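(* Assume hypotheses (A1)–(A6) and (A9) listed in the context hold, and $d\ge2$. For $\epsilon>0$ let $(u^\epsilon,m^\epsilon)$ be a solution of the regularized system described in the context. Then for every $1\le r<\frac{d(1+\mu)}{d(1+\mu)-2}$, $\|m^\epsilon\|_{L^\infty(0,T;L^r(\mathbb{T}^d))}$ is bounded uniformly in $\epsilon$.
   Context: $\mathbb{T}^d$ is the $d$-dimensional flat torus, $T>0$ fixed. Data: $H:\mathbb{T}^d\times\mathbb{R}^d\to\mathbb{R}$, $g:[0,\infty)\to\mathbb{R}$, $u_T,m_0:\mathbb{T}^d\to\mathbb{R}$. Hypotheses: (A1) $H$ is $C^\infty$; $p\mapsto H(x,p)$ strictly convex; $\lim_{|p|\to\infty}H(x,p)/|p|=+\infty$; $H\ge1$. (A2) $g$ non-negative and increasing; $u_T,m_0\in C^\infty(\mathbb{T}^d)$, $m_0\ge0$, $\int m_0=1$. (A3) With $\hat L(x,p)=D_pH(x,p)\cdot p-H(x,p)$, there are $c,C>0$ with $\hat L\ge cH-C$. (A4) $g(z)=z^\alpha$, $\alpha>0$. (A5) $|D_xH|,|D^2_{xx}H|\le CH+C$, and for every symmetric matrix $M$ and $\delta>0$ there is $C_\delta$ with $\operatorname{tr}(D^2_{px}H M)\le\delta\operatorname{tr}(D^2_{pp}HM^2)+C_\delta H$. (A6) $m_0\ge\kappa_0>0$ for a constant $\kappa_0$. (A9) For a constant $\mu$ with $0<\mu<1$: $|D^2_{xp}H|^2\le CH^{\frac{2+2\mu}{2+\mu}}$ and, for every symmetric $M$, $|D^2_{pp}HM|^2\le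 CH^{\frac{\mu}{2+\mu}}\operatorname{tr}(D^2_{pp}HMM)$. Regularized system: $\eta_\epsilon$ is a standard symmetric mollifying kernel and $g_\epsilon(m)=\eta_\epsilon*g(\eta_\epsilon*m)$. A solution is a pair of smooth functions $u^\epsilon,m^\epsilon$ on $\mathbb{T}^d\times[0,T]$ with $-u^\epsilon_t+H(x,Du^\epsilon)=\Delta u^\epsilon+g_\epsilon(m^\epsilon)$, $m^\epsilon_t-\operatorname{div}(D_pH(x,Du^\epsilon)m^\epsilon)=\Delta m^\epsilon$, $u^\epsilon(x,T)=u_T(x)$, $m^\epsilon(x,0)=m_0(x)$. *)

(* Defs.v *)
From HB Require Import structures.
From mathcomp Require Import all_boot all_order all_algebra.
From mathcomp Require Import all_classical all_reals all_analysis.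
Set Implicit Arguments. Unset Strict Implicit. Unset Printing Implicit Defensive.
Import Order.TTheory GRing.Theory Num.Theory.
Import numFieldNormedType.Exports.
Local Open Scope classical_set_scope.
Local Open Scope ring_scope.

Section Defs.
Variable R : realType.

Definition ebasis (n : nat) (i : 'I_n) : 'rV[R]_n := delta_mx 0 i.

Definition dpartial (n : nat) (i : 'I_n) (f : 'rV[R]_n -> R) : 'rV[R]_n -> R :=
  fun x => 'D_(ebasis i) f x.

Definition iter_partial (n : nat) (s : seq 'I_n) (f : 'rV[R]_n -> R) :=
  foldr (@dpartial n) f s.

Definition Cinf (n : nat) (f : 'rV[R]_n -> R) : Prop :=
  forall s : seq 'I_n, continuous (iter_partial s f) /\
    forall (i : 'I_n) (x : 'rV[R]_n), derivable (iter_partial s f) x (ebasis i).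

(* 1-Zperiodic in each variable: a function on the flat torus T^n = R^n/Z^n *)
Definition Zperiodic (n : nat) (f : 'rV[R]_n -> R) : Prop :=
  forall (x : 'rV[R]_n) (i : 'I_n), f (x + ebasis i) = f x.

Definition smooth_slab (d : nat) (T : R) (F : 'rV[R]_d -> R -> R) : Prop :=
  (exists G : 'rV[R]_(d + 1) -> R, Cinf G /\
     forall x t, 0 <= t <= T -> G (row_mx x (const_mx t)) = F x t) /\
  forall t, Zperiodic (fun x => F x t).

Definition smooth2 (d : nat) (H : 'rV[R]_d -> 'rV[R]_d -> R) : Prop :=
  Cinf (fun z : 'rV[R]_(d + d) => H (lsubmx z) (rsubmx z)).

Fixpoint iter_int (A : set R) (n : nat) : ('rV[R]_n -> R) -> R :=
  match n with
  | 0 => fun f => f 0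
  | n'.+1 => fun f => Rintegral (@lebesgue_measure R) A
                 (fun t => iter_int A (fun v : 'rV[R]_n' =>
                     f (row_mx (const_mx t : 'rV[R]_1) v)))
  end.

Definition int_Rn (n : nat) (f : 'rV[R]_n -> R) : R := iter_int setT f.
Definition int_torus (n : nat) (f : 'rV[R]_n -> R) : R := iter_int `[0, 1] f.

Definition euclid_norm (n : nat) (v : 'rV[R]_n) : R :=
  Num.sqrt (\sum_i v 0 i ^+ 2).
Definition frob_norm (n : nat) (A : 'M[R]_n) : R :=
  Num.sqrt (\sum_i \sum_j A i j ^+ 2).

Definition Lr_norm (n : nat) (r : R) (f : 'rV[R]_n -> R) : R :=
  powR (int_torus (fun x => powR `|f x| r)) r^-1.

Definition mollifier (d : nat) (eta : 'rV[R]_d -> R) : Prop :=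
  [/\ Cinf eta, (forall x, 0 <= eta x),
      (forall x, 1 <= euclid_norm x -> eta x = 0),
      (forall x, eta (- x) = eta x) & int_Rn eta = 1].

Definition eta_eps (d : nat) (eta : 'rV[R]_d -> R) (eps : R) (x : 'rV[R]_d) : R :=
  eps ^- d * eta (eps^-1 *: x).

(* convolution on the torus (f Zperiodic, kernel compactly supported) *)
Definition tconv (d : nat) (k f : 'rV[R]_d -> R) (x : 'rV[R]_d) : R :=
  int_Rn (fun y => k y * f (x - y)).

Definition DpH d (H : 'rV[R]_d -> 'rV[R]_d -> R) x p : 'rV[R]_d :=
  \row_i 'D_(ebasis i) (H x) p.
Definition DxH d (H : 'rV[R]_d -> 'rV[R]_d -> R) x p : 'rV[R]_d :=
  \row_i 'D_(ebasis i) (fun y => H y p) x.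
Definition D2ppH d (H : 'rV[R]_d -> 'rV[R]_d -> R) x p : 'M[R]_d :=
  \matrix_(i, j) 'D_(ebasis i) (fun q => 'D_(ebasis j) (H x) q) p.
Definition D2xxH d (H : 'rV[R]_d -> 'rV[R]_d -> R) x p : 'M[R]_d :=
  \matrix_(i, j) 'D_(ebasis i) (fun y => 'D_(ebasis j) (fun z => H z p) y) x.
Definition D2pxH d (H : 'rV[R]_d -> 'rV[R]_d -> R) x p : 'M[R]_d :=
  \matrix_(i, j) 'D_(ebasis i) (fun q => 'D_(ebasis j) (fun y => H y q) x) p.
Definition D2xpH d (H : 'rV[R]_d -> 'rV[R]_d -> R) x p : 'M[R]_d :=
  \matrix_(i, j) 'D_(ebasis i) (fun y => 'D_(ebasis j) (H y) p) x.

Definition dotv d (a b : 'rV[R]_d) : R := \sum_i a 0 i * b 0 i.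

Definition Lhat d (H : 'rV[R]_d -> 'rV[R]_d -> R) x p : R :=
  dotv (DpH H x p) p - H x p.

Definition gradx d (F : 'rV[R]_d -> R -> R) x t : 'rV[R]_d :=
  \row_i 'D_(ebasis i) (fun y => F y t) x.
Definition lapx d (F : 'rV[R]_d -> R -> R) x t : R :=
  \sum_i 'D_(ebasis i) (fun y => 'D_(ebasis i) (fun z => F z t) y) x.
Definition dtime d (F : 'rV[R]_d -> R -> R) x t : R :=
  'D_1 (fun s => F x s) t.

Definition divx d (V : 'rV[R]_d -> 'rV[R]_d) (x : 'rV[R]_d) : R :=
  \sum_i 'D_(ebasis i) (fun y => V y 0 i) x.

Definition gpow (alpha : R) (z : R) : R := powR z alpha.

Definition g_eps d (alpha : R) (eta : 'rV[R]_d -> R) (eps : R)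
  (m : 'rV[R]_d -> R) (x : 'rV[R]_d) : R :=
  tconv (eta_eps eta eps) (fun y => gpow alpha (tconv (eta_eps eta eps) m y)) x.

Definition reg_solution d (T : R) (H : 'rV[R]_d -> 'rV[R]_d -> R) (alpha : R)
  (eta : 'rV[R]_d -> R) (eps : R) (uT m0 : 'rV[R]_d -> R)
  (u m : 'rV[R]_d -> R -> R) : Prop :=
  [/\ smooth_slab T u /\ smooth_slab T m,
      (forall x t, 0 < t < T ->
        - dtime u x t + H x (gradx u x t)
          = lapx u x t + g_eps alpha eta eps (fun y => m y t) x),
      (forall x t, 0 < t < T ->
        dtime m x t - divx (fun y => m y t *: DpH H y (gradx u y t)) x
          = lapx m x t),
      (forall x, u x T = uT x) &
      (forall x, m x 0 = m0 x)].

End Defs.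

(* Main.v *)
(* Write h = H(x, Du) and b = D_pH(x, Du), and let z be the mollified density, so that
   g_eps(m) = eta * z^alpha.

   Testing the Fokker-Planck equation with u and with Delta u, and integrating the
   Hamilton-Jacobi equation in x, gives the derivatives of P = int u m, Q = int u and
   W = int (Delta u) m.  The coupling contributes to W' the term - int (Delta g_eps(m)) m,
   which is nonnegative because s |-> int g_eps(m)(x) m(x + s e) is largest at s = 0.  By (A3),
   (A5) and K z^alpha <= z^(1+alpha) + K^(1+alpha), the combination Phi = W - K'(P - K Q)
   satisfies Phi' >= B/2 - const with B = int (h + tr(D2_pp H (D^2 u)^2)) m.  At t = T, Phi is
   bounded by the data and the mass of m; at t = 0 it is int u(., 0) w with an explicit weight
   w >= 0 when K is large, and u is bounded below by the maximum principle.  Hence B is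
   bounded in L^1(0, T), uniformly in eps.

   By (A9), |div b| <= C X^theta, where X = h + tr(D2_pp H (D^2 u)^2) and
   theta = (1 + mu)/(2 + mu).  For y = int m^r and E = int m^(r-2) |Dm|^2 this gives
     y' <= (r - 1) (C int m^r X^theta - r E),
     m^r X^theta <= l X m + l^(-(1+mu)) m^e,     e = 1 + (r - 1)(2 + mu).
   The assumption on r says exactly e <= r (1 + 2/d), where the Gagliardo-Nirenberg inequality
   int m^(r(1+2/d)) <= C y^(2/d) (y + E) applies.  With S = max(1, sup y) and l of order
   S^(2/(d(1+mu))) the gradient term is absorbed, and integration in time yields
   S <= a + b S^(2/(d(1+mu))) + S/2.  The exponent is smaller than 1, so S is bounded. *)
Require Import Defs.
From HB Require Import structures.
From mathcomp Require Import all_boot all_order all_algebra.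
From mathcomp Require Import all_classical all_reals all_analysis.
From mathcomp Require Import lra ring.
Set Implicit Arguments. Unset Strict Implicit. Unset Printing Implicit Defensive.
Import Order.TTheory GRing.Theory Num.Theory.
Import numFieldNormedType.Exports.
Local Open Scope classical_set_scope.
Local Open Scope ring_scope.

(** * Calculus on row vectors *)

(** The obstacle is the missing upper bound on u: no bound on g_eps(m) independent of eps is at
    hand, and the maximum principle bounds u from below only. This is why int u enters Phi with the
    factor K' K. At t = 0 it turns int u (Delta m_0 - K' m_0) into an integral of u against a
    nonnegative weight, for which a lower bound suffices. The price is the term - K' K int g_eps(m)
    in Phi', and the term K' int g_eps(m) m coming from P pays for it. The factor K' itself is
    chosen so that (A3) outweighs the loss in int h m caused by (A5). A solution is accessed through
    a smooth extension to all times, but periodicity, positivity and the equations are known for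
    this extension only on the slab. Differential identities are therefore used at interior times,
    and the end points are reached by continuity. The bound (A6) propagates to m > 0, so all real
    powers of m are smooth in x. Uniformity in eps is a matter of quantifiers: every constant is
    fixed before the kernel, of which only continuity, evenness, sign, mass one and compact support
    are used. *)

Section lines.
Context {R : realType}.

Lemma continuous_sum (S : topologicalType) n (f : 'I_n -> S -> R) :
  (forall i, continuous (f i)) -> continuous (fun x => \sum_i f i x).
Proof.
by move=> cf; apply: continuous_big => [|i _]; [exact: add_continuous|exact: cf].
Qed.

Lemma continuousMc (S : topologicalType) (f g : S -> R) :
  continuous f -> continuous g -> continuous (fun x => f x * g x).
Proof. by move=> cf cg x; apply: cvgM; [exact: cf|exact: cg]. Qed.

Lemma continuousDc (S : topologicalType) (f g : S -> R) :
  continuous f -> continuous g -> continuous (fun x => f x + g x).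
Proof. by move=> cf cg x; apply: cvgD; [exact: cf|exact: cg]. Qed.

Lemma continuousNc (S : topologicalType) (f : S -> R) :
  continuous f -> continuous (fun x => - f x).
Proof. by move=> cf x; apply: cvgN; exact: cf. Qed.

Lemma continuousZc (S : topologicalType) (a : R) (f : S -> R) :
  continuous f -> continuous (fun x => a * f x).
Proof. by move=> cf x; apply: cvgM; [exact: cvg_cst|exact: cf]. Qed.

(** Both derivatives are limits of the same difference quotient. This lets statements about
    directional derivatives be checked on lines with one-variable theorems. *)
Lemma is_derive_line (V : normedModType R) (f : V -> R) (x v : V) (s : R) :
  derivable f (x + s *: v) v ->
  is_derive s 1 (fun h => f (x + h *: v)) ('D_v f (x + s *: v)).
Proof.
have E : (fun h : R => h^-1 *: (f (x + ((h *: 1 : R) + s) *: v) - f (x + s *: v)))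
       = (fun h => h^-1 *: (f (h *: v + (x + s *: v)) - f (x + s *: v))).
  apply/funext => h; congr (_ *: (f _ - _)).
  by rewrite [h *: 1 : R]mulr1 scalerDl addrCA.
move=> df; split; first by rewrite /derivable /= E.
by rewrite /derive /= E.
Qed.

Lemma derivable_line0 (V : normedModType R) (f : V -> R) (x v : V) (df : R) :
  is_derive (0 : R) 1 (fun h => f (x + h *: v)) df -> is_derive x v f df.
Proof.
have E : (fun h : R => h^-1 *: (f (x + ((h *: 1 : R) + 0) *: v) - f (x + 0 *: v)))
       = (fun h => h^-1 *: (f (h *: v + x) - f x)).
  apply/funext => h; congr (_ *: (f _ - f _)); last by rewrite scale0r addr0.
  by rewrite [h *: 1 : R]mulr1 addr0 addrC.
case=> + <-; rewrite /derivable /derive /= E => ?.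
by split.
Qed.

(** The step s may have either sign; bounding [|c|] by [|s|] gives one statement for both orders of
    the end points. *)
Lemma mvt_line (V : normedModType R) (f : V -> R) (x v : V) (s : R) :
  (forall y, derivable f y v) ->
  exists2 c, `|c| <= `|s| & f (x + s *: v) - f x = s * 'D_v f (x + c *: v).
Proof.
move=> df.
have dl (r : R) : is_derive r 1 (fun h => f (x + h *: v)) ('D_v f (x + r *: v)).
  exact: is_derive_line.
have cl : continuous (fun h : R => f (x + h *: v)).
  by move=> r; apply/differentiable_continuous/derivable1_diffP; apply: ex_derive.
have [s0|s0] := leP 0 s.
  have [|c] := @MVT_segment R _ _ 0 s s0 (fun r _ => dl r).
    exact: continuous_subspaceT.
  rewrite in_itv /= => /andP[c0 cs]; rewrite scale0r addr0 subr0 mulrC => ->.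
  by exists c => //; rewrite !ger0_norm.
have [|c] := @MVT_segment R _ _ s 0 (ltW s0) (fun r _ => dl r).
  exact: continuous_subspaceT.
rewrite in_itv /= => /andP[cs c0]; rewrite scale0r addr0 sub0r => E.
exists c; first by rewrite !ler0_norm ?lerN2 // ltW.
by rewrite -[LHS]opprB E; ring.
Qed.

Lemma cvg_rV (S : Type) (F : set_system S) (FF : Filter F) n (f : S -> 'rV[R]_n)
  (l : 'rV[R]_n) :
  (forall j, (fun s => f s 0 j) @ F --> l 0 j) -> f @ F --> l.
Proof.
move=> cf; apply/cvgrPdist_le => /= e e0.
near=> x.
rewrite /Num.Def.normr/= mx_normrE (bigmax_le _ (ltW e0))//= => -[i j] _.
rewrite !mxE ord1 /=.
move: j; near: x; apply: filter_forall => /= j.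
exact: ((cvgrPdist_le _ _).1 (cf j)).
Unshelve. all: by end_near. Qed.

Lemma ler_norm_rV n (v : 'rV[R]_n) (c : R) : 0 <= c ->
  (forall j, `|v 0 j| <= c) -> `|v| <= c.
Proof.
move=> c0 vc; rewrite /Num.Def.normr/= mx_normrE (bigmax_le _ c0)//= => -[i j] _.
by rewrite ord1; exact: vc.
Qed.

Lemma ler_coord_norm n (v : 'rV[R]_n) j : `|v 0 j| <= `|v|.
Proof.
rewrite [in leRHS]/Num.Def.normr/= mx_normrE.
exact: (le_bigmax _ _ (0, j)).
Qed.

End lines.

(** * Functions with continuous partial derivatives up to order k *)

Section Ck.
Context {R : realType}.

(** Finite-order counterpart of [Cinf]. Induction on k handles products, compositions and powers,
    where [Cinf] would call for a description of every iterated partial derivative. *)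
Fixpoint Ck (k n : nat) (f : 'rV[R]_n -> R) : Prop :=
  continuous f /\
  if k is k'.+1 then forall i, (forall x, derivable f x (ebasis R i)) /\ Ck k' (dpartial i f)
  else True.

Lemma Ck_cont k n (f : 'rV[R]_n -> R) : Ck k f -> continuous f.
Proof. by case: k => [|k] []. Qed.

Lemma CkS k n (f : 'rV[R]_n -> R) : Ck k.+1 f -> Ck k f.
Proof.
elim: k n f => [|k IH] n f [cf df] //.
by split=> // i; have [? /IH] := df i.
Qed.

Lemma CkW k l n (f : 'rV[R]_n -> R) : (l <= k)%N -> Ck k f -> Ck l f.
Proof.
move=> /subnK <-; elim: (k - l)%N => [//|p IH] /=.
by move/CkS; exact: IH.
Qed.

Lemma Ck_dpartial k n i (f : 'rV[R]_n -> R) : Ck k.+1 f -> Ck k (dpartial i f).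
Proof. by case=> _ /(_ i)[]. Qed.

Lemma Ck_derivable k n i (f : 'rV[R]_n -> R) x : Ck k.+1 f -> derivable f x (ebasis R i).
Proof. by case=> _ /(_ i)[]. Qed.

Lemma Cinf_Ck k n (f : 'rV[R]_n -> R) : Cinf f -> Ck k f.
Proof.
(* The induction treats all iterated partials at once, since a partial derivative of
   [iter_partial s f] is an iterated partial for a longer sequence. *)
move=> Cf; have : forall s, Ck k (iter_partial s f).
  elim: k => [|k IH] s; first by split=> //; have [] := Cf s.
  split; first by have [] := Cf s.
  move=> i; split; first by have [_] := Cf s; exact.
  exact: (IH (i :: s)).
by move/(_ [::]).
Qed.

Definition gradlin n (f : 'rV[R]_n -> R) (x h : 'rV[R]_n) : R :=
  \sum_j h 0 j * dpartial j f x.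

Fact gradlin_linear n (f : 'rV[R]_n -> R) x : linear (gradlin f x).
Proof.
move=> a u v; rewrite /gradlin scaler_sumr -big_split /=; apply: eq_bigr => j _.
by rewrite !mxE mulrDl -mulrA.
Qed.
HB.instance Definition _ n (f : 'rV[R]_n -> R) x :=
  GRing.isLinear.Build R 'rV[R]_n R _ (gradlin f x) (gradlin_linear f x).

Lemma gradlin_continuous n (f : 'rV[R]_n -> R) x : continuous (gradlin f x).
Proof.
apply: continuous_sum => j; by apply: continuousMc; [exact: coord_continuous|exact: cst_continuous].
Qed.

(* The increment is split into one coordinate step at a time, and the mean value theorem is
   applied to each step. *)
Lemma Ck1_taylor n (f : 'rV[R]_n -> R) x (e : {posnum R}) : Ck 1 f ->
  \forall h \near (0 : 'rV[R]_n),
    `|f (h + x) - (f x + gradlin f x h)| <= e%:num * `|h|.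
Proof.
case=> cf df.
pose e' := e%:num / n.+1%:R.
have e'0 : 0 < e' by rewrite divr_gt0.
have : \forall y \near x, forall j, `|dpartial j f x - dpartial j f y| <= e'.
  apply: (filter_forall (F := nbhs x)) => j; have [_ [cd _]] := df j.
  by have /cvgrPdist_le /(_ _ e'0) := cd x.
move=> /nbhs_ballP[r /= r0 rP].
near=> h.
have hr : `|h| < r.
  near: h; apply/nbhs_ballP; exists r => //= y; rewrite -ball_normE /= sub0r normrN //.
pose tr k : 'rV[R]_n := \row_j (if (j < k)%N then h 0 j else 0).
have tr0 : tr 0 = 0 by apply/rowP => j; rewrite !mxE.
have trn : tr n = h by apply/rowP => j; rewrite !mxE ltn_ord.
have trS (k : 'I_n) : tr k.+1 = tr k + h 0 k *: ebasis R k.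
  apply/rowP => j; rewrite !mxE eqxx /= ltnS leq_eqVlt.
  have [/val_inj <-|jk] /= := eqVneq (val j) (val k).
    by rewrite eqxx ltnn mulr1 add0r.
  case: ltnP => _; rewrite ?mulr0 ?addr0 //=;
   have -> : (j == k) = false by [apply/negbTE]; by rewrite mulr0 addr0.
have -> : f (h + x) - (f x + gradlin f x h) =
   \sum_(k < n) ((f (x + tr k.+1) - f (x + tr k)) - h 0 k * dpartial k f x).
  rewrite sumrB -(big_mkord xpredT (fun k => f (x + tr k.+1) - f (x + tr k))).
  rewrite telescope_sumr // trn tr0 addr0 /= opprD addrA.
  by rewrite [h + x]addrC.
apply: le_trans (ler_norm_sum _ _ _) _.
apply: (@le_trans _ _ (\sum_(k < n) (e' * `|h|))); last first.
  rewrite sumr_const card_ord -[leLHS]mulr_natr /e' /=.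
  have -> : e%:num / n.+1%:R * `|h| * n%:R = (e%:num * `|h|) * (n%:R / n.+1%:R) by ring.
  by rewrite ler_piMr // ?mulr_ge0 // ler_pdivrMr // mul1r ler_nat.
apply: ler_sum => k _.
have [dk _] := df k.
have [c ck E] := mvt_line (x + tr k) (h 0 k) dk.
rewrite trS addrA E -mulrBr normrM mulrC ler_pM ?ler_coord_norm //.
rewrite distrC; apply: (rP (x + tr k + c *: ebasis R k)) => //=.
rewrite -ball_normE /= -addrA opprD addrA subrr sub0r normrN.
apply: le_lt_trans hr; apply: ler_norm_rV => // j; rewrite !mxE eqxx /=.
have [<-|jk] := eqVneq k j.
  by rewrite ltnn add0r mulr1 (le_trans ck)// ler_coord_norm.
by rewrite mulr0 addr0; case: ifP => _; rewrite ?normr0 ?ler_coord_norm.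
Unshelve. all: by end_near. Qed.

(** The full differential is extracted from the partial derivatives because the chain rule for maps
    between row vectors goes through it. *)
Lemma Ck1_diff n (f : 'rV[R]_n -> R) x : Ck 1 f ->
  differentiable f x /\ forall h, 'd f x h = gradlin f x h.
Proof.
move=> Cf.
have D : 'd f x = gradlin f x :> (_ -> _).
  apply: diff_unique; first exact: gradlin_continuous.
  apply/eqaddoP => /= _ /posnumP[e]; exact: Ck1_taylor.
split=> [|h]; last by rewrite D.
apply/diff_locallyP; rewrite D; split; first exact: gradlin_continuous.
by apply/eqaddoP => /= _ /posnumP[e]; exact: Ck1_taylor.
Qed.

Lemma is_derive_comp_rV (V : normedModType R) n (f : 'rV[R]_n -> R)
    (phi : V -> 'rV[R]_n) (dphi : 'I_n -> R) x v : Ck 1 f ->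
  differentiable phi x ->
  (forall j, is_derive x v (fun y => phi y 0 j) (dphi j)) ->
  is_derive x v (f \o phi) (\sum_j dphi j * dpartial j f (phi x)).
Proof.
move=> Cf dphix dj; have [df E] := Ck1_diff (phi x) Cf.
have dc : differentiable (f \o phi) x by exact: differentiable_comp.
split; first exact: diff_derivable.
rewrite deriveE // diff_comp //= E /gradlin; apply: eq_bigr => j _.
congr (_ * _); rewrite -deriveE // derive_mx; last exact: diff_derivable.
by rewrite mxE; apply: derive_val.
Qed.

End Ck.

(** * Closure properties, chain rules and symmetry of second derivatives *)

Section Ck_closure.
Context {R : realType}.

Lemma Ck_cst k n (c : R) : Ck k (fun _ : 'rV[R]_n => c).
Proof.
elim: k c => [|k IH] c /=; first by split=> //; exact: cst_continuous.
split; first exact: cst_continuous.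
move=> i; split=> [x|]; first exact: derivable_cst.
have -> : dpartial i (fun _ : 'rV[R]_n => c) = (fun _ => 0).
  by apply/funext => x; rewrite /dpartial derive_cst.
exact: IH.
Qed.

Lemma dpartialD n i (f g : 'rV[R]_n -> R) : Ck 1 f -> Ck 1 g ->
  dpartial i (fun x => f x + g x) = (fun x => dpartial i f x + dpartial i g x).
Proof.
move=> [_ df] [_ dg]; apply/funext => x; rewrite /dpartial.
by rewrite deriveD; [|exact: (df i).1|exact: (dg i).1].
Qed.

Lemma dpartialM n i (f g : 'rV[R]_n -> R) : Ck 1 f -> Ck 1 g ->
  dpartial i (fun x => f x * g x) =
  (fun x => f x * dpartial i g x + dpartial i f x * g x).
Proof.
move=> [_ df] [_ dg]; apply/funext => x; rewrite /dpartial.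
rewrite deriveM; [|exact: (df i).1|exact: (dg i).1].
by congr (_ + _); rewrite mulrC.
Qed.

Lemma CkD k n (f g : 'rV[R]_n -> R) : Ck k f -> Ck k g -> Ck k (fun x => f x + g x).
Proof.
elim: k f g => [|k IH] f g Cf Cg.
  by split=> //; apply: continuousDc; [case: Cf|case: Cg].
split; first by apply: continuousDc; [case: Cf|case: Cg].
move=> i; split=> [x|].
  by apply: derivableD; [apply: Ck_derivable Cf|apply: Ck_derivable Cg].
rewrite dpartialD; [|exact: CkW Cf|exact: CkW Cg].
by apply: IH; exact: Ck_dpartial.
Qed.

Lemma CkM k n (f g : 'rV[R]_n -> R) : Ck k f -> Ck k g -> Ck k (fun x => f x * g x).
Proof.
elim: k f g => [|k IH] f g Cf Cg.
  by split=> //; apply: continuousMc; [case: Cf|case: Cg].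
split; first by apply: continuousMc; [case: Cf|case: Cg].
move=> i; split=> [x|].
  by apply: derivableM; [apply: Ck_derivable Cf|apply: Ck_derivable Cg].
rewrite dpartialM; [|exact: CkW Cf|exact: CkW Cg].
by apply: CkD; apply: IH; [exact: CkS|exact: Ck_dpartial|exact: Ck_dpartial|exact: CkS].
Qed.

Lemma Ck_sum k n (I : Type) (r : seq I) (f : I -> 'rV[R]_n -> R) :
  (forall j, Ck k (f j)) -> Ck k (fun x => \sum_(j <- r) f j x).
Proof.
move=> Cf; elim: r => [|j r IH].
  have -> : (fun x => \sum_(j <- [::]) f j x) = (fun _ : 'rV[R]_n => 0).
    by apply/funext => x; rewrite big_nil.
  exact: Ck_cst.
have -> : (fun x => \sum_(l <- j :: r) f l x) = (fun x => f j x + \sum_(l <- r) f l x).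
  by apply/funext => x; rewrite big_cons.
exact: CkD.
Qed.

Lemma dpartial_sum n i (I : Type) (r : seq I) (f : I -> 'rV[R]_n -> R) :
  (forall j, Ck 1 (f j)) ->
  dpartial i (fun x => \sum_(j <- r) f j x) = (fun x => \sum_(j <- r) dpartial i (f j) x).
Proof.
move=> Cf; elim: r => [|j r IH].
  have -> : (fun x => \sum_(j <- [::]) f j x) = (fun _ : 'rV[R]_n => 0).
    by apply/funext => x; rewrite big_nil.
  by apply/funext => x; rewrite /dpartial derive_cst big_nil.
have -> : (fun x => \sum_(l <- j :: r) f l x) = (fun x => f j x + \sum_(l <- r) f l x).
  by apply/funext => x; rewrite big_cons.
rewrite dpartialD //; last exact: Ck_sum.
by apply/funext => x; rewrite IH big_cons.
Qed.

Lemma dpartialZ n i c (f : 'rV[R]_n -> R) : Ck 1 f ->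
  dpartial i (fun x => c * f x) = (fun x => c * dpartial i f x).
Proof.
move=> Cf; rewrite (dpartialM i (Ck_cst 1 n c) Cf); apply/funext => x.
by rewrite [X in _ + X * _](_ : _ = 0) ?mul0r ?addr0 // /dpartial derive_cst.
Qed.

Lemma CkZ k n c (f : 'rV[R]_n -> R) : Ck k f -> Ck k (fun x => c * f x).
Proof. by move=> Cf; apply: CkM => //; exact: Ck_cst. Qed.

Lemma CkN k n (f : 'rV[R]_n -> R) : Ck k f -> Ck k (fun x => - f x).
Proof. by move/(CkZ (-1)); under eq_fun do rewrite mulN1r. Qed.

Lemma dpartialN n i (f : 'rV[R]_n -> R) : Ck 1 f ->
  dpartial i (fun x => - f x) = (fun x => - dpartial i f x).
Proof.
move=> Cf; have := dpartialZ i (-1) Cf.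
under eq_fun do rewrite mulN1r; move=> ->.
by apply/funext => x; rewrite mulN1r.
Qed.

Lemma Ck_differentiable_rV n N (phi : 'rV[R]_n -> 'rV[R]_N) x :
  (forall j, Ck 1 (fun y => phi y 0 j)) -> differentiable phi x.
Proof.
move=> Cphi.
have -> : phi = \sum_j (fun y => phi y 0 j *: (delta_mx 0 j : 'rV[R]_N)).
  by apply/funext => y; rewrite fct_sumE [LHS]row_sum_delta.
apply: differentiable_sum => j; apply: differentiableZl.
by have [] := Ck1_diff x (Cphi j).
Qed.

Lemma is_derive_comp n N (f : 'rV[R]_N -> R) (phi : 'rV[R]_n -> 'rV[R]_N) i x :
  Ck 1 f -> (forall j, Ck 1 (fun y => phi y 0 j)) ->
  is_derive x (ebasis R i) (fun y => f (phi y))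
   (\sum_j dpartial i (fun y => phi y 0 j) x * dpartial j f (phi x)).
Proof.
move=> Cf Cphi; apply: is_derive_comp_rV => //.
  exact: Ck_differentiable_rV.
by move=> j; apply: derivableP; have [_ /(_ i)[]] := Cphi j.
Qed.

Lemma dpartial_comp n N (f : 'rV[R]_N -> R) (phi : 'rV[R]_n -> 'rV[R]_N) i :
  Ck 1 f -> (forall j, Ck 1 (fun y => phi y 0 j)) ->
  dpartial i (fun y => f (phi y)) =
   (fun x => \sum_j dpartial i (fun y => phi y 0 j) x * dpartial j f (phi x)).
Proof.
by move=> Cf Cphi; apply/funext => x; apply: derive_val; exact: is_derive_comp.
Qed.

Lemma Ck_comp k n N (f : 'rV[R]_N -> R) (phi : 'rV[R]_n -> 'rV[R]_N) :
  Ck k f -> (forall j, Ck k (fun y => phi y 0 j)) -> Ck k (fun y => f (phi y)).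
Proof.
elim: k f => [|k IH] f Cf Cphi.
  split=> // x; apply: (@continuous_comp _ _ _ phi f); last by have [cf _] := Cf; exact: cf.
  by apply: (@cvg_rV _ _ (nbhs x) _) => j; have [cp _] := Cphi j; exact: cp.
have cc : continuous (fun y => f (phi y)).
  move=> x; apply: (@continuous_comp _ _ _ phi f); last by have [cf _] := Cf; exact: cf.
  by apply: (@cvg_rV _ _ (nbhs x) _) => j; have [cp _] := Cphi j; exact: cp.
split=> // i.
have Cf1 : Ck 1 f by exact: CkW Cf.
have Cphi1 j : Ck 1 (fun y => phi y 0 j) by exact: CkW (Cphi j).
split=> [x|]; first by apply: ex_derive; exact: is_derive_comp.
rewrite dpartial_comp //; apply: Ck_sum => j; apply: CkM.
  exact: Ck_dpartial.
by apply: IH => [|l]; [exact: Ck_dpartial|exact: CkS].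
Qed.

(** On the line through x in direction v this is the one-variable chain rule, so only
    differentiability of f along v enters. *)
Lemma is_derive_fcomp (V : normedModType R) (g : R -> R) (f : V -> R) x v a b :
  is_derive (f x) 1 g a -> is_derive x v f b -> is_derive x v (fun y => g (f y)) (a * b).
Proof.
move=> dg df; apply: derivable_line0.
have dl : is_derive (0 : R) 1 (fun h : R => f (x + h *: v)) b.
  have [d <-] := df.
  have e : x + 0 *: v = x by rewrite scale0r addr0.
  by have := @is_derive_line _ V f x v 0; rewrite e; apply.
apply: (@is_derive1_comp R g (fun h : R => f (x + h *: v)) 0 a b) => //.
by rewrite scale0r addr0.
Qed.

Lemma dpartial_powR n i (f : 'rV[R]_n -> R) a : Ck 1 f -> (forall x, 0 < f x) ->
  (forall x, is_derive x (ebasis R i) (fun y => powR (f y) a)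
     (a * powR (f x) (a - 1) * dpartial i f x)).
Proof.
move=> [_ df] f0 x.
have h1 : is_derive x (ebasis R i) f (dpartial i f x).
  by apply: derivableP; exact: (df i).1.
have h2 : is_derive (f x) 1 ((@powR R) ^~ a) (a * powR (f x) (a - 1)).
  exact: is_derive1_powR.
exact: (is_derive_fcomp h2 h1).
Qed.

Lemma powR_continuous_pos (S : topologicalType) (f : S -> R) a x :
  {for x, continuous f} -> 0 < f x -> {for x, continuous (fun y => powR (f y) a)}.
Proof.
move=> cf f0; apply: (@continuous_comp _ _ _ f ((@powR R) ^~ a)) => //.
apply/differentiable_continuous/derivable1_diffP.
by apply: ex_derive; exact: is_derive1_powR.
Qed.

Lemma Ck_powR k n (f : 'rV[R]_n -> R) a : Ck k f -> (forall x, 0 < f x) ->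
  Ck k (fun x => powR (f x) a).
Proof.
(* The exponent is generalized because the derivative involves the power [a - 1]. *)
move=> + f0; elim: k a => [|k IH] a Cf.
  by split=> // x; apply: powR_continuous_pos => //; case: Cf => + _; exact.
split; first by move=> x; apply: powR_continuous_pos => //; case: Cf => + _; exact.
have Cf1 : Ck 1 f by exact: CkW Cf.
move=> i; split=> [x|].
  by apply: ex_derive; exact: dpartial_powR.
have -> : dpartial i (fun x => powR (f x) a) =
   (fun x => a * powR (f x) (a - 1) * dpartial i f x).
  by apply/funext => x; apply: derive_val; exact: dpartial_powR.
apply: CkM; last exact: Ck_dpartial.
by apply: CkZ; apply: IH; exact: CkS.
Qed.

Lemma derive_shiftw (V : normedModType R) (f : V -> R) (w v x : V) :
  'D_v (fun y => f (y + w)) x = 'D_v f (x + w).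
Proof.
rewrite /derive /=.
suff -> : (fun h : R => h^-1 *: (f (h *: v + x + w) - f (x + w))) =
  (fun h : R => h^-1 *: (f (h *: v + (x + w)) - f (x + w))) by [].
by apply/funext => h; rewrite addrA.
Qed.

Lemma derivable_shiftw (V : normedModType R) (f : V -> R) (w v x : V) :
  derivable f (x + w) v -> derivable (fun y => f (y + w)) x v.
Proof.
rewrite /derivable /=.
suff -> : (fun h : R => h^-1 *: (f (h *: v + x + w) - f (x + w))) =
  (fun h : R => h^-1 *: (f (h *: v + (x + w)) - f (x + w))) by [].
by apply/funext => h; rewrite addrA.
Qed.

(** The mean value theorem is applied twice: along e_i to the increment f(y + s e_j) - f(y), then
    along e_j to the partial derivative of f in direction i. *)
Lemma second_difference n (f : 'rV[R]_n -> R) i j x (s : R) : Ck 2 f ->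
  exists c c' : R, [/\ `|c| <= `|s|, `|c'| <= `|s| &
    f (x + s *: ebasis R i + s *: ebasis R j) - f (x + s *: ebasis R i)
    - (f (x + s *: ebasis R j) - f x)
    = s * (s * dpartial j (dpartial i f) (x + c *: ebasis R i + c' *: ebasis R j))].
Proof.
move=> Cf; have di y : derivable f y (ebasis R i) by exact: Ck_derivable Cf.
pose g y := f (y + s *: ebasis R j) - f y.
have dg y : derivable g y (ebasis R i).
  by apply: derivableB => //; apply: derivable_shiftw; exact: di.
have [c cs E] := mvt_line x s dg.
have dji y : derivable (dpartial i f) y (ebasis R j).
  by apply: Ck_derivable; exact: Ck_dpartial Cf.
have [c' cs' E'] := mvt_line (x + c *: ebasis R i) s dji.
exists c, c'; split=> //.
rewrite -E'; move: E; rewrite /g deriveB => [->|//|//]; last by apply: derivable_shiftw; exact: di.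
by rewrite derive_shiftw.
Qed.

(** The second difference is symmetric in i and j, so both mixed derivatives take the same value at
    two points close to x, and continuity concludes. *)
Lemma dpartialC n (f : 'rV[R]_n -> R) i j : Ck 2 f ->
  dpartial i (dpartial j f) = dpartial j (dpartial i f).
Proof.
move=> Cf; apply/funext => x; apply/eqP; rewrite -subr_eq0 -normr_le0.
apply/ler_addgt0Pr => e e0; rewrite add0r.
have e20 : 0 < e / 2 by rewrite divr_gt0.
have cC a b : continuous (dpartial a (dpartial b f)).
  by apply: (@Ck_cont _ 0); apply: Ck_dpartial; exact: Ck_dpartial Cf.
have /cvgrPdist_le/(_ _ e20)/nbhs_ballP[r1 r10 P1] := cC i j x.
have /cvgrPdist_le/(_ _ e20)/nbhs_ballP[r2 r20 P2] := cC j i x.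
(* Each mean value point lies within 2 s of x in the sup norm, hence inside both balls, whose radii
   are at least 4 s. *)
pose s := (Num.min r1 r2) / 4.
have r0 : 0 < Num.min r1 r2 by rewrite lt_min; apply/andP; split.
have s0 : 0 < s by rewrite divr_gt0.
have near a b (c c' r : R) : `|c| <= `|s| -> `|c'| <= `|s| -> Num.min r1 r2 <= r ->
    ball x r (x + c *: ebasis R a + c' *: ebasis R b).
  move=> cs cs' rr; rewrite -ball_normE /= -addrA opprD addrA subrr sub0r normrN.
  apply: (@le_lt_trans _ _ (s + s)); last by rewrite /s; lra.
  apply: ler_norm_rV; first by rewrite addr_ge0 // ltW.
  move=> l; rewrite !mxE eqxx /=; apply: le_trans (ler_normD _ _) _.
  rewrite (gtr0_norm s0) in cs cs'.
  have H (z : R) (q : bool) : `|z| <= s -> `|z * q%:R| <= s.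
    by case: q => /= zs; rewrite ?mulr1 // mulr0 normr0 ltW.
  by apply: lerD; exact: H.
have [c [c' [h1 h2 E]]] := second_difference i j x s Cf.
have [d [d' [h3 h4 E']]] := second_difference j i x s Cf.
have EE : dpartial j (dpartial i f) (x + c *: ebasis R i + c' *: ebasis R j) =
   dpartial i (dpartial j f) (x + d *: ebasis R j + d' *: ebasis R i).
  apply: (@mulfI _ (s * s)); first by rewrite mulf_neq0 // gt_eqF.
  rewrite -[LHS]mulrA -[RHS]mulrA; apply: etrans (esym E) (etrans _ E').
  have -> : x + s *: ebasis R i + s *: ebasis R j = x + s *: ebasis R j + s *: ebasis R i.
    exact: addrAC.
  by move: (f _) (f _) (f _) (f _) => p q u v; ring.
have m1 : Num.min r1 r2 <= r1 by rewrite ge_min lexx.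
have m2 : Num.min r1 r2 <= r2 by rewrite ge_min lexx orbT.
have Q1 := P1 _ (near j i d d' r1 h3 h4 m1).
have Q2 := P2 _ (near i j c c' r2 h1 h2 m2).
rewrite /= EE in Q1 Q2.
move: Q1 Q2; move: (dpartial i _ _) (dpartial j _ x) (dpartial i _ x) => P C A.
move=> Q1 Q2; rewrite [leRHS]splitr; apply: le_trans (ler_distD P _ _) (lerD Q1 _).
by rewrite distrC.
Qed.

End Ck_closure.

(** * Integration over boxes and the torus *)

Section cint.
Context {R : realType}.

Definition jcont (S X : topologicalType) (F : S -> X -> R) :=
  continuous (fun z : S * X => F z.1 z.2).

Lemma jcont_sec (S X : topologicalType) (F : S -> X -> R) s :
  jcont F -> continuous (F s).
Proof.
move=> cF x; apply: (@continuous_comp _ _ _ (fun x => (s, x)) (fun z : S * X => F z.1 z.2)).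
  by apply: cvg_pair => /=; [exact: cvg_cst|exact: cvg_id].
exact: cF.
Qed.

Lemma jcont_swap (S X : topologicalType) (F : S -> X -> R) :
  jcont F -> jcont (fun x s => F s x).
Proof.
move=> cF [x s].
apply: (@continuous_comp _ _ _ (fun z : X * S => (z.2, z.1)) (fun z : S * X => F z.1 z.2)).
  by apply: cvg_pair => /=; [exact: cvg_snd|exact: cvg_fst].
exact: cF.
Qed.

(* A positive functional on continuous functions carried by a compact set,
   abstracting integration over a segment or a box. *)
Record cint (X : topologicalType) (K : set X) (vol : R) (I : (X -> R) -> R) : Prop := Cint {
  cint_compact : compact K ;
  cint_lin : forall (f g : X -> R) (c : R), continuous f -> continuous g ->
     I (fun x => f x + c * g x) = I f + c * I g ;
  cint_le : forall (f g : X -> R), continuous f -> continuous g ->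
     (forall x, K x -> f x <= g x) -> I f <= I g ;
  cint_1 : I (fun=> 1) = vol }.

Section theory.
Variables (X : topologicalType) (K : set X) (vol : R) (I : (X -> R) -> R).
Hypothesis HI : cint K vol I.

Lemma cintD (f g : X -> R) : continuous f -> continuous g -> I (fun x => f x + g x) = I f + I g.
Proof.
move=> cf cg; have := cint_lin HI 1 cf cg; rewrite mul1r => <-.
by congr I; apply/funext => x; rewrite mul1r.
Qed.

Lemma cint0 : I (fun=> 0) = 0.
Proof.
have E := cint_lin HI (-1) (@cst_continuous X R 0) (@cst_continuous X R 0).
transitivity (I (fun x => cst 0 x + -1 * cst 0 x)).
  by congr I; apply/funext => x; rewrite /cst mulr0 addr0.
by rewrite E mulN1r subrr.
Qed.

Lemma cintZ (c : R) (f : X -> R) : continuous f -> I (fun x => c * f x) = c * I f.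
Proof.
move=> cf; have E := cint_lin HI c (@cst_continuous X R 0) cf.
rewrite [I (cst 0)]cint0 add0r in E; rewrite -E.
by congr I; apply/funext => x; rewrite /cst add0r.
Qed.

Lemma cintN (f : X -> R) : continuous f -> I (fun x => - f x) = - I f.
Proof. by move=> cf; rewrite -mulN1r -cintZ //; under [in RHS]eq_fun do rewrite mulN1r. Qed.

Lemma cintB (f g : X -> R) : continuous f -> continuous g -> I (fun x => f x - g x) = I f - I g.
Proof.
move=> cf cg; have := cint_lin HI (-1) cf cg; rewrite mulN1r => <-.
by congr I; apply/funext => x; rewrite mulN1r.
Qed.

Lemma cint_cst (c : R) : I (fun=> c) = c * vol.
Proof.
rewrite -(cint_1 HI) -cintZ; first by under [in RHS]eq_fun do rewrite mulr1.
exact: cst_continuous.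
Qed.

Lemma cint_ge0 (f : X -> R) : continuous f -> (forall x, K x -> 0 <= f x) -> 0 <= I f.
Proof. by move=> cf f0; rewrite -cint0; apply: (cint_le HI) => //; exact: cst_continuous. Qed.

Lemma cint_vol_ge0 : 0 <= vol.
Proof. by rewrite -(cint_1 HI); apply: cint_ge0 => //; exact: cst_continuous. Qed.

Lemma cint_sum (J : Type) (r : seq J) (f : J -> X -> R) :
  (forall j, continuous (f j)) ->
  I (fun x => \sum_(j <- r) f j x) = \sum_(j <- r) I (f j).
Proof.
move=> cf; have cs s : continuous (fun x => \sum_(j <- s) f j x).
  apply: continuous_big => [|j _]; [exact: add_continuous|exact: cf].
elim: r => [|j r IH].
  by rewrite big_nil; under eq_fun do rewrite big_nil; exact: cint0.
by rewrite big_cons -IH -cintD //; under eq_fun do rewrite big_cons.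
Qed.

Lemma cint_norm_le (f : X -> R) (e : R) : continuous f -> (forall x, K x -> `|f x| <= e) ->
  `|I f| <= e * vol.
Proof.
move=> cf fe; rewrite ler_norml -mulNr -!cint_cst; apply/andP; split;
  apply: (cint_le HI) => //; try exact: cst_continuous;
  by move=> x /fe; rewrite ler_norml => /andP[].
Qed.

(** Tube lemma: compactness of K turns joint continuity at all points (s0, x) into closeness that is
    uniform over K. *)
Lemma cint_tube (S : topologicalType) (G : S -> X -> R) s0 e : 0 < e ->
  (forall x, {for (s0, x), continuous (fun z : S * X => G z.1 z.2)}) ->
  \forall s \near s0, forall x, K x -> `|G s x - G s0 x| <= e.
Proof.
move=> e0 cG.
have := (compact_near_coveringP K).1 (cint_compact HI).
move=> /(_ S (nbhs s0) (fun s x => `|G s x - G s0 x| <= e) _); apply => x Kx.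
have e20 : 0 < e / 2 by rewrite divr_gt0.
have /cvgrPdist_le/(_ _ e20)[[U V] [/= Us Vx] UV] := cG x.
exists (V, U) => //= -[x' s] /= [Vx' Us'].
have h1 := UV (s, x') (conj Us' Vx').
have h2 := UV (s0, x') (conj (nbhs_singleton Us) Vx').
rewrite /= in h1 h2; rewrite [leRHS]splitr.
apply: le_trans (ler_distD (G s0 x) _ _) (lerD _ h2).
by rewrite distrC.
Qed.

Lemma cint_param (S : topologicalType) (G : S -> X -> R) s0 :
  (\forall s \near s0, continuous (G s)) ->
  (forall x, {for (s0, x), continuous (fun z : S * X => G z.1 z.2)}) ->
  {for s0, continuous (fun s => I (G s))}.
Proof.
move=> cGs cG; apply/cvgrPdist_le => /= e e0.
(* The tolerance is divided by [vol + 1] since [vol] may vanish. *)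
have v1 : 0 < vol + 1 by rewrite ltr_wpDl // cint_vol_ge0.
have e'0 : 0 < e / (vol + 1) by rewrite divr_gt0.
have cG0 := nbhs_singleton cGs.
near=> s.
have cGss : continuous (G s) by near: s.
rewrite distrC -cintB //.
apply: (@le_trans _ _ (e / (vol + 1) * vol)).
  apply: cint_norm_le; last by near: s; exact: cint_tube.
  by move=> x; apply: cvgB; [exact: cGss|exact: cG0].
by rewrite mulrAC ler_pdivrMr // ler_wpM2l ?(ltW e0) // lerDl.
Unshelve. all: by end_near. Qed.

Lemma cint_jcont (S : topologicalType) (G : S -> X -> R) :
  jcont G -> continuous (fun s => I (G s)).
Proof.
move=> cG s; apply: cint_param; last by move=> x; exact: cG.
by near=> t; exact: jcont_sec.
Unshelve. all: by end_near. Qed.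

Lemma mvt_near (f f' : R -> R) (s h : R) :
  (forall c, `|c - s| <= `|h| -> is_derive c 1 f (f' c)) ->
  exists2 c, `|c - s| <= `|h| & f (s + h) - f s = h * f' c.
Proof.
move=> df.
have [h0|h0] := leP 0 h.
  have [|c||c] := @MVT_segment R f f' s (s + h).
  - by rewrite lerDl.
  - rewrite in_itv /= => /andP[sc ch]; apply: df.
    by rewrite !ger0_norm ?subr_ge0 ?(ltW sc) // lerBlDl ltW.
  - apply: derivable_within_continuous => c; rewrite in_itv /= => /andP[sc ch].
    by apply: ex_derive; apply: df; rewrite !ger0_norm ?subr_ge0 // lerBlDl.
  - rewrite in_itv /= => /andP[sc ch] ->; exists c.
      by rewrite !ger0_norm ?subr_ge0 // lerBlDl.
    by rewrite addrAC subrr add0r mulrC.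
have [|c||c] := @MVT_segment R f f' (s + h) s.
- by rewrite gerDl ltW.
- rewrite in_itv /= => /andP[sc ch]; apply: df.
  by rewrite distrC ger0_norm ?subr_ge0 ?(ltW ch) // ltr0_norm //; lra.
- apply: derivable_within_continuous => c; rewrite in_itv /= => /andP[sc ch].
  apply: ex_derive; apply: df.
  by rewrite distrC ger0_norm ?subr_ge0 // ltr0_norm //; lra.
- rewrite in_itv /= => /andP[sc ch] E; exists c.
    by rewrite distrC ger0_norm ?subr_ge0 // ltr0_norm //; lra.
  rewrite -[LHS]opprB E; ring.
Qed.

(** By the mean value theorem the difference quotient at x is F' at an intermediate time depending
    on x, and [cint_tube] makes it close to F' s0 uniformly in x. The hypotheses are local in s
    because powers of the density are differentiable in time only where it is positive. *)
Lemma cint_is_derive (F F' : R -> X -> R) s0 :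
  (\forall s \near s0, continuous (F s) /\ forall x, is_derive s 1 (F^~ x) (F' s x)) ->
  continuous (F' s0) ->
  (forall x, {for (s0, x), continuous (fun z : R * X => F' z.1 z.2)}) ->
  is_derive s0 1 (fun s => I (F s)) (I (F' s0)).
Proof.
move=> dF cF's0 cF'.
have v1 : 0 < vol + 1 by rewrite ltr_wpDl // cint_vol_ge0.
have cF0 : continuous (F s0) by have [] := nbhs_singleton dF.
suff H : (fun h : R => h^-1 *: (I (F (h *: 1 + s0)) - I (F s0))) @ 0^' --> I (F' s0).
  split; first by apply/cvg_ex; exists (I (F' s0)).
  by apply: cvg_lim.
apply/cvgrPdist_le => /= e e0.
have e'0 : 0 < e / (vol + 1) by rewrite divr_gt0.
have /nbhs_ballP[r r0 Pr] := cint_tube e'0 cF'.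
have /nbhs_ballP[r' r'0 Pr'] := dF.
near=> h.
have h0 : h != 0 by near: h; exact: nbhs_dnbhs_neq.
have hr : `|h| < r by near: h; exact: dnbhs0_lt.
have hr' : `|h| < r' by near: h; exact: dnbhs0_lt.
have [cFh _] : continuous (F (s0 + h)) /\ forall x, is_derive (s0 + h) 1 (F^~ x) (F' (s0 + h) x).
  by apply: Pr'; rewrite /= -ball_normE /= opprD addrA subrr sub0r normrN.
have -> : (h *: 1 + s0 : R) = s0 + h by rewrite [h *: 1 : R]mulr1 addrC.
have cq : continuous (fun x => F (s0 + h) x - F s0 x).
  by move=> x; apply: cvgB; [exact: cFh|exact: cF0].
have cq' : continuous (fun x => h^-1 * (F (s0 + h) x - F s0 x)).
  exact: continuousZc.
have -> : h^-1 *: (I (F (s0 + h)) - I (F s0)) =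
          I (fun x => h^-1 * (F (s0 + h) x - F s0 x)).
  by rewrite cintZ // cintB.
rewrite -cintB //.
apply: (@le_trans _ _ (e / (vol + 1) * vol)); last first.
  by rewrite mulrAC ler_pdivrMr // ler_wpM2l ?(ltW e0) // lerDl.
apply: cint_norm_le => [x|x Kx]; first by apply: cvgB; [exact: cF's0|exact: cq'].
have [c|c ch ->] := @mvt_near (F^~ x) (F'^~ x) s0 h.
  move=> ch; have /Pr'[_] : ball s0 r' c; last exact.
  by rewrite -ball_normE /= distrC (le_lt_trans ch).
rewrite mulKf // distrC; apply: (Pr c) => //=.
by rewrite -ball_normE /= distrC (le_lt_trans ch).
Unshelve. all: by end_near. Qed.

End theory.
End cint.

(** * Fundamental theorem of calculus and Fubini on a segment *)

Section one_dim.
Context {R : realType}.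
Local Notation mu := (@lebesgue_measure R).

Lemma continuous_integrable (f : R -> R) (a b : R) : continuous f ->
  mu.-integrable `[a, b] (EFin \o f).
Proof.
move=> cf; apply: continuous_compact_integrable; first exact: segment_compact.
exact: continuous_subspaceT.
Qed.

Lemma cint_segment (a b : R) : a <= b -> cint `[a, b] (b - a) (Rintegral mu `[a, b]).
Proof.
move=> ab; split.
- exact: segment_compact.
- move=> f g c cf cg; have icg : mu.-integrable `[a, b] (EFin \o (fun x => c * g x)).
    by apply: continuous_integrable; apply: continuousMc => //; exact: cst_continuous.
  by rewrite RintegralD // ?RintegralZl //; exact: continuous_integrable.
- by move=> f g cf cg fg; apply: le_Rintegral => //; exact: continuous_integrable.
- rewrite Rintegral_cst // mul1r.
  transitivity (fine (lebesgue_measure (`[a, b]%classic : set R))); first by [].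
  rewrite lebesgue_measure_itv /= lte_fin.
  by case: ltgtP ab => //= ->; rewrite subrr.
Qed.

Lemma is_derive_Rint (f : R -> R) (lo s : R) : continuous f -> lo < s ->
  is_derive s 1 (fun s => Rintegral mu `[lo, s] f) (f s).
Proof.
move=> cf los.
have s1 : s < s + 1 by rewrite ltrDl.
have [] := @continuous_FTC1_closed R f lo s (s + 1) s1 (continuous_integrable _ _ cf) los (cf s).
by move=> d <-; rewrite derive1E; exact: derivableP.
Qed.

Lemma Rint_split (f : R -> R) (a b c : R) : continuous f -> a <= b <= c ->
  Rintegral mu `[a, c] f = Rintegral mu `[a, b] f + Rintegral mu `[b, c] f.
Proof.
move=> cf /andP[ab bc].
have := @Rintegral_itvB R f (BLeft a) (BRight c) b (continuous_integrable _ _ cf).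
rewrite !bnd_simp => /(_ ab bc).
rewrite Rintegral_itv_obnd_cbnd; last first.
  by apply: integrableS (continuous_integrable b c cf) => //; exact: subset_itv_oc_cc.
by move=> <-; rewrite addrC subrK.
Qed.

Lemma derive0_const (f : R -> R) (a b : R) : a <= b ->
  (forall s, a <= s <= b -> is_derive s 1 f 0) -> f a = f b.
Proof.
move=> ab df; have [||c _ E] := @MVT_segment R f (fun=> 0) a b ab.
- by move=> x; rewrite in_itv /= => /andP[ax xb]; apply: df; rewrite !ltW.
- apply: derivable_within_continuous => x; rewrite in_itv /= => xab.
  by apply: ex_derive; exact: df.
- by apply/eqP; rewrite eq_sym -subr_eq0 E mul0r.
Qed.

Lemma Rint_FTC (f F : R -> R) (a b : R) : a <= b -> continuous f ->
  (forall s, a <= s <= b -> is_derive s 1 F (f s)) ->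
  Rintegral mu `[a, b] f = F b - F a.
Proof.
move=> ab cf dF.
(* The comparison primitive starts at a - 1, so that it is differentiable on both sides at a as
   well. *)
have a1 : a - 1 < a by rewrite ltrBlDr ltrDl.
have H : Rintegral mu `[a - 1, a] f - F a = Rintegral mu `[a - 1, b] f - F b.
  apply: (@derive0_const (fun s => Rintegral mu `[a - 1, s] f - F s)) => // s /andP[as_ sb].
  rewrite -(subrr (f s)); apply: is_deriveB; last by apply: dF; rewrite as_ sb.
  by apply: is_derive_Rint => //; exact: lt_le_trans a1 as_.
have := Rint_split cf (_ : a - 1 <= a <= b); rewrite ab ltW // => /(_ isT) E.
by rewrite E in H; lra.
Qed.

(* Differentiating under [J], the function [s |-> J (int_(a-1)^s F)] is a primitive of
   [t |-> J (F t)], so that Fubini reduces to the fundamental theorem of calculus. *)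
Lemma Rint_cint_swap (X : topologicalType) (K : set X) vol (J : (X -> R) -> R)
    (F : R -> X -> R) (a b : R) : cint K vol J -> a <= b -> jcont F ->
  Rintegral mu `[a, b] (fun t => J (F t)) = J (fun x => Rintegral mu `[a, b] (F^~ x)).
Proof.
move=> HJ ab cF.
have a1 : a - 1 < a by rewrite ltrBlDr ltrDl.
have cFx x : continuous (F^~ x) by exact: (@jcont_sec R X R (fun x t => F t x) x (jcont_swap cF)).
have cJ : continuous (fun t => J (F t)) by exact: (cint_jcont HJ cF).
have cR lo hi : lo <= hi -> continuous (fun x => Rintegral mu `[lo, hi] (F^~ x)).
  by move=> lh; apply: (cint_jcont (cint_segment lh)); exact: jcont_swap.
pose psi s := J (fun x => Rintegral mu `[a - 1, s] (F^~ x)).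
transitivity (psi b - psi a); last first.
  rewrite /psi -(cintB HJ); [|exact: cR (le_trans (ltW a1) ab)|exact: cR (ltW a1)].
  congr J; apply/funext => x.
  by rewrite (@Rint_split _ (a - 1) a b) ?ab ?(ltW a1) // addrAC subrr add0r.
apply: Rint_FTC => // s /andP[as_ sb].
have s1 : a - 1 < s by exact: lt_le_trans a1 as_.
apply: (cint_is_derive HJ (F' := F)); last by move=> x; exact: cF.
  near=> t; have t1 : a - 1 < t by near: t; exact: lt_nbhsr.
  split; first exact: cR (ltW t1).
  by move=> x; apply: is_derive_Rint.
exact: jcont_sec.
Unshelve. all: by end_near. Qed.

End one_dim.

Lemma continuous_pairc (S X Y : topologicalType) (f : S -> X) (g : S -> Y) :
  continuous f -> continuous g -> continuous (fun z => (f z, g z)).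
Proof. by move=> cf cg z; apply: cvg_pair; [exact: cf|exact: cg]. Qed.

Lemma continuous_compc (S X Y : topologicalType) (f : S -> X) (g : X -> Y) :
  continuous f -> continuous g -> continuous (fun z => g (f z)).
Proof. by move=> cf cg z; apply: continuous_comp; [exact: cf|exact: cg]. Qed.

Lemma continuous_fst (S X : topologicalType) : continuous (@fst S X).
Proof. by move=> z; exact: cvg_fst. Qed.

Lemma continuous_snd (S X : topologicalType) : continuous (@snd S X).
Proof. by move=> z; exact: cvg_snd. Qed.

(** * Iterated integrals, one coordinate at a time *)

Section row_cons.
Context {R : realType}.

Definition rcons0 n (t : R) (v : 'rV[R]_n) : 'rV[R]_n.+1 :=
  row_mx (const_mx t : 'rV[R]_1) v.

Lemma rcons0_0 n t (v : 'rV[R]_n) : rcons0 t v 0 0 = t.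
Proof. by rewrite /rcons0 mxE; case: splitP => // j; rewrite mxE. Qed.

Lemma rcons0_S n t (v : 'rV[R]_n) j : rcons0 t v 0 (lift ord0 j) = v 0 j.
Proof.
rewrite /rcons0 mxE; case: splitP => [i|k /= E].
  by rewrite ord1.
by congr (v 0 _); apply/val_inj; move: E; rewrite /= /bump /= !add1n => -[].
Qed.

Lemma row_ext0 n (u v : 'rV[R]_n.+1) : u 0 0 = v 0 0 ->
  (forall j, u 0 (lift ord0 j) = v 0 (lift ord0 j)) -> u = v.
Proof.
move=> h0 hS; apply/rowP => j; case: (unliftP ord0 j) => [k|] -> //; exact: hS.
Qed.

Lemma rcons0_continuous n : continuous (fun z : R * 'rV[R]_n => rcons0 z.1 z.2).
Proof.
move=> z; apply: (@cvg_rV _ _ (nbhs z) _) => j.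
case: (unliftP ord0 j) => [k|] ->.
  rewrite rcons0_S; under eq_fun do rewrite rcons0_S.
  apply: (@continuous_comp _ _ _ snd (fun v : 'rV[R]_n => v 0 k)); first exact: cvg_snd.
  exact: coord_continuous.
by rewrite rcons0_0; under eq_fun do rewrite rcons0_0; exact: cvg_fst.
Qed.

Definition box (A : set R) n : set 'rV[R]_n := [set v | forall i, A (v 0 i)].

Lemma rcons0_box A n t (v : 'rV[R]_n) : A t -> box A v -> box A (rcons0 t v).
Proof.
move=> At Av i; case: (unliftP ord0 i) => [k|] ->; first by rewrite rcons0_S; exact: Av.
by rewrite rcons0_0.
Qed.

Lemma iter_intS A n (f : 'rV[R]_n.+1 -> R) :
  iter_int A f = Rintegral (@lebesgue_measure R) A (fun t => iter_int A (fun v => f (rcons0 t v))).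
Proof. by []. Qed.

Lemma jcont_rcons0 n (f : 'rV[R]_n.+1 -> R) : continuous f ->
  jcont (fun (t : R) v => f (rcons0 t v)).
Proof. by move=> cf; apply: continuous_compc cf; exact: rcons0_continuous. Qed.

Lemma cint_iter (a b : R) n : a <= b ->
  cint (@box `[a, b] n) ((b - a) ^+ n) (@iter_int R `[a, b] n).
Proof.
move=> ab; elim: n => [|n IH].
  split=> //=.
  - have -> : box `[a, b] (n:=0) = [set 0 : 'rV[R]_0].
      apply/seteqP; split=> v /= _; first by apply/rowP => -[].
      by case.
    exact: compact_set1.
  - by move=> f g _ _ fg; apply: fg => -[].
have cI (f : 'rV[R]_n.+1 -> R) : continuous f ->
    continuous (fun t => iter_int `[a, b] (fun v => f (rcons0 t v))).
  by move=> cf; apply: (cint_jcont IH); exact: jcont_rcons0.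
have cs (f : 'rV[R]_n.+1 -> R) t : continuous f -> continuous (fun v => f (rcons0 t v)).
  by move=> cf; exact: (@jcont_sec R R 'rV[R]_n (fun t v => f (rcons0 t v)) t (jcont_rcons0 cf)).
have H1 := cint_segment ab.
split.
- exact: (@rV_compact R n.+1 (fun=> `[a, b]%classic) (fun=> @segment_compact _ a b)).
- move=> f g c cf cg; rewrite !iter_intS -(cint_lin H1); [|exact: cI|exact: cI].
  by congr Rintegral; apply/funext => t; rewrite (cint_lin IH) //; exact: cs.
- move=> f g cf cg fg; rewrite !iter_intS.
  apply: (cint_le H1); [exact: cI|exact: cI|] => t tab.
  apply: (cint_le IH); [exact: cs|exact: cs|] => v vab.
  by apply: fg; exact: rcons0_box.
- rewrite iter_intS exprS mulrC -(cint_cst H1).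
  by congr Rintegral; apply/funext => t; exact: cint_1 IH.
Qed.

(** Fubini for a box against any [cint] functional: the coordinates of the box are moved across J
    one by one with [Rint_cint_swap]. *)
Lemma iter_cint_swap (a b : R) n (X : topologicalType) (K : set X) vol (J : (X -> R) -> R)
    (F : 'rV[R]_n -> X -> R) : cint K vol J -> a <= b -> jcont F ->
  iter_int `[a, b] (fun v => J (F v)) = J (fun x => iter_int `[a, b] (F^~ x)).
Proof.
move=> HJ ab; elim: n F => [//|n IH] F cF; rewrite iter_intS.
have E t : iter_int `[a, b] (fun v => J (F (rcons0 t v))) =
           J (fun x => iter_int `[a, b] (fun v => F (rcons0 t v) x)).
  apply: IH; apply: (continuous_compc (f := fun z => (rcons0 t z.1, z.2)) _ cF).
  apply: continuous_pairc; last exact: continuous_snd.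
  apply: continuous_compc; first exact: continuous_fst.
  apply: (continuous_compc (f := fun z => (t, z)) _ (@rcons0_continuous n)).
  by apply: continuous_pairc; [exact: cst_continuous|move=> z; exact: cvg_id].
transitivity (Rintegral (@lebesgue_measure R) `[a, b]
   (fun t => J (fun x => iter_int `[a, b] (fun v => F (rcons0 t v) x)))).
  by congr Rintegral; apply/funext => t; exact: E.
apply: (Rint_cint_swap HJ (F := fun t x => iter_int `[a, b] (fun v => F (rcons0 t v) x))) => //.
apply: (cint_jcont (cint_iter n ab)).
apply: (continuous_compc (f := fun z => (rcons0 z.1.1 z.2, z.1.2)) _ cF).
apply: continuous_pairc.
  apply: (continuous_compc (f := fun z => (z.1.1, z.2)) _ (@rcons0_continuous n)).
  apply: continuous_pairc; last exact: continuous_snd.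
  by apply: continuous_compc; exact: continuous_fst.
by apply: continuous_compc; [exact: continuous_fst|exact: continuous_snd].
Qed.

End row_cons.

(** * Translation invariance and integration by parts on the torus *)

Section torus.
Context {R : realType}.
Local Notation mu := (@lebesgue_measure R).

Lemma cintT n : cint (@box R `[0, 1] n) 1 (@int_torus R n).
Proof. by have := @cint_iter R 0 1 n ler01; rewrite subr0 expr1n. Qed.

Definition tail n (w : 'rV[R]_n.+1) : 'rV[R]_n := \row_j w 0 (lift ord0 j).

Lemma rcons0D n t (v : 'rV[R]_n) (w : 'rV[R]_n.+1) :
  rcons0 t v + w = rcons0 (t + w 0 0) (v + tail w).
Proof. by apply: row_ext0 => [|j]; rewrite !(rcons0_0, rcons0_S, mxE). Qed.

Lemma rcons0Z n c t (v : 'rV[R]_n) : c *: rcons0 t v = rcons0 (c * t) (c *: v).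
Proof. by apply: row_ext0 => [|j]; rewrite !(rcons0_0, rcons0_S, mxE). Qed.

Lemma rcons0_e0 n t (v : 'rV[R]_n) : rcons0 t v + ebasis R ord0 = rcons0 (t + 1) v.
Proof.
rewrite rcons0D; congr rcons0; first by rewrite !mxE.
by apply/rowP => j; rewrite !mxE addr0.
Qed.

Lemma rcons0_eS n t (v : 'rV[R]_n) i :
  rcons0 t v + ebasis R (lift ord0 i) = rcons0 t (v + ebasis R i).
Proof.
rewrite rcons0D; congr rcons0; first by rewrite !mxE addr0.
by apply/rowP => j; rewrite !mxE (inj_eq lift_inj).
Qed.

(** If P is a primitive of f, the shifted integral is P(c + 1) - P(c), whose derivative in c is f(c
    + 1) - f(c) = 0. *)
Lemma Rint_shift (f : R -> R) (c : R) : continuous f -> (forall t, f (t + 1) = f t) ->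
  Rintegral mu `[0, 1] (fun t => f (t + c)) = Rintegral mu `[0, 1] f.
Proof.
(* The primitive is based below both 0 and c, so that every point between them is interior. *)
move=> cf pf; pose lo := Num.min 0 c - 1.
have lo0 : lo < 0 by rewrite /lo ltrBlDr add0r (le_lt_trans _ ltr01)// ge_min lexx.
have loc : lo < c by rewrite /lo ltrBlDr (@le_lt_trans _ _ c) ?ltrDl// ge_min lexx orbT.
pose P s := Rintegral mu `[lo, s] f.
have dP (s : R) : lo < s -> is_derive s 1 P (f s) by exact: is_derive_Rint.
have dPs (s a : R) : lo < s + a -> is_derive s 1 (fun s => P (s + a)) (f (s + a)).
  move=> h; rewrite -[f _]mulr1.
  by apply: (@is_derive1_comp R P (fun s => s + a) s (f (s + a)) 1); [exact: dP|exact: is_derive_shift].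
have E (b : R) : lo < b -> Rintegral mu `[0, 1] (fun t => f (t + b)) = P (b + 1) - P b.
  move=> lob; have cfb : continuous (fun t => f (t + b)).
    by apply: continuous_compc cf => t; apply: cvgD; [exact: cvg_id|exact: cvg_cst].
  have H (s : R) : 0 <= s <= 1 -> is_derive s 1 (fun t => P (t + b)) (f (s + b)).
    by move=> /andP[s0 _]; apply: dPs; rewrite ltr_wpDl.
  by rewrite (Rint_FTC ler01 cfb H) add0r addrC [1 + b]addrC addrC.
have d0 (s : R) : lo < s -> is_derive s 1 (fun s => P (s + 1) - P s) 0.
  move=> h; have h1 : lo < s + 1 by apply: lt_trans h _; rewrite ltrDl.
  have := is_deriveB (dPs s 1 h1) (dP s h).
  by rewrite pf subrr.
have -> : Rintegral mu `[0, 1] f = P (0 + 1) - P 0.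
  by rewrite -E //; congr Rintegral; apply/funext => t; rewrite addr0.
rewrite E //; have [c0|c0] := leP 0 c.
  have H (s : R) : 0 <= s <= c -> is_derive s 1 (fun s => P (s + 1) - P s) 0.
    by move=> /andP[h _]; apply: d0; exact: lt_le_trans h.
  exact: esym (derive0_const c0 H).
have H (s : R) : c <= s <= 0 -> is_derive s 1 (fun s => P (s + 1) - P s) 0.
  by move=> /andP[h _]; apply: d0; exact: lt_le_trans h.
exact: derive0_const (ltW c0) H.
Qed.

Lemma torus_shift n (f : 'rV[R]_n -> R) w : continuous f -> Zperiodic f ->
  int_torus (fun x => f (x + w)) = int_torus f.
Proof.
rewrite /int_torus; elim: n f w => [|n IH] f w cf pf.
  by rewrite /=; congr f; apply/rowP => -[].
rewrite !iter_intS.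
transitivity (Rintegral mu `[0, 1] (fun t => iter_int `[0, 1] (fun v => f (rcons0 (t + w 0 0) v)))).
  congr Rintegral; apply/funext => t.
  transitivity (iter_int `[0, 1] (fun v => f (rcons0 (t + w 0 0) (v + tail w)))).
    by congr iter_int; apply/funext => v; rewrite rcons0D.
  apply: (IH (fun v => f (rcons0 (t + w 0 0) v))).
    exact: (@jcont_sec R R 'rV[R]_n (fun t v => f (rcons0 t v)) _ (jcont_rcons0 cf)).
  by move=> v i; rewrite -rcons0_eS pf.
apply: (@Rint_shift (fun t => iter_int `[0, 1] (fun v => f (rcons0 t v)))).
  by apply: (cint_jcont (cint_iter n ler01)); exact: jcont_rcons0.
by move=> t; congr iter_int; apply/funext => v; rewrite -rcons0_e0 pf.
Qed.

Lemma jcont_line n (f : 'rV[R]_n -> R) (v : 'rV[R]_n) : continuous f ->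
  jcont (fun (s : R) (x : 'rV[R]_n) => f (x + s *: v)).
Proof.
move=> cf; apply: (continuous_compc (f := fun z : R * 'rV[R]_n => z.2 + z.1 *: v) _ cf).
move=> z; apply: cvgD; first exact: cvg_snd.
by apply: cvgZ; [exact: cvg_fst|exact: cvg_cst].
Qed.

(** Only f is translated, so g may be merely continuous. This matters for the coupling, which is
    tested against derivatives of m. *)
Lemma torus_line_derive n (g f : 'rV[R]_n -> R) i (s : R) : continuous g -> Ck 1 f ->
  is_derive s 1 (fun s : R => int_torus (fun x => g x * f (x + s *: ebasis R i)))
    (int_torus (fun x => g x * dpartial i f (x + s *: ebasis R i))).
Proof.
move=> cg [cf /(_ i)[df [cdf _]]].
have cM (h : 'rV[R]_n -> R) : continuous h ->
    jcont (fun (s : R) (x : 'rV[R]_n) => g x * h (x + s *: ebasis R i)).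
  move=> ch; apply: continuousMc; last exact: jcont_line.
  by apply: continuous_compc cg; exact: continuous_snd.
apply: (cint_is_derive (cintT n)
  (F' := fun s x => g x * dpartial i f (x + s *: ebasis R i))).
- near=> t; split; first exact: (@jcont_sec R R 'rV[R]_n (fun s x => g x * f (x + s *: ebasis R i)) t (cM _ cf)).
  move=> x; have H := is_derive_line (df (x + t *: ebasis R i)).
  have := @is_deriveZ _ _ _ (fun h : R => f (x + h *: ebasis R i)) (g x) t 1 _ H; exact.
- exact: (@jcont_sec R R 'rV[R]_n (fun s x => g x * dpartial i f (x + s *: ebasis R i)) s (cM _ cdf)).
- by move=> x; exact: (cM _ cdf (s, x)).
Unshelve. all: by end_near. Qed.

Lemma Zperiodic_dpartial n i (f : 'rV[R]_n -> R) : Zperiodic f -> Zperiodic (dpartial i f).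
Proof.
move=> pf x j; have E : (fun y => f (y + ebasis R j)) = f.
  by apply/funext => y; exact: pf.
by have := derive_shiftw f (ebasis R j) (ebasis R i) x; rewrite E => /esym.
Qed.

Lemma ZperiodicM n (f g : 'rV[R]_n -> R) : Zperiodic f -> Zperiodic g ->
  Zperiodic (fun x => f x * g x).
Proof. by move=> pf pg x i; rewrite pf pg. Qed.

(** By translation invariance the integral of f(x + s e_i) does not depend on s, and the claim is
    that its derivative at s = 0 vanishes. *)
Lemma torus_dpartial n i (f : 'rV[R]_n -> R) : Ck 1 f -> Zperiodic f ->
  int_torus (dpartial i f) = 0.
Proof.
move=> Cf pf; have := @torus_line_derive n (fun=> 1) f i 0 (@cst_continuous 'rV[R]_n R 1) Cf.
have E : (fun s : R => int_torus (fun x => 1 * f (x + s *: ebasis R i))) = cst (int_torus f).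
  apply/funext => s; rewrite -(torus_shift (s *: ebasis R i) (Ck_cont Cf) pf).
  by congr int_torus; apply/funext => x; rewrite mul1r.
rewrite E => /@derive_val; rewrite derive_cst => ->.
by congr int_torus; apply/funext => x; rewrite mul1r scale0r addr0.
Qed.

Lemma torus_ibp n i (f g : 'rV[R]_n -> R) : Ck 1 f -> Ck 1 g -> Zperiodic f -> Zperiodic g ->
  int_torus (fun x => f x * dpartial i g x) = - int_torus (fun x => dpartial i f x * g x).
Proof.
move=> Cf Cg pf pg; apply/eqP; rewrite -addr_eq0 -(cintD (cintT n)).
- rewrite -[X in int_torus X](dpartialM i Cf Cg); apply/eqP; apply: torus_dpartial.
    exact: CkM.
  exact: ZperiodicM.
- by apply: continuousMc; [exact: Ck_cont Cf|exact: Ck_cont (Ck_dpartial i Cg)].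
- by apply: continuousMc; [exact: Ck_cont (Ck_dpartial i Cf)|exact: Ck_cont Cg].
Qed.

End torus.

(** * Convolution on the torus *)

Section convolution.
Context {R : realType}.
Local Notation mu := (@lebesgue_measure R).

Lemma iter_int0 (A : set R) n : iter_int A (fun _ : 'rV[R]_n => 0) = 0.
Proof.
elim: n => [//|n IH]; rewrite iter_intS; under eq_fun do rewrite IH.
by rewrite /Rintegral integral0.
Qed.

(** Integrals over the whole space occur here with integrands supported in a box; on the box the
    integral is a [cint] functional. *)
Lemma int_Rn_box n (f : 'rV[R]_n -> R) (N : R) :
  (forall v, ~ box `[- N, N] v -> f v = 0) -> int_Rn f = iter_int `[- N, N] f.
Proof.
rewrite /int_Rn; elim: n f => [//|n IH] f f0; rewrite !iter_intS.
rewrite [RHS]Rintegral_mkcond; congr Rintegral; apply/funext => t.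
rewrite patchE; case: ifPn; rewrite ?inE ?notin_setE => tN.
  apply: IH => v Nv; apply: f0 => H; apply: Nv => i.
  by have := H (lift ord0 i); rewrite rcons0_S.
rewrite -[RHS](iter_int0 setT n); congr iter_int; apply/funext => v.
by apply: f0 => H; apply: tN; have := H ord0; rewrite rcons0_0.
Qed.

(** A primitive of f(t / c) is c P(t / c). Negative c is allowed because c = -1 yields the
    reflection used for even kernels. *)
Lemma Rint_scale (f : R -> R) (c N : R) : continuous f -> c != 0 -> 0 <= N ->
  Rintegral mu `[- (`|c| * N), `|c| * N] (fun t => f (c^-1 * t)) =
  `|c| * Rintegral mu `[- N, N] f.
Proof.
move=> cf c0 N0; pose P s := Rintegral mu `[- N - 1, s] f.
have dP (s : R) : - N <= s -> is_derive s 1 P (f s).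
  by move=> h; apply: is_derive_Rint => //; rewrite ltrBlDr (le_lt_trans h)// ltrDl.
have NN : - N <= N by rewrite (le_trans _ N0) // oppr_le0.
have HN (s : R) : - N <= s <= N -> is_derive s 1 P (f s).
  by move=> /andP[h _]; exact: dP.
rewrite (Rint_FTC NN cf HN).
have cN : `|c^-1| * (`|c| * N) = N by rewrite mulrA -normrM mulVf // normr1 mul1r.
have Hc : - (`|c| * N) <= `|c| * N.
  by apply: (@le_trans _ _ 0); rewrite ?oppr_le0 mulr_ge0.
have cfc : continuous (fun t => f (c^-1 * t)).
  by apply: continuous_compc cf => t; apply: cvgM; [exact: cvg_cst|exact: cvg_id].
have H (s : R) : - (`|c| * N) <= s <= `|c| * N ->
    is_derive s 1 (fun t => c * P (c^-1 * t)) (f (c^-1 * s)).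
  move=> sN; have h : - N <= c^-1 * s.
    have : `|c^-1 * s| <= N by rewrite normrM -[leRHS]cN ler_wpM2l // ler_norml.
    by rewrite ler_norml => /andP[].
  have d1 : is_derive s 1 (fun t : R => c^-1 * t) c^-1.
    have := @is_deriveZ _ _ _ (@id R) c^-1 s 1 1 (is_derive_id _ _).
    by rewrite [_ *: 1]mulr1.
  have d2 := @is_derive1_comp R P (fun t => c^-1 * t) s (f (c^-1 * s)) c^-1 (dP _ h) d1.
  have := @is_deriveZ _ _ _ (P \o (fun t => c^-1 * t)) c s 1 _ d2.
  by rewrite [_ *: (_ * _)]mulrC -mulrA mulVf // mulr1.
rewrite (Rint_FTC Hc cfc H).
have e : c^-1 * (c * N) = N by rewrite mulKf.
have [c1|c1] := ltP 0 c; first by rewrite (gtr0_norm c1) mulrN e; ring.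
by rewrite (ler0_norm c1) mulNr opprK e mulrN e; ring.
Qed.

Lemma iter_int_scale n (f : 'rV[R]_n -> R) (c N : R) : continuous f -> c != 0 -> 0 <= N ->
  iter_int `[- (`|c| * N), `|c| * N] (fun v => f (c^-1 *: v)) =
  `|c| ^+ n * iter_int `[- N, N] f.
Proof.
move=> + c0 N0; have NN : - N <= N by rewrite (le_trans _ N0) // oppr_le0.
elim: n f => [|n IH] f cf.
  by rewrite /= expr0 mul1r scaler0.
have ci : continuous (fun t => iter_int `[- N, N] (fun v => f (rcons0 t v))).
  by apply: (cint_jcont (cint_iter n NN)); exact: jcont_rcons0.
rewrite !iter_intS exprSr -mulrA -Rint_scale // -RintegralZl //; last first.
  apply: continuous_integrable; apply: continuous_compc ci.
  by move=> t; apply: cvgM; [exact: cvg_cst|exact: cvg_id].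
congr Rintegral; apply/funext => t.
rewrite -IH; last exact: (@jcont_sec R R 'rV[R]_n (fun t v => f (rcons0 t v)) _ (jcont_rcons0 cf)).
by congr iter_int; apply/funext => v; rewrite rcons0Z.
Qed.

Lemma iter_int_reflect n (f : 'rV[R]_n -> R) (N : R) : continuous f -> 0 <= N ->
  iter_int `[- N, N] (fun v => f (- v)) = iter_int `[- N, N] f.
Proof.
move=> cf N0; have n1 : (-1 : R) != 0 by rewrite oppr_eq0 oner_eq0.
have := iter_int_scale cf n1 N0.
rewrite normrN normr1 !mul1r expr1n mul1r => <-.
by congr iter_int; apply/funext => v; rewrite invrN invr1 scaleN1r.
Qed.

(** All that the estimates know about the mollifier. The parameter eps survives only as the size N
    of the support, which enters no bound. *)
Record kernel_on n (k : 'rV[R]_n -> R) (N : R) : Prop := KernelOn {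
  ker_cont : continuous k ; ker_N0 : 0 <= N ;
  ker_supp : forall v, ~ box `[- N, N] v -> k v = 0 ;
  ker_ge0 : forall v, 0 <= k v ;
  ker_even : forall v, k (- v) = k v ;
  ker_1 : iter_int `[- N, N] k = 1 }.

Lemma coord_le_euclid n (v : 'rV[R]_n) i : `|v 0 i| <= euclid_norm v.
Proof.
rewrite /euclid_norm -sqrtr_sqr; apply: ler_wsqrtr.
by rewrite (bigD1 i) //= lerDl sumr_ge0 // => j _; rewrite sqr_ge0.
Qed.

Lemma kernel_eta_eps n (eta : 'rV[R]_n -> R) (eps : R) : mollifier eta -> 0 < eps ->
  kernel_on (eta_eps eta eps) eps.
Proof.
move=> [Ceta eta0 etas etae eta1] e0.
have ceta : continuous eta by apply: (@Ck_cont _ 0); exact: Cinf_Ck.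
have cs : continuous (fun v : 'rV[R]_n => eta (eps^-1 *: v)).
  by apply: continuous_compc ceta; exact: scaler_continuous.
have s1 v : ~ box `[- 1, 1] v -> eta v = 0.
  move=> /existsNP[i]; rewrite /= in_itv /= -ler_norml => /negP; rewrite -ltNge => h.
  by apply: etas; apply: le_trans (coord_le_euclid v i); exact: ltW.
split.
- exact: continuousZc.
- exact: ltW.
- move=> v h; rewrite /eta_eps s1 ?mulr0 // => H; apply: h => i.
  have := H i; rewrite /= !in_itv /= -!ler_norml mxE normrM normfV (gtr0_norm e0).
  by rewrite ler_pdivrMl // mulr1.
- by move=> v; rewrite mulr_ge0 // invr_ge0 exprn_ge0 // ltW.
- by move=> v; rewrite /eta_eps scalerN etae.
- have ee : - eps <= eps by apply: (@le_trans _ _ 0); rewrite ?oppr_le0 ltW.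
  rewrite [LHS](cintZ (cint_iter n ee)) //.
  have := iter_int_scale ceta (lt0r_neq0 e0) ler01.
  rewrite gtr0_norm // mulr1 => ->.
  by rewrite -(int_Rn_box s1) eta1 mulr1 mulVf // expf_neq0 // gt_eqF.
Qed.

Section kernel.
Variables (n : nat) (k : 'rV[R]_n -> R) (N : R).
Hypothesis Hk : kernel_on k N.

Let NN : - N <= N.
Proof. by apply: (@le_trans _ _ 0); rewrite ?oppr_le0 (ker_N0 Hk). Qed.

Let J := @iter_int R `[- N, N] n.
Let HJ := cint_iter n NN.

Lemma tconvE (f : 'rV[R]_n -> R) x : tconv k f x = J (fun y => k y * f (x - y)).
Proof. by apply: int_Rn_box => v /(ker_supp Hk) ->; rewrite mul0r. Qed.

Let jsub (f : 'rV[R]_n -> R) : continuous f -> jcont (fun x y : 'rV[R]_n => f (x - y)).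
Proof.
move=> cf; apply: (continuous_compc (f := fun z : 'rV[R]_n * 'rV[R]_n => z.1 - z.2) _ cf) => z.
by apply: cvgB; [exact: cvg_fst|exact: cvg_snd].
Qed.

Let jker (f : 'rV[R]_n -> R) : continuous f -> jcont (fun x y : 'rV[R]_n => k y * f (x - y)).
Proof.
move=> cf; apply: continuousMc; last exact: jsub.
by apply: continuous_compc (ker_cont Hk); exact: continuous_snd.
Qed.

Lemma tconv_continuous (f : 'rV[R]_n -> R) : continuous f -> continuous (tconv k f).
Proof.
move=> cf; rewrite (_ : tconv k f = fun x => J (fun y => k y * f (x - y))).
  by apply: (cint_jcont HJ); exact: jker.
by apply/funext => x; exact: tconvE.
Qed.

Lemma tconv_periodic (f : 'rV[R]_n -> R) : Zperiodic f -> Zperiodic (tconv k f).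
Proof.
move=> pf x i; rewrite !tconvE; congr J; apply/funext => y.
by rewrite addrAC pf.
Qed.

Lemma tconv_ge0 (f : 'rV[R]_n -> R) x : continuous f -> (forall x, 0 <= f x) -> 0 <= tconv k f x.
Proof.
move=> cf f0; rewrite tconvE; apply: (cint_ge0 HJ).
  exact: (@jcont_sec R 'rV[R]_n 'rV[R]_n (fun x y => k y * f (x - y)) x (jker cf)).
by move=> y _; rewrite mulr_ge0 // (ker_ge0 Hk).
Qed.

Lemma tconv_cst (c : R) x : tconv k (fun=> c) x = c.
Proof.
rewrite tconvE; transitivity (J (fun y => c * k y)).
  by congr J; apply/funext => y; rewrite mulrC.
rewrite [LHS](cintZ HJ); last exact: ker_cont Hk.
by have := ker_1 Hk; rewrite -/J => ->; rewrite mulr1.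
Qed.

Lemma tconv_shift (f : 'rV[R]_n -> R) w x : tconv k (fun y => f (y + w)) x = tconv k f (x + w).
Proof. by rewrite !tconvE; congr J; apply/funext => y; rewrite addrAC. Qed.

(** After Fubini, the substitution y -> - y and the translation x -> x - y exchange the roles of f
    and g; evenness of k makes the weight agree. *)
Lemma tconv_adjoint (f g : 'rV[R]_n -> R) : continuous f -> continuous g -> Zperiodic f -> Zperiodic g ->
  int_torus (fun x => tconv k f x * g x) = int_torus (fun x => f x * tconv k g x).
Proof.
move=> cf cg pf pg.
have NHJ := NN.
have j1 : jcont (fun x y : 'rV[R]_n => k y * f (x - y) * g x).
  apply: continuousMc; first exact: jker.
  by apply: continuous_compc cg; exact: continuous_fst.
have j2 : jcont (fun x y : 'rV[R]_n => k y * g (x - y) * f x).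
  apply: continuousMc; first exact: jker.
  by apply: continuous_compc cf; exact: continuous_fst.
have E1 : int_torus (fun x => tconv k f x * g x) =
    int_torus (fun x => J (fun y => k y * f (x - y) * g x)).
  congr int_torus; apply/funext => x; rewrite tconvE mulrC -(cintZ HJ).
    by congr J; apply/funext => y; rewrite mulrC.
  exact: (@jcont_sec R 'rV[R]_n 'rV[R]_n (fun x y => k y * f (x - y)) x (jker cf)).
have E2 : int_torus (fun x => f x * tconv k g x) =
    int_torus (fun x => J (fun y => k y * g (x - y) * f x)).
  congr int_torus; apply/funext => x; rewrite tconvE -(cintZ HJ).
    by congr J; apply/funext => y; rewrite mulrC.
  exact: (@jcont_sec R 'rV[R]_n 'rV[R]_n (fun x y => k y * g (x - y)) x (jker cg)).
rewrite E1 E2 /int_torus !(iter_cint_swap HJ ler01) //.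
rewrite -/(int_torus _) -[LHS]iter_int_reflect ?(ker_N0 Hk) //; last first.
  by apply: (cint_jcont (cint_iter n ler01)); exact: jcont_swap.
congr J; apply/funext => y; rewrite -[LHS]/(int_torus _) -[RHS]/(int_torus _).
rewrite -[LHS](torus_shift (- y)).
- by congr int_torus; apply/funext => x; rewrite (ker_even Hk) opprK subrK mulrAC.
- exact: (@jcont_sec R 'rV[R]_n 'rV[R]_n (fun y x => k y * f (x - y) * g x) (- y) (jcont_swap j1)).
- by move=> x i; rewrite addrAC pf pg.
Qed.

Lemma torus_tconv (f : 'rV[R]_n -> R) : continuous f -> Zperiodic f -> int_torus (tconv k f) = int_torus f.
Proof.
move=> cf pf.
have := @tconv_adjoint f (fun=> 1) cf (@cst_continuous 'rV[R]_n R 1) pf (fun _ _ => erefl).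
have -> : (fun x => tconv k f x * 1) = tconv k f by apply/funext => x; rewrite mulr1.
move=> ->; congr int_torus; apply/funext => x.
by rewrite tconv_cst mulr1.
Qed.

End kernel.
End convolution.

(** * The Gagliardo-Nirenberg inequality *)

Section holder.
Context {R : realType}.

Lemma weighted_amgm (u v th : R) : 0 <= u -> 0 <= v -> 0 <= th <= 1 ->
  powR u th * powR v (1 - th) <= th * u + (1 - th) * v.
Proof.
(* The values 0 and 1 of th are separated because Young's inequality is applied with the conjugate
   exponents 1/th and 1/(1 - th). *)
move=> u0 v0 /andP[]; rewrite le_eqVlt => /predU1P[<- _|th0].
  by rewrite powRr0 subr0 powRr1 // mul0r add0r.
rewrite le_eqVlt => /predU1P[->|th1].
  by rewrite subrr powRr0 powRr1 // mul0r addr0 mulr1 mul1r.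
have t1 : 0 < 1 - th by rewrite subr_gt0.
have := @conjugate_powR R (powR u th) (powR v (1 - th)) th^-1 (1 - th)^-1.
rewrite !powR_ge0 !invr_gt0 !invrK -!powRrM !mulfV ?gt_eqF // !powRr1 //.
by move=> /(_ isT isT th0 t1); rewrite addrC subrK [u * _]mulrC [v * _]mulrC; apply.
Qed.

Section cint_holder.
Variables (X : topologicalType) (K : set X) (I : (X -> R) -> R).
Hypothesis HI : cint K 1 I.

Lemma cint_gt0 (f : X -> R) : continuous f -> (forall x, K x -> 0 < f x) -> 0 < I f.
Proof.
(* K is nonempty: otherwise monotonicity would compare I 1 = 1 with I 0 = 0 in the wrong
   direction. *)
move=> cf f0; have K0 : K !=set0.
  apply/set0P/eqP => K0; have : (1 : R) <= 0; last by rewrite ler10.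
  rewrite -{1}(cint_1 HI) -(cint0 HI); apply: (cint_le HI); try exact: cst_continuous.
  by move=> x; rewrite K0.
have [c] := compact_EVT_min K0 (cint_compact HI) (continuous_subspaceT cf).
rewrite inE => Kc cmin; apply: (@lt_le_trans _ _ (f c)); first exact: f0.
rewrite -[f c]mulr1 -(cint_cst HI); apply: (cint_le HI) => //; first exact: cst_continuous.
by move=> x Kx; apply: cmin; rewrite inE.
Qed.

(** After dividing a and b by their integrals, the weighted arithmetic-geometric inequality holds
    pointwise, and its right-hand side integrates to th + (1 - th) = 1. *)
Lemma cint_holder (a b : X -> R) (th : R) : continuous a -> continuous b ->
  (forall x, 0 < a x) -> (forall x, 0 < b x) -> 0 <= th <= 1 ->
  I (fun x => powR (a x) th * powR (b x) (1 - th)) <= powR (I a) th * powR (I b) (1 - th).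
Proof.
move=> ca cb a0 b0 th01.
have A0 : 0 < I a by apply: cint_gt0.
have B0 : 0 < I b by apply: cint_gt0.
set C := powR (I a) th * powR (I b) (1 - th).
have cp (f : X -> R) e : continuous f -> (forall x, 0 < f x) -> continuous (fun x => powR (f x) e).
  by move=> cf f0 x; apply: powR_continuous_pos => //; exact: cf.
have cZ (f : X -> R) (c : R) : continuous f -> continuous (fun x => c * f x).
  by move=> cf; apply: continuousMc => //; exact: cst_continuous.
apply: (@le_trans _ _ (I (fun x => C * (th / I a) * a x + C * ((1 - th) / I b) * b x))).
  apply: (cint_le HI).
  - by apply: continuousMc; exact: cp.
  - by apply: continuousDc; exact: cZ.
  - move=> x _.
    have h := @weighted_amgm (a x / I a) (b x / I b) th.
    have -> : powR (a x) th * powR (b x) (1 - th) =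
       C * (powR (a x / I a) th * powR (b x / I b) (1 - th)).
      have e (p q e : R) : 0 < p -> 0 < q -> powR p e = powR (p / q) e * powR q e.
        by move=> p0 q0; rewrite -powRM ?divfK ?gt_eqF // ?ltW // divr_gt0.
      by rewrite (e _ _ _ (a0 x) A0) (e _ _ _ (b0 x) B0) /C; ring.
    apply: (@le_trans _ _ (C * (th * (a x / I a) + (1 - th) * (b x / I b)))).
      apply: ler_wpM2l; first by rewrite mulr_ge0 ?powR_ge0.
      apply: h => //.
        by rewrite divr_ge0 ?(ltW A0) ?(ltW (a0 x)).
      by rewrite divr_ge0 ?(ltW B0) ?(ltW (b0 x)).
    by rewrite le_eqVlt; apply/orP; left; apply/eqP; ring.
rewrite (cintD HI); [|exact: cZ|exact: cZ].
rewrite !(cintZ HI) //; clearbody C; suff -> : C * (th / I a) * I a + C * ((1 - th) / I b) * I b = C by [].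
by field; rewrite !gt_eqF.
Qed.

End cint_holder.
End holder.

Section gagliardo.
Context {R : realType}.
Local Notation mu := (@lebesgue_measure R).

(** At a minimum point c the value f c is at most the mean of f, and f t - f c is at most the
    integral of [|f'|]. *)
Lemma sup_le_W11 (f f' : R -> R) (t : R) : continuous f' ->
  (forall s : R, is_derive s 1 f (f' s)) -> (forall s, 0 <= f s) -> 0 <= t <= 1 ->
  f t <= Rintegral mu `[0, 1] (fun s => f s + `|f' s|).
Proof.
move=> cf' df f0 /andP[t0 t1].
have cf : continuous f.
  by move=> s; apply/differentiable_continuous/derivable1_diffP; have [] := df s.
have H1 := @cint_segment R 0 1 ler01.
have can : continuous (fun s => `|f' s|) by move=> s; apply: cvg_norm; exact: cf'.
rewrite (cintD H1) //.
have [c] := EVT_min ler01 (continuous_subspaceT cf).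
rewrite in_itv /= => /andP[c0 c1] cmin.
have fc : f c <= Rintegral mu `[0, 1] f.
  have -> : f c = f c * (1 - 0) by rewrite subr0 mulr1.
  rewrite -(cint_cst H1); apply: (cint_le H1) => //; first exact: cst_continuous.
have nn lo hi : lo <= hi -> 0 <= Rintegral mu `[lo, hi] (fun s => `|f' s|).
  by move=> h; apply: (cint_ge0 (cint_segment h)).
have sub lo hi : 0 <= lo -> lo <= hi -> hi <= 1 ->
    `|f hi - f lo| <= Rintegral mu `[0, 1] (fun s => `|f' s|).
  move=> l0 lh h1; rewrite -(@Rint_FTC R f' f lo hi lh cf' (fun s _ => df s)).
  rewrite (@Rint_split R _ 0 lo 1) ?l0 ?(le_trans lh) //.
  rewrite (@Rint_split R _ lo hi 1) ?lh //.
  apply: (@le_trans _ _ (Rintegral mu `[lo, hi] (fun s => `|f' s|))).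
    by apply: le_normr_Rintegral => //; exact: continuous_integrable.
  by have := nn _ _ l0; have := nn _ _ h1; lra.
have : `|f t - f c| <= Rintegral mu `[0, 1] (fun s => `|f' s|).
  by have [ct|tc] := leP c t; [apply: sub|rewrite distrC; apply: sub => //; exact: ltW].
by move=> /(le_trans (ler_norm _)); lra.
Qed.

Lemma rcons0_line0 n (t : R) (v : 'rV[R]_n) : rcons0 t v = rcons0 0 v + t *: ebasis R ord0.
Proof.
apply: row_ext0 => [|j]; rewrite !(rcons0_0, rcons0_S, mxE) /=.
  by rewrite mulr1 add0r.
by rewrite mulr0 addr0.
Qed.

Lemma rcons0_lineS n (t s : R) (v : 'rV[R]_n) j :
  rcons0 t (v + s *: ebasis R j) = rcons0 t v + s *: ebasis R (lift ord0 j).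
Proof.
apply: row_ext0 => [|i]; rewrite !(rcons0_0, rcons0_S, mxE) /=.
  by rewrite mulr0 addr0.
by rewrite (inj_eq lift_inj).
Qed.

Lemma is_derive_slice0 n (F : 'rV[R]_n.+1 -> R) v (t : R) : Ck 1 F ->
  is_derive t 1 (fun t => F (rcons0 t v)) (dpartial ord0 F (rcons0 t v)).
Proof.
case=> _ /(_ ord0)[dF _]; have := @is_derive_line R _ F (rcons0 0 v) (ebasis R ord0) t (dF _).
rewrite -rcons0_line0; congr (is_derive _ _ _ _).
by apply/funext => h; rewrite -rcons0_line0.
Qed.

Lemma is_derive_sliceS n (F : 'rV[R]_n.+1 -> R) v (t : R) j : Ck 1 F ->
  is_derive v (ebasis R j) (fun v => F (rcons0 t v)) (dpartial (lift ord0 j) F (rcons0 t v)).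
Proof.
case=> _ /(_ (lift ord0 j))[dF _]; apply: derivable_line0.
have e : rcons0 t v + 0 *: ebasis R (lift ord0 j) = rcons0 t v by rewrite scale0r addr0.
have := @is_derive_line R _ F (rcons0 t v) (ebasis R (lift ord0 j)) 0 (dF _).
rewrite e; congr (is_derive _ _ _ _).
by apply/funext => h; rewrite -rcons0_lineS.
Qed.

Lemma Ck1_slice n (F : 'rV[R]_n.+1 -> R) (t : R) : Ck 1 F -> Ck 1 (fun v => F (rcons0 t v)).
Proof.
move=> CF; have cs (G : 'rV[R]_n.+1 -> R) : continuous G -> continuous (fun v => G (rcons0 t v)).
  by move=> cG; exact: (@jcont_sec R R 'rV[R]_n (fun t v => G (rcons0 t v)) t (jcont_rcons0 cG)).
split; first by apply: cs; exact: Ck_cont CF.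
move=> j; split=> [v|]; first by have [] := is_derive_sliceS v t j CF.
split=> //; rewrite (_ : dpartial j _ = fun v => dpartial (lift ord0 j) F (rcons0 t v)).
  by apply: cs; exact: Ck_cont (Ck_dpartial _ CF).
by apply/funext => v; apply: derive_val; exact: is_derive_sliceS.
Qed.

(** The W^{1,1} norm in the single direction i. The function is not wrapped in an absolute value
    because it is applied to positive functions. *)
Definition W11 n (i : 'I_n) (F : 'rV[R]_n -> R) : R :=
  int_torus (fun x => F x + `|dpartial i F x|).

Lemma W11_cont n (i : 'I_n) (F : 'rV[R]_n -> R) : Ck 1 F ->
  continuous (fun x => F x + `|dpartial i F x|).
Proof.
move=> CF; apply: continuousDc; first exact: Ck_cont CF.
have cd : continuous (dpartial i F) := Ck_cont (Ck_dpartial i CF).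
exact: continuous_compc cd (@norm_continuous _ R).
Qed.

Lemma W11_ge0 n (i : 'I_n) (F : 'rV[R]_n -> R) : Ck 1 F -> (forall x, 0 < F x) -> 0 <= W11 i F.
Proof.
move=> CF F0; apply: (cint_ge0 (cintT n)); first exact: W11_cont.
by move=> x _; rewrite addr_ge0 // ltW.
Qed.

Definition W0 n (F : 'rV[R]_n.+1 -> R) (v : 'rV[R]_n) : R :=
  Rintegral mu `[0, 1] (fun t => F (rcons0 t v) + `|dpartial ord0 F (rcons0 t v)|).

Lemma W0_cont n (F : 'rV[R]_n.+1 -> R) : Ck 1 F -> continuous (W0 F).
Proof.
move=> CF; apply: (cint_jcont (cint_segment ler01)).
exact: jcont_swap (jcont_rcons0 (@W11_cont _ ord0 F CF)).
Qed.

Lemma W0_gt0 n (F : 'rV[R]_n.+1 -> R) v : Ck 1 F -> (forall x, 0 < F x) -> 0 < W0 F v.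
Proof.
move=> CF F0; have := @cint_segment R 0 1 ler01; rewrite subr0 => H1.
apply: (cint_gt0 H1).
  exact: (@jcont_sec _ _ _ (fun v t => F (rcons0 t v) + `|dpartial ord0 F (rcons0 t v)|) v
    (jcont_swap (jcont_rcons0 (@W11_cont _ ord0 F CF)))).
by move=> t _; rewrite ltr_wpDr.
Qed.

Lemma le_W0 n (F : 'rV[R]_n.+1 -> R) v (t : R) : Ck 1 F -> (forall x, 0 < F x) ->
  0 <= t <= 1 -> F (rcons0 t v) <= W0 F v.
Proof.
move=> CF F0 t01; apply: (@sup_le_W11 (fun t => F (rcons0 t v))
   (fun t => dpartial ord0 F (rcons0 t v))) => //.
- exact: (@jcont_sec _ _ _ (fun v t => dpartial ord0 F (rcons0 t v)) v
    (jcont_swap (jcont_rcons0 (Ck_cont (Ck_dpartial _ CF))))).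
- by move=> s; exact: is_derive_slice0.
- by move=> s; exact: ltW.
Qed.

Lemma torus_W0 n (F : 'rV[R]_n.+1 -> R) : Ck 1 F -> int_torus (W0 F) = W11 ord0 F.
Proof.
move=> CF; rewrite /W11 /int_torus iter_intS.
apply/esym; apply: (@Rint_cint_swap R _ _ _ (@int_torus R n)
  (fun t v => F (rcons0 t v) + `|dpartial ord0 F (rcons0 t v)|) 0 1 (cintT n) ler01).
exact: jcont_rcons0 (@W11_cont _ ord0 F CF).
Qed.

(* The weighted form in dimension n follows from the unweighted inequality in dimension n by
   Hoelder, and implies the unweighted one in dimension n + 1: integrate over the last n
   coordinates with the weight [W0 F], the W^{1,1} norm along the first one, which bounds [F]. *)
Let gagliardo_weighted (n : nat) := forall (K F : 'rV[R]_n -> R), continuous K ->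
  (forall x, 0 < K x) -> Ck 1 F -> (forall x, 0 < F x) ->
  int_torus (fun x => powR (K x) n%:R^-1 * F x) <= powR (int_torus K) n%:R^-1 * \sum_i W11 i F.

Lemma gagliardo_step n (F : 'rV[R]_n.+1 -> R) : (0 < n)%N -> gagliardo_weighted n ->
  Ck 1 F -> (forall x, 0 < F x) ->
  int_torus (fun x => powR (F x) (1 + n%:R^-1)) <= powR (\sum_i W11 i F) (1 + n%:R^-1).
Proof.
move=> n0 IH CF F0; have H1 := @cint_segment R 0 1 ler01.
have ni0 : 0 < n%:R^-1 :> R by rewrite invr_gt0 ltr0n.
have cF := Ck_cont CF.
have cp (N : nat) (f : 'rV[R]_N -> R) e : continuous f -> (forall x, 0 < f x) ->
    continuous (fun x => powR (f x) e).
  by move=> cf f0 x; apply: powR_continuous_pos => //; exact: cf.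
have cI (f : R -> 'rV[R]_n -> R) : jcont f -> continuous (fun t => int_torus (f t)).
  by move=> jf; apply: (cint_jcont (cintT n)).
have cW i : continuous (fun t => W11 i (fun v => F (rcons0 t v))).
  apply: (cI (fun t v => F (rcons0 t v) + `|dpartial i (fun v => F (rcons0 t v)) v|)).
  have -> : (fun t v => F (rcons0 t v) + `|dpartial i (fun v => F (rcons0 t v)) v|) =
       (fun t v => F (rcons0 t v) + `|dpartial (lift ord0 i) F (rcons0 t v)|).
    apply/funext => t; apply/funext => v; congr (_ + `|_|).
    by apply: derive_val; exact: is_derive_sliceS.
  exact: jcont_rcons0 (@W11_cont _ (lift ord0 i) F CF).
apply: (@le_trans _ _ (Rintegral mu `[0, 1]
    (fun t => powR (W11 ord0 F) n%:R^-1 * \sum_i W11 i (fun v => F (rcons0 t v))))).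
  rewrite /int_torus iter_intS; apply: (cint_le H1).
  - apply: (cI (fun t v => powR (F (rcons0 t v)) (1 + n%:R^-1))).
    by apply: (@jcont_rcons0 R n (fun x => powR (F x) (1 + n%:R^-1))); exact: cp.
  - apply: continuousMc; first exact: cst_continuous.
    exact: continuous_sum.
  move=> t; rewrite /= in_itv /= => t01.
  apply: (@le_trans _ _ (int_torus (fun v => powR (W0 F v) n%:R^-1 * F (rcons0 t v)))).
    apply: (cint_le (cintT n)).
    - by apply: cp; [exact: Ck_cont (Ck1_slice t CF)|move=> x].
    - apply: continuousMc; last exact: Ck_cont (Ck1_slice t CF).
      by apply: cp; [exact: W0_cont|move=> x; exact: W0_gt0].
    (* Of the two factors F^(1/n) and F only the first is replaced, by the power of a bound that no
       longer depends on t. *)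
    move=> v _; rewrite powRD; last by rewrite gt_eqF ?implybT.
    rewrite powRr1 ?(ltW (F0 _)) // mulrC ler_wpM2r ?(ltW (F0 _)) //.
    by apply: ge0_ler_powR; rewrite ?nnegrE ?(ltW ni0) ?(ltW (F0 _)) ?(ltW (W0_gt0 _ CF F0)) ?le_W0.
  rewrite -torus_W0 //; apply: IH => //; [exact: W0_cont|move=> x; exact: W0_gt0|].
  exact: Ck1_slice.
rewrite (cintZ H1); last exact: continuous_sum.
rewrite (cint_sum H1) //.
have E i : Rintegral mu `[0, 1] (fun t => W11 i (fun v => F (rcons0 t v))) = W11 (lift ord0 i) F.
  rewrite /W11 /int_torus iter_intS; congr Rintegral; apply/funext => t; congr iter_int.
  apply/funext => v; congr (_ + `|_|).
  by apply: derive_val; exact: is_derive_sliceS.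
under eq_bigr do rewrite E.
rewrite big_ord_recl; set P := W11 ord0 F; set Q := \sum_i _.
have P0 : 0 <= P by exact: W11_ge0.
have Q0 : 0 <= Q by apply: sumr_ge0 => i _; exact: W11_ge0.
rewrite powRD; last by rewrite gt_eqF // addr_gt0.
rewrite powRr1 ?addr_ge0 // mulrC ler_pM ?powR_ge0 ?lerDr //.
by apply: ge0_ler_powR; rewrite ?nnegrE ?(ltW ni0) ?addr_ge0 ?lerDl.
Qed.

Lemma gagliardo_wt n : gagliardo_weighted n.+1.
Proof.
elim: n => [|n IH] K F cK K0 CF F0.
  rewrite big_ord_recl big_ord0 addr0 invr1.
  have H := @cintT R 1; have IK0 : 0 <= int_torus K.
    by apply: (cint_ge0 H) => // x _; exact: ltW.
  rewrite powRr1 // mulrC -(cintZ H) //; apply: (cint_le H).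
  - apply: continuousMc; last exact: Ck_cont CF.
    by move=> x; apply: powR_continuous_pos => //; exact: cK.
  - exact: continuousZc.
  move=> x xb; rewrite powRr1 ?(ltW (K0 _)) // mulrC ler_wpM2r ?(ltW (K0 _)) //.
  have -> : x = rcons0 (x 0 0) 0 by apply: row_ext0 => [|[]//]; rewrite rcons0_0.
  rewrite -torus_W0 // /int_torus /=; apply: le_W0 => //.
  by have := xb 0; rewrite /= in_itv.
set N := n.+2; have N0 : (0 : R) < N%:R by rewrite ltr0n.
have th01 : 0 <= (N%:R^-1 : R) <= 1.
  by rewrite invr_ge0 ler0n /= invf_le1 // ler1n.
(* With N = n + 2, the Hoelder exponent conjugate to N is 1 + 1/(N - 1), exactly the power in the
   unweighted inequality. *)
have M1 : (1 + n.+1%:R^-1) * (1 - N%:R^-1) = 1 :> R.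
  have gen (y : R) : 0 < y -> (1 + y^-1) * (1 - (y + 1)^-1) = 1.
    by move=> y0; field; rewrite !gt_eqF ?addr_gt0.
  have -> : N%:R = n.+1%:R + 1 :> R by rewrite natr1.
  by apply: gen; rewrite ltr0n.
have G0 x : 0 < powR (F x) (1 + n.+1%:R^-1) by apply: powR_gt0.
have cG : continuous (fun x => powR (F x) (1 + n.+1%:R^-1)).
  by move=> x; apply: powR_continuous_pos => //; exact: (Ck_cont CF).
have := cint_holder (cintT N) cK cG K0 G0 th01.
have -> : (fun x => powR (K x) N%:R^-1 * powR (powR (F x) (1 + n.+1%:R^-1)) (1 - N%:R^-1)) =
   (fun x => powR (K x) N%:R^-1 * F x).
  by apply/funext => x; rewrite -powRrM M1 powRr1 // ltW.
move=> h; apply: le_trans h _; rewrite ler_wpM2l ?powR_ge0 //.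
have S0 : 0 <= \sum_(i < N) W11 i F by apply: sumr_ge0 => i _; exact: W11_ge0.
rewrite [leRHS](_ : _ = powR (powR (\sum_(i < N) W11 i F) (1 + n.+1%:R^-1)) (1 - N%:R^-1)); last first.
  by rewrite -powRrM M1 powRr1.
apply: ge0_ler_powR.
- by case/andP: th01 => _; rewrite subr_ge0.
- by rewrite nnegrE; apply: (cint_ge0 (cintT N)) => // x _; exact: ltW.
- by rewrite nnegrE powR_ge0.
- by apply: gagliardo_step.
Qed.

Lemma gagliardo n (F : 'rV[R]_n.+2 -> R) : Ck 1 F -> (forall x, 0 < F x) ->
  int_torus (fun x => powR (F x) (1 + n.+1%:R^-1)) <= powR (\sum_i W11 i F) (1 + n.+1%:R^-1).
Proof. by apply: gagliardo_step => //; exact: gagliardo_wt. Qed.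

End gagliardo.

Lemma onem_half (R : realType) : 1 - 2^-1 = 2^-1 :> R.
Proof. by lra. Qed.

Lemma half_in01 (R : realType) : 0 <= (2^-1 : R) <= 1.
Proof. by lra. Qed.

Lemma le_double_sum (R : realFieldType) (b y E : R) : 0 <= b -> 0 <= y -> 0 <= E ->
  2 * y + 2 * b * E <= 2 * (1 + b) * (y + E).
Proof. by move=> b0 y0 E0; have := mulr_ge0 b0 y0; lra. Qed.

Lemma gn_regroup (R : comRingType) (N b Y y E X : R) :
  N * (2 * b) * (Y * (y + E)) * X = N * ((Y * X) * (2 * b * (y + E))).
Proof. by ring. Qed.

Section interpolation.
Context {R : realType}.
Variables (n : nat) (m : 'rV[R]_n.+2 -> R) (q : R).
Hypotheses (Cm : Ck 1 m) (m0 : forall x, 0 < m x) (q0 : 0 < q).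
Variables (K : set 'rV[R]_n.+2) (I : ('rV[R]_n.+2 -> R) -> R).
Hypothesis HI : cint K 1 I.
Hypothesis gag : forall F : 'rV[R]_n.+2 -> R, Ck 1 F -> (forall x, 0 < F x) ->
  I (fun x => powR (F x) (1 + n.+1%:R^-1)) <=
  powR (\sum_i I (fun x => F x + `|dpartial i F x|)) (1 + n.+1%:R^-1).
Let c : R := n.+2%:R^-1.
(** Since (1 + 1/(d - 1)) (1 - c) = 1 with c = 1/d, raising m^beta to the power 1 + 1/(d - 1) gives
    m^(q (1 + 2 c)). So [J] is the left side of Gagliardo's inequality for m^beta. *)
Let beta := q * (1 + 2 * c) * (1 - c).
Let y := I (fun x => powR (m x) q).
Let E := I (fun x => powR (m x) (q - 2) * \sum_i dpartial i m x ^+ 2).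
Let J := I (fun x => powR (m x) (q * (1 + 2 * c))).

Let cP e : continuous (fun x => powR (m x) e).
Proof. by move=> x; apply: powR_continuous_pos => //; exact: (Ck_cont Cm). Qed.

Let cd i : continuous (dpartial i m). Proof. exact: Ck_cont (Ck_dpartial i Cm). Qed.

Let cdn i : continuous (fun x => `|dpartial i m x|).
Proof. exact: continuous_compc (@cd i) (@norm_continuous _ R). Qed.

Let cd2 i : continuous (fun x => dpartial i m x ^+ 2).
Proof. by rewrite (_ : (fun x => _) = (fun x => dpartial i m x * dpartial i m x)) //; exact: continuousMc. Qed.

Let cE : continuous (fun x => powR (m x) (q - 2) * \sum_i dpartial i m x ^+ 2).
Proof. by apply: continuousMc => //; exact: continuous_sum. Qed.

Let c2 : [/\ 0 < c, 2 * c <= 1 & 0 <= 2 * (1 - c)].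
Proof.
have p : 0 < n.+2%:R :> R by rewrite ltr0n.
have c0 : 0 < c by rewrite invr_gt0.
have c1 : 2 * c <= 1 by rewrite -(ler_pM2r p) mulfVK ?gt_eqF // mul1r ler_nat.
have c1' : c <= 1 by apply: le_trans c1; rewrite ler_peMl ?ler1n // ltW.
by split=> //; rewrite mulr_ge0 // subr_ge0.
Qed.

Let e1c : (1 + n.+1%:R^-1) * (1 - c) = 1.
Proof.
have gen (z : R) : 0 < z -> (1 + z^-1) * (1 - (z + 1)^-1) = 1.
  by move=> z0; field; rewrite !gt_eqF ?addr_gt0.
have e : n.+2%:R = n.+1%:R + 1 :> R by rewrite natr1.
rewrite /c e; by apply: gen; rewrite ltr0n.
Qed.

Let PD a b x : powR (m x) (a + b) = powR (m x) a * powR (m x) b.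
Proof. by rewrite powRD // (gt_eqF (m0 x)) implybT. Qed.

(* Gagliardo's inequality for m^beta, whose gradient term is controlled by Cauchy-Schwarz,
   m^(beta-1) |Dm| = m^(beta - q/2) m^(q/2 - 1) |Dm|, and interpolation of
   int m^(2 beta - q) between the exponents q and q (1 + 2/d). *)
Lemma cint_gagliardo_nirenberg :
  J <= n.+2%:R ^+ 2 * (2 * (1 + beta ^+ 2)) * (powR y (2 * c) * (y + E)).
Proof.
have [c0 c21 c10] := c2.
have b0 : 0 <= beta.
  by rewrite /beta; apply: mulr_ge0; [apply: mulr_ge0; [exact: ltW|lra]|lra].
have y0 : 0 < y by apply: (cint_gt0 HI) => // x _; exact: powR_gt0.
have J0 : 0 < J by apply: (cint_gt0 HI) => // x _; exact: powR_gt0.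
have E0 : 0 <= E.
  apply: (cint_ge0 HI) => // x _; rewrite mulr_ge0 ?powR_ge0 // sumr_ge0 // => i _.
  exact: sqr_ge0.
pose A := I (fun x => powR (m x) (2 * beta - q)).
pose D := 2 * (1 + beta ^+ 2) * (y + E).
have D0 : 0 <= D.
  apply: mulr_ge0; last by apply: addr_ge0 => //; exact: ltW.
  by apply: mulr_ge0 => //; apply: addr_ge0 => //; exact: sqr_ge0.
have A0 : 0 < A by apply: (cint_gt0 HI) => // x _; exact: powR_gt0.
have Ale : A <= powR y (2 * c) * powR J (1 - 2 * c).
  have t01 : 0 <= 2 * c <= 1 by rewrite c21 mulr_ge0 // ltW.
  have := cint_holder HI (@cP q) (@cP (q * (1 + 2 * c))) _ _ t01.
  rewrite -/y -/J => h; apply: le_trans (h _ _); try by move=> x; exact: powR_gt0.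
  rewrite le_eqVlt; apply/orP; left; apply/eqP; congr I; apply/funext => x.
  by rewrite -!powRrM -PD; congr powR; rewrite /beta; ring.
have CF : Ck 1 (fun x => powR (m x) beta) by exact: Ck_powR.
have dF i x : dpartial i (fun x => powR (m x) beta) x = beta * powR (m x) (beta - 1) * dpartial i m x.
  by apply: derive_val; exact: dpartial_powR.
have nrm (u v w : R) : 0 <= u -> 0 <= v -> `|u * v * w| = u * v * `|w|.
  by move=> *; rewrite normrM ger0_norm ?mulr_ge0.
pose W i x := powR (m x) beta + `|dpartial i (fun x => powR (m x) beta) x|.
have PleD i : I (W i) <= powR A 2^-1 * powR D 2^-1.
  pose h x := powR (m x) (q / 2) + beta * (powR (m x) (q / 2 - 1) * `|dpartial i m x|).
  have h0 x : 0 < h x.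
    apply: ltr_pwDl; first exact: powR_gt0.
    by apply: mulr_ge0 => //; apply: mulr_ge0 => //; exact: powR_ge0.
  have ch : continuous h.
    apply: continuousDc; first exact: cP.
    by apply: continuousMc; [exact: cst_continuous|apply: continuousMc].
  have ch2 : continuous (fun x => powR (h x) 2).
    by move=> x; apply: powR_continuous_pos => //; exact: ch.
  have := cint_holder HI (@cP (2 * beta - q)) ch2 (fun x => powR_gt0 _ (m0 x))
     (fun x => powR_gt0 _ (h0 x)) (half_in01 R).
  rewrite onem_half -/A => H; apply: (@le_trans _ _ (powR A 2^-1 * powR (I (fun x => powR (h x) 2)) 2^-1)).
    apply: le_trans H; rewrite le_eqVlt; apply/orP; left; apply/eqP; congr I; apply/funext => x.
    rewrite -!powRrM mulfV ?pnatr_eq0 // powRr1 ?(ltW (h0 _)) // /W dF (nrm _ _ _ b0 (powR_ge0 _ _)).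
    rewrite /h mulrDr -PD; congr (_ + _).
      by congr powR; field.
    transitivity (beta * (powR (m x) ((2 * beta - q) * 2^-1) * powR (m x) (q / 2 - 1))
       * `|dpartial i m x|); last by ring.
    by rewrite -PD; congr (_ * powR _ _ * _); field.
  apply: ler_wpM2l; first exact: powR_ge0.
  apply: ge0_ler_powR; rewrite ?nnegrE ?invr_ge0 //.
    by apply: (cint_ge0 HI) => // x _; exact: powR_ge0.
  apply: (@le_trans _ _ (I (fun x => 2 * powR (m x) q +
     2 * beta ^+ 2 * (powR (m x) (q - 2) * \sum_i dpartial i m x ^+ 2)))).
    apply: (cint_le HI) => //.
      by apply: continuousDc; apply: continuousMc => //; exact: cst_continuous.
    move=> x _; rewrite powR_mulrn ?(ltW (h0 x)) // /h.
    have -> : powR (m x) q = powR (m x) (q / 2) ^+ 2.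
      by rewrite -powR_mulrn ?powR_ge0 // -powRrM; congr powR; field.
    have -> : powR (m x) (q - 2) = powR (m x) (q / 2 - 1) ^+ 2.
      by rewrite -powR_mulrn ?powR_ge0 // -powRrM; congr powR; field.
    have : `|dpartial i m x| ^+ 2 <= \sum_i dpartial i m x ^+ 2.
      by rewrite real_normK ?num_real // (bigD1 i) //= lerDl sumr_ge0 // => j _; exact: sqr_ge0.
    move: (powR _ _) (powR _ _) `|_| (\sum_i _) => v u w s ws.
    apply: (@le_trans _ _ (2 * u ^+ 2 + 2 * beta ^+ 2 * (v ^+ 2 * w ^+ 2))).
      have H' := sqr_ge0 (u - beta * (v * w)).
      rewrite -subr_ge0; apply: le_trans H' _; rewrite le_eqVlt; apply/orP; left; apply/eqP; ring.
    rewrite lerD2l; apply: ler_wpM2l; first by apply: mulr_ge0 => //; exact: sqr_ge0.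
    by apply: ler_wpM2l => //; exact: sqr_ge0.
  rewrite (cintD HI); try exact: continuousZc.
  rewrite !(cintZ HI) // -/y -/E /D.
  exact: le_double_sum (sqr_ge0 _) (ltW y0) E0.
have S0 : 0 <= \sum_i I (W i).
  apply: sumr_ge0 => i _; apply: (cint_ge0 HI); first exact: W11_cont.
  by move=> x _; rewrite addr_ge0 ?powR_ge0.
have Jle : J <= powR (\sum_i I (W i)) (1 + n.+1%:R^-1).
  apply: le_trans (gag CF (fun x => powR_gt0 _ (m0 x))).
  rewrite le_eqVlt; apply/orP; left; apply/eqP; congr I; apply/funext => x.
  by rewrite -powRrM /beta -mulrA [(1 - c) * _]mulrC e1c mulr1.
have Sle : \sum_i I (W i) <= n.+2%:R * (powR A 2^-1 * powR D 2^-1).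
  apply: le_trans (ler_sum _ (fun i _ => PleD i)) _.
  by rewrite sumr_const card_ord -[leLHS]mulr_natl.
have key : powR J (2 * (1 - c)) <= n.+2%:R ^+ 2 * (A * D).
  apply: (@le_trans _ _ (powR (powR (\sum_i I (W i)) (1 + n.+1%:R^-1)) (2 * (1 - c)))).
    apply: ge0_ler_powR => //; rewrite ?nnegrE ?powR_ge0 ?(ltW J0) //.
  rewrite -powRrM mulrCA e1c mulr1 powR_mulrn //.
  have -> : n.+2%:R ^+ 2 * (A * D) = (n.+2%:R * (powR A 2^-1 * powR D 2^-1)) ^+ 2.
    rewrite !exprMn -!powR_mulrn ?powR_ge0 // -!powRrM mulVf ?pnatr_eq0 //.
    by rewrite !powRr1 // ltW.
  by rewrite ler_sqr ?nnegrE // !mulr_ge0 ?powR_ge0.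
have Jp : 0 < powR J (1 - 2 * c) by exact: powR_gt0.
rewrite -(ler_pM2r Jp).
have -> : J * powR J (1 - 2 * c) = powR J (2 * (1 - c)).
  rewrite -{1}[J]powRr1 ?(ltW J0) // -powRD; last by rewrite (gt_eqF J0) implybT.
  by congr powR; ring.
apply: (le_trans key).
rewrite gn_regroup -/D.
by rewrite ler_wpM2l ?sqr_ge0 // ler_wpM2r.
Qed.

End interpolation.

Lemma gagliardo_nirenberg (R : realType) n (m : 'rV[R]_n.+2 -> R) (q : R) :
  Ck 1 m -> (forall x, 0 < m x) -> 0 < q ->
  let c := n.+2%:R^-1 in let beta := q * (1 + 2 * c) * (1 - c) in
  let y := int_torus (fun x => powR (m x) q) in
  let E := int_torus (fun x => powR (m x) (q - 2) * \sum_i dpartial i m x ^+ 2) in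
  int_torus (fun x => powR (m x) (q * (1 + 2 * c))) <=
    n.+2%:R ^+ 2 * (2 * (1 + beta ^+ 2)) * (powR y (2 * c) * (y + E)).
Proof.
move=> Cm m0 q0; apply: (cint_gagliardo_nirenberg Cm m0 q0 (cintT n.+2)).
exact: gagliardo.
Qed.

(** * Slices and minima *)

Section slices.
Context {R : realType}.

Lemma ebasis_lshift a b (i : 'I_a) : ebasis R (lshift b i) = row_mx (ebasis R i) 0.
Proof. exact: delta_mx_lshift. Qed.

Lemma ebasis_rshift a b (i : 'I_b) : ebasis R (rshift a i) = row_mx 0 (ebasis R i).
Proof. exact: delta_mx_rshift. Qed.

Lemma row_mx_linel a b (x : 'rV[R]_a) (p : 'rV[R]_b) (s : R) i :
  row_mx (x + s *: ebasis R i) p = row_mx x p + s *: ebasis R (lshift b i).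
Proof. by rewrite ebasis_lshift scale_row_mx add_row_mx scaler0 addr0. Qed.

Lemma row_mx_liner a b (x : 'rV[R]_a) (p : 'rV[R]_b) (s : R) i :
  row_mx x (p + s *: ebasis R i) = row_mx x p + s *: ebasis R (rshift a i).
Proof. by rewrite ebasis_rshift scale_row_mx add_row_mx scaler0 addr0. Qed.

Lemma row_mx_continuous a b :
  continuous (fun z : 'rV[R]_a * 'rV[R]_b => row_mx z.1 z.2).
Proof.
move=> z; apply: (@cvg_rV _ _ (nbhs z) _) => j; rewrite mxE.
case: (fintype.splitP j) => k E.
  rewrite (_ : (fun s : 'rV[R]_a * 'rV[R]_b => row_mx s.1 s.2 0 j) = (fun s => s.1 0 k)).
    by apply: (@continuous_comp _ _ _ fst (fun v : 'rV[R]_a => v 0 k)); [exact: cvg_fst|exact: coord_continuous].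
  apply/funext => s; rewrite (_ : j = lshift b k) ?row_mxEl //; exact: val_inj.
rewrite (_ : (fun s : 'rV[R]_a * 'rV[R]_b => row_mx s.1 s.2 0 j) = (fun s => s.2 0 k)).
  by apply: (@continuous_comp _ _ _ snd (fun v : 'rV[R]_b => v 0 k)); [exact: cvg_snd|exact: coord_continuous].
apply/funext => s; rewrite (_ : j = rshift a k) ?row_mxEr //; exact: val_inj.
Qed.

Lemma is_derive_coord n (x : 'rV[R]_n) i j :
  is_derive x (ebasis R i) (fun x => x 0 j) (i == j)%:R.
Proof.
apply: derivable_line0; rewrite (_ : (fun h : R => _) = (fun h => x 0 j + (i == j)%:R * h)).
  rewrite -[X in is_derive _ _ _ X]add0r.
  apply: (@is_deriveD _ _ _ (cst (x 0 j)) (fun h : R => (i == j)%:R * h)).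
  have := @is_deriveZ _ _ _ (@id R) (i == j)%:R 0 1 1 (is_derive_id _ _).
  by rewrite [_ *: 1]mulr1.
by apply/funext => h; rewrite !mxE eqxx /= mulrC eq_sym.
Qed.

Lemma dpartial_coord n i j : dpartial i (fun x : 'rV[R]_n => x 0 j) = (fun=> (i == j)%:R).
Proof. by apply/funext => x; apply: derive_val; exact: is_derive_coord. Qed.

Lemma Ck_coord k n j : Ck k (fun x : 'rV[R]_n => x 0 j).
Proof.
case: k => [|k]; first by split=> //; exact: coord_continuous.
split; first exact: coord_continuous.
move=> i; split=> [x|]; first by have [] := is_derive_coord x i j.
by rewrite dpartial_coord; exact: Ck_cst.
Qed.

Section two_blocks.
Variables (a b : nat).
Implicit Types (F : 'rV[R]_(a + b) -> R) (x : 'rV[R]_a) (p : 'rV[R]_b).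

Lemma is_derive_row_mxl F x p i : Ck 1 F ->
  is_derive x (ebasis R i) (fun x => F (row_mx x p)) (dpartial (lshift b i) F (row_mx x p)).
Proof.
case=> _ /(_ (lshift b i))[dF _]; apply: derivable_line0.
have e : row_mx x p + 0 *: ebasis R (lshift b i) = row_mx x p by rewrite scale0r addr0.
have := @is_derive_line R _ F (row_mx x p) (ebasis R (lshift b i)) 0 (dF _).
rewrite e; congr (is_derive _ _ _ _).
by apply/funext => h; rewrite -row_mx_linel.
Qed.

Lemma is_derive_row_mxr F x p i : Ck 1 F ->
  is_derive p (ebasis R i) (fun p => F (row_mx x p)) (dpartial (rshift a i) F (row_mx x p)).
Proof.
case=> _ /(_ (rshift a i))[dF _]; apply: derivable_line0.
have e : row_mx x p + 0 *: ebasis R (rshift a i) = row_mx x p by rewrite scale0r addr0.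
have := @is_derive_line R _ F (row_mx x p) (ebasis R (rshift a i)) 0 (dF _).
rewrite e; congr (is_derive _ _ _ _).
by apply/funext => h; rewrite -row_mx_liner.
Qed.

Lemma dpartial_row_mxl F p i : Ck 1 F ->
  dpartial i (fun x => F (row_mx x p)) = (fun x => dpartial (lshift b i) F (row_mx x p)).
Proof. by move=> CF; apply/funext => x; apply: derive_val; exact: is_derive_row_mxl. Qed.

Lemma dpartial_row_mxr F x i : Ck 1 F ->
  dpartial i (fun p => F (row_mx x p)) = (fun p => dpartial (rshift a i) F (row_mx x p)).
Proof. by move=> CF; apply/funext => p; apply: derive_val; exact: is_derive_row_mxr. Qed.

Lemma row_mx_cont F (S : topologicalType) (f : S -> 'rV[R]_a) (g : S -> 'rV[R]_b) :
  continuous F -> continuous f -> continuous g -> continuous (fun s => F (row_mx (f s) (g s))).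
Proof.
move=> cF cf cg; apply: (continuous_compc (f := fun s => row_mx (f s) (g s)) _ cF).
apply: (continuous_compc (f := fun s => (f s, g s)) _ (@row_mx_continuous a b)).
exact: continuous_pairc.
Qed.

Lemma Ck_row_mxl k F p : Ck k F -> Ck k (fun x => F (row_mx x p)).
Proof.
elim: k F => [|k IH] F CF.
  split=> //; apply: row_mx_cont; [exact: Ck_cont CF|by move=> x; exact: cvg_id|exact: cst_continuous].
split.
  apply: row_mx_cont; [exact: Ck_cont CF|by move=> x; exact: cvg_id|exact: cst_continuous].
have C1 : Ck 1 F by exact: CkW CF.
move=> i; split=> [x|]; first by have [] := is_derive_row_mxl x p i C1.
by rewrite dpartial_row_mxl //; apply: IH; exact: Ck_dpartial.
Qed.

Lemma Ck_graph k F (v : 'rV[R]_a -> 'rV[R]_b) : Ck k F ->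
  (forall j, Ck k (fun x => v x 0 j)) -> Ck k (fun x => F (row_mx x (v x))).
Proof.
move=> CF Cv; apply: Ck_comp => // j; case: (fintype.splitP j) => l E.
  rewrite (_ : (fun y => _) = (fun y : 'rV[R]_a => y 0 l)); first exact: Ck_coord.
  by apply/funext => y; rewrite (_ : j = lshift b l) ?row_mxEl //; exact: val_inj.
rewrite (_ : (fun y => _) = (fun y : 'rV[R]_a => v y 0 l)) //.
by apply/funext => y; rewrite (_ : j = rshift a l) ?row_mxEr //; exact: val_inj.
Qed.

Lemma dpartial_graph F (v : 'rV[R]_a -> 'rV[R]_b) i : Ck 1 F ->
  (forall j, Ck 1 (fun x => v x 0 j)) ->
  dpartial i (fun x => F (row_mx x (v x))) = (fun x =>
    dpartial (lshift b i) F (row_mx x (v x)) +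
    \sum_j dpartial i (fun x => v x 0 j) x * dpartial (rshift a j) F (row_mx x (v x))).
Proof.
move=> CF Cv; have El j : (fun y : 'rV[R]_a => row_mx y (v y) 0 (lshift b j)) = (fun y => y 0 j).
  by apply/funext => y; rewrite row_mxEl.
have Er j : (fun y : 'rV[R]_a => row_mx y (v y) 0 (rshift a j)) = (fun y => v y 0 j).
  by apply/funext => y; rewrite row_mxEr.
rewrite (@dpartial_comp R a (a + b) F (fun x => row_mx x (v x))) //; last first.
  move=> j; case: (fintype.splitP j) => l E.
    by rewrite (_ : j = lshift b l) ?El; [exact: Ck_coord|exact: val_inj].
  by rewrite (_ : j = rshift a l) ?Er //; exact: val_inj.
apply/funext => x; rewrite big_split_ord /=; congr (_ + _); last first.
  by apply: eq_bigr => j _; rewrite Er.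
rewrite (bigD1 i) //= El dpartial_coord eqxx mul1r big1 ?addr0 // => j ji.
by rewrite El dpartial_coord eq_sym (negbTE ji) mul0r.
Qed.

End two_blocks.
End slices.

(** * Derivative tests at a minimum and minima of periodic functions *)

Section minima.
Context {R : realType}.

(** If f2 were negative at s0, hence nearby, two applications of the mean value theorem to the right
    of s0 would give a value of f below f s0. *)
Lemma min_derive2 (f f1 f2 : R -> R) (s0 : R) :
  (forall s : R, is_derive s 1 f (f1 s)) -> (forall s : R, is_derive s 1 f1 (f2 s)) ->
  continuous f2 -> (forall s, f s0 <= f s) -> f1 s0 = 0 /\ 0 <= f2 s0.
Proof.
move=> d1 d2 cf2 fmin.
have cf : continuous f by move=> s; apply/differentiable_continuous/derivable1_diffP; have [] := d1 s.
have cf1 : continuous f1 by move=> s; apply/differentiable_continuous/derivable1_diffP; have [] := d2 s.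
have f10 : f1 s0 = 0.
  have H := @derive1_at_min R f (s0 - 1) (s0 + 1) s0.
  have : is_derive s0 1 f 0.
    apply: H => //; first by lra.
    by rewrite in_itv /=; apply/andP; split; lra.
  by move=> [_ <-]; have [_ ->] := d1 s0.
split=> //; rewrite leNgt; apply/negP => f20.
have : \forall s \near s0, f2 s < 0 by apply: (cvgr_lt (f2 s0) (cf2 s0)).
move=> /nbhs_ballP[r /= r0 rP].
have s0r : s0 < s0 + r / 2 by rewrite ltrDl divr_gt0.
have [c] := MVT s0r (fun s _ => d1 s) (continuous_subspaceT cf).
rewrite in_itv /= => /andP[s0c cr] E.
have [c'] := MVT s0c (fun s _ => d2 s) (continuous_subspaceT cf1).
rewrite in_itv /= f10 subr0 => /andP[s0c' c'c] E'.
have f2c' : f2 c' < 0.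
  apply: rP; rewrite -ball_normE /= ltr0_norm ?subr_lt0 // opprB ltrBlDl.
  by apply: (lt_trans c'c); apply: (lt_trans cr); rewrite ltrD2l ltr_pdivrMr // ltr_pMr // ltr1n.
have : f (s0 + r / 2) - f s0 < 0.
  by rewrite E E' -mulrA (nmulr_rlt0 _ f2c'); apply: mulr_gt0; rewrite subr_gt0.
by rewrite subr_lt0 ltNge fmin.
Qed.

(** The one-sided form serves space-time minima, which may be attained at the last time under
    consideration. *)
Lemma min_derive_left (f f1 : R -> R) (a s0 : R) : a < s0 ->
  (forall s : R, is_derive s 1 f (f1 s)) -> continuous f1 ->
  (forall s, a <= s <= s0 -> f s0 <= f s) -> f1 s0 <= 0.
Proof.
move=> as0 d1 cf1 fmin.
have cf : continuous f by move=> s; apply/differentiable_continuous/derivable1_diffP; have [] := d1 s.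
rewrite leNgt; apply/negP => f10.
have : \forall s \near s0, 0 < f1 s by apply: (cvgr_gt (f1 s0) (cf1 s0)).
move=> /nbhs_ballP[r /= r0 rP].
pose b := Num.max a (s0 - r / 2).
have bs : b < s0 by rewrite gt_max as0 ltrBlDr ltrDl divr_gt0.
have [c] := MVT bs (fun s _ => d1 s) (continuous_subspaceT cf).
rewrite in_itv /= => /andP[bc cs] E.
have f1c : 0 < f1 c.
  apply: rP; rewrite -ball_normE /= gtr0_norm ?subr_gt0 // ltrBlDl -ltrBlDr.
  apply: le_lt_trans bc; rewrite /b le_max; apply/orP; right.
  by rewrite lerD2l lerN2 ler_pdivrMr // ler_pMr // ler1n.
have : 0 < f s0 - f b by rewrite E mulr_gt0 // subr_gt0.
by rewrite subr_gt0 ltNge fmin // (ltW bs) andbT /b le_max lexx.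
Qed.

Lemma Zperiodic_int n (f : 'rV[R]_n -> R) i (k : int) x : Zperiodic f ->
  f (x + k%:~R *: ebasis R i) = f x.
Proof.
move=> pf; have N (l : nat) y : f (y + l%:R *: ebasis R i) = f y.
  elim: l y => [|l IH] y; first by rewrite scale0r addr0.
  by rewrite -natr1 scalerDl scale1r addrA pf IH.
case: k => l; first exact: N.
by rewrite NegzE mulrNz scaleNr -[LHS](N l.+1) subrK.
Qed.

Lemma Zperiodic_unit_box n (f : 'rV[R]_n -> R) x : Zperiodic f ->
  exists2 x', box `[0, 1] x' & f x' = f x.
Proof.
move=> pf; exists (x + \sum_i (- Num.floor (x 0 i))%:~R *: ebasis R i).
  move=> j; rewrite /= in_itv /= !mxE summxE (bigD1 j) //= big1 => [|i ij]; last first.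
    by rewrite !mxE eqxx /= eq_sym (negbTE ij) mulr0.
  rewrite !mxE !eqxx mulr1 addr0 mulrNz subr_ge0 lerBlDl.
  have := Num.Theory.floor_itv (x 0 j); rewrite -intrD1 => /andP[-> /ltW].
  by rewrite intrD.
have H (r : seq 'I_n) y : f (y + \sum_(i <- r) (- Num.floor (x 0 i))%:~R *: ebasis R i) = f y.
  elim: r y => [|i r IH] y; first by rewrite big_nil addr0.
  by rewrite big_cons addrA IH Zperiodic_int.
exact: H.
Qed.

(** Periodicity brings every point of the slab back to a compact set. It is asked only for times in
    [0, T], as the smooth extension of a solution need not be periodic elsewhere. *)
Lemma slab_min n (F : 'rV[R]_n -> R -> R) (T : R) : 0 <= T ->
  jcont F -> (forall t, 0 <= t <= T -> Zperiodic (F^~ t)) ->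
  exists x0 t0, 0 <= t0 <= T /\ forall x t, 0 <= t <= T -> F x0 t0 <= F x t.
Proof.
move=> T0 cF pF; pose K := (@box R `[0, 1] n `*` `[0, T]) : set ('rV[R]_n * R).
have cK : compact K.
  by apply: compact_setX; [exact: cint_compact (cint_iter n ler01)|exact: segment_compact].
have K0 : K !=set0.
  exists (0, 0); split=> /=; last by rewrite in_itv /= lexx.
  by move=> i; rewrite mxE /= in_itv /= lexx ler01.
have [[x0 t0]] := compact_EVT_min K0 cK (continuous_subspaceT cF).
rewrite inE => -[/= bx0]; rewrite in_itv /= => t0T mn; exists x0, t0; split=> // x t tT.
have [x' bx' <-] := Zperiodic_unit_box x (pF t tT).
by apply: (mn (x', t)); rewrite inE; split=> //=; rewrite in_itv.
Qed.

End minima.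

Section translations.
Context {R : realType}.

Lemma continuous_csub n (x : 'rV[R]_n) : continuous (fun y : 'rV[R]_n => x - y).
Proof.
have c2 : continuous (fun z : 'rV[R]_n * 'rV[R]_n => z.1 - z.2).
  by move=> z; apply: cvgB; [exact: cvg_fst|exact: cvg_snd].
apply: (continuous_compc (f := fun y => (x, y)) _ c2).
by apply: continuous_pairc; [exact: cst_continuous|move=> y; exact: cvg_id].
Qed.

Lemma continuous_addc n (w : 'rV[R]_n) : continuous (fun y : 'rV[R]_n => y + w).
Proof.
have c2 : continuous (fun z : 'rV[R]_n * 'rV[R]_n => z.1 + z.2).
  by move=> z; apply: cvgD; [exact: cvg_fst|exact: cvg_snd].
apply: (continuous_compc (f := fun y => (y, w)) _ c2).
by apply: continuous_pairc; [move=> y; exact: cvg_id|exact: cst_continuous].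
Qed.

End translations.

(** The difference of the two sides is (a - b) (c - d), and the hypotheses say that the two factors
    do not have opposite signs. *)
Lemma rearrangement (R : realDomainType) (a b c d : R) :
  (c <= d -> a <= b) -> (d <= c -> b <= a) -> a * d + b * c <= a * c + b * d.
Proof.
move=> cd dc; rewrite -subr_ge0.
have -> : a * c + b * d - (a * d + b * c) = (a - b) * (c - d) by ring.
have [h|h] := leP c d; first by rewrite mulr_le0 // subr_le0 ?cd.
by rewrite mulr_ge0 // subr_ge0 ?dc // ltW.
Qed.

(** * Monotonicity of the mollified coupling *)

Section conv_monotone.
Context {R : realType}.
Variables (n : nat) (k : 'rV[R]_n -> R) (N : R).
Hypothesis Hk : kernel_on k N.
Variables (m : 'rV[R]_n -> R) (alpha : R).
Hypotheses (Cm : Ck 2 m) (pm : Zperiodic m) (m0 : forall x, 0 < m x) (a0 : 0 < alpha).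

Lemma periodic_gt0_lb (f : 'rV[R]_n -> R) : continuous f -> Zperiodic f -> (forall x, 0 < f x) ->
  exists2 c, 0 < c & forall x, c <= f x.
Proof.
move=> cf pf f0; have K0 : @box R `[0, 1] n !=set0.
  by exists 0 => i; rewrite mxE /= in_itv /= lexx ler01.
have [c _ cmin] := compact_EVT_min K0 (cint_compact (cint_iter n ler01)) (continuous_subspaceT cf).
by exists (f c) => // x; have [x' bx' <-] := Zperiodic_unit_box x pf; apply: cmin; rewrite inE.
Qed.

Lemma periodic_bounded (f : 'rV[R]_n -> R) : continuous f -> Zperiodic f ->
  exists2 c, 0 < c & forall x, `|f x| <= c.
Proof.
move=> cf pf; have K0 : @box R `[0, 1] n !=set0.
  by exists 0 => i; rewrite mxE /= in_itv /= lexx ler01.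
have cn : continuous (fun x => `|f x|) by exact: continuous_compc cf (@norm_continuous _ R).
have [c _ cmax] := compact_EVT_max K0 (cint_compact (cint_iter n ler01)) (continuous_subspaceT cn).
exists (`|f c| + 1) => [|x]; first by rewrite ltr_wpDl.
have [x' bx' <-] := Zperiodic_unit_box x pf.
by apply: (@le_trans _ _ `|f c|); [apply: cmax; rewrite inE|rewrite lerDl].
Qed.

(** Strict positivity comes from a positive lower bound c of f: convolution is monotone and
    preserves constants. *)
Lemma tconv_gt0 (f : 'rV[R]_n -> R) x : continuous f -> Zperiodic f ->
  (forall x, 0 < f x) -> 0 < tconv k f x.
Proof.
move=> cf pf f0; have [c c0 cle] := periodic_gt0_lb cf pf f0.
have NN : - N <= N by apply: (@le_trans _ _ 0); rewrite ?oppr_le0 (ker_N0 Hk).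
apply: (lt_le_trans c0); rewrite -(tconv_cst Hk c x) !(tconvE Hk).
apply: (cint_le (cint_iter n NN)).
- by apply: continuousMc; [exact: ker_cont Hk|exact: cst_continuous].
- apply: continuousMc; first exact: ker_cont Hk.
  exact: (continuous_compc (f := fun y : 'rV[R]_n => x - y) (@continuous_csub R n x) cf).
- by move=> y _; apply: ler_wpM2l; [exact: (ker_ge0 Hk)|exact: cle].
Qed.

Let z := tconv k m.
Let za := fun x => powR (z x) alpha.
Let g := tconv k za.

Let cm : continuous m. Proof. exact: Ck_cont Cm. Qed.
Let cz : continuous z. Proof. exact: (tconv_continuous Hk cm). Qed.
Let pz : Zperiodic z. Proof. exact: (tconv_periodic Hk pm). Qed.
Let z0 x : 0 < z x. Proof. exact: (tconv_gt0 x cm pm m0). Qed.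
Let cza : continuous za.
Proof. by move=> x; apply: powR_continuous_pos => //; exact: cz. Qed.
Let pza : Zperiodic za. Proof. by move=> x i; rewrite /za pz. Qed.
Let za0 x : 0 <= za x. Proof. exact: powR_ge0. Qed.
Let zamono u v : z u <= z v -> za u <= za v.
Proof.
by apply: (ge0_ler_powR (ltW a0)); rewrite nnegrE; exact: ltW (z0 _).
Qed.
Let cg : continuous g. Proof. exact: (tconv_continuous Hk cza). Qed.

Lemma conv_pow_ge0 x : 0 <= g x. Proof. exact: (tconv_ge0 Hk x cza za0). Qed.

(* Pointwise in z = k * m: either z >= K and K z^alpha <= z^alpha z, or K z^alpha <= K^(1+alpha). *)
Lemma conv_pow_integral_le (K : R) : 0 < K ->
  K * int_torus g <= int_torus (fun x => g x * m x) + powR K (1 + alpha).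
Proof.
move=> K0; rewrite (tconv_adjoint Hk) // (torus_tconv Hk) // -/z.
have H := @cintT R n.
have := cint_cst H (powR K (1 + alpha)); rewrite mulr1 => <-.
rewrite -(cintZ H) // -(cintD H); [|exact: continuousMc|exact: cst_continuous].
apply: (cint_le H).
- exact: continuousZc.
- by apply: continuousDc; [exact: continuousMc|exact: cst_continuous].
move=> x _; have [Kz|zK] := leP K (z x).
  apply: (@le_trans _ _ (za x * z x)); last by rewrite lerDl powR_ge0.
  by rewrite mulrC ler_wpM2l.
apply: (@le_trans _ _ (powR K (1 + alpha))); last by rewrite lerDr mulr_ge0 // ltW.
rewrite powRD; last by rewrite (gt_eqF K0) implybT.
rewrite powRr1 ?(ltW K0) // ler_wpM2l ?(ltW K0) //.
by apply: ge0_ler_powR; rewrite ?nnegrE ?(ltW a0) ?(ltW (z0 _)) ?(ltW K0) ?(ltW zK).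
Qed.

Let K0 i (s : R) := int_torus (fun x => g x * m (x + s *: ebasis R i)).

Let pshift (f : 'rV[R]_n -> R) w : Zperiodic f -> Zperiodic (fun x => f (x + w)).
Proof. by move=> pf x i; rewrite addrAC pf. Qed.

Let cshift (f : 'rV[R]_n -> R) (w : 'rV[R]_n) : continuous f -> continuous (fun x : 'rV[R]_n => f (x + w)).
Proof.
by move=> cf; exact: (continuous_compc (f := fun y : 'rV[R]_n => y + w) (@continuous_addc R n w) cf).
Qed.

Let K0E i (s : R) : K0 i s = int_torus (fun x => za x * z (x + s *: ebasis R i)).
Proof.
rewrite /K0 (tconv_adjoint Hk) //; [|exact: cshift|exact: pshift].
by congr int_torus; apply/funext => x; rewrite (tconv_shift Hk).
Qed.

(* K0 s = int (z^alpha)(x) z(x + s e_i), and the rearrangement inequality is applied to the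
   similarly ordered values of z^alpha and z at x and x + s e_i. *)
Let K0_concave i (s : R) : K0 i s + K0 i (- s) <= K0 i 0 + K0 i 0.
Proof.
have H := @cintT R n; pose w := s *: ebasis R i.
have E1 : K0 i (- s) = int_torus (fun x => za (x + w) * z x).
  rewrite K0E -(torus_shift w); last 2 first.
  - by apply: continuousMc => //; exact: cshift.
  - by apply: ZperiodicM => //; exact: pshift.
  by congr int_torus; apply/funext => x; rewrite scaleNr addrK.
have E2 : K0 i 0 = int_torus (fun x => za x * z x).
  by rewrite K0E; congr int_torus; apply/funext => x; rewrite scale0r addr0.
have E3 : K0 i 0 = int_torus (fun x => za (x + w) * z (x + w)).
  rewrite E2 -(torus_shift w) //; first exact: continuousMc.
  exact: ZperiodicM.
have czw := cshift (w := w) cz; have czaw := cshift (w := w) cza.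
have c1 := continuousMc cza cz; have c2 := continuousMc czaw czw.
have c3 := continuousMc cza czw; have c4 := continuousMc czaw cz.
rewrite {1}E2 E3 K0E E1 -/w -(cintD H c1 c2) -(cintD H c3 c4).
apply: (cint_le H).
- exact: continuousDc c3 c4.
- exact: continuousDc c1 c2.
by move=> x _; apply: rearrangement; exact: zamono.
Qed.

(** The function K0 i s + K0 i (- s) is largest at s = 0, and its second derivative there is twice
    the integral in question. Both derivatives fall on m, so g need not be differentiated. The sign
    is reversed below to apply the test for minima. *)
Lemma conv_pow_laplace_le0 i :
  int_torus (fun x => g x * dpartial i (dpartial i m) x) <= 0.
Proof.
pose K1 (s : R) := int_torus (fun x => g x * dpartial i m (x + s *: ebasis R i)).
pose K2 (s : R) := int_torus (fun x => g x * dpartial i (dpartial i m) (x + s *: ebasis R i)).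
have C1 : Ck 1 m by exact: CkS.
have d0 (s : R) : is_derive s 1 (K0 i) (K1 s) by exact: (torus_line_derive i s cg C1).
have d1 (s : R) : is_derive s 1 K1 (K2 s).
  exact: (torus_line_derive i s cg (Ck_dpartial i Cm)).
have dN (f f1 : R -> R) : (forall s : R, is_derive s 1 f (f1 s)) ->
    forall s : R, is_derive s 1 (fun s => f (- s)) (- f1 (- s)).
  move=> df s; rewrite -[- _]mulrN1.
  by apply: (@is_derive1_comp R f (fun s => - s) s (f1 (- s)) (-1)); apply: is_deriveN; exact: is_derive_id.
have e0 (s : R) : is_derive s 1 (fun s => - (K0 i s + K0 i (- s))) (- (K1 s + - K1 (- s))).
  exact: (@is_deriveN _ _ _ (fun s => K0 i s + K0 i (- s)) s 1 _
    (@is_deriveD _ _ _ (K0 i) (fun s => K0 i (- s)) s 1 _ _ (d0 s) (dN _ _ d0 s))).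
have e1 (s : R) : is_derive s 1 (fun s => - (K1 s + - K1 (- s))) (- (K2 s + - - K2 (- s))).
  exact: (@is_deriveN _ _ _ (fun s => K1 s + - K1 (- s)) s 1 _
    (@is_deriveD _ _ _ K1 (fun s => - K1 (- s)) s 1 _ _ (d1 s)
      (@is_deriveN _ _ _ (fun s => K1 (- s)) s 1 _ (dN _ _ d1 s)))).
have cK2 : continuous K2.
  apply: (cint_jcont (cintT n)); apply: continuousMc.
    by apply: continuous_compc cg; exact: continuous_snd.
  exact: jcont_line (Ck_cont (Ck_dpartial i (Ck_dpartial i Cm))).
have ce : continuous (fun s => - (K2 s + - - K2 (- s))).
  move=> s; apply: cvgN; apply: cvgD; first exact: cK2.
  apply: cvgN; apply: cvgN; apply: (@continuous_comp _ _ _ (fun s : R => - s) K2).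
    exact: opp_continuous.
  exact: cK2.
have hm (s : R) : - (K0 i 0 + K0 i (- 0)) <= - (K0 i s + K0 i (- s)).
  by rewrite oppr0 lerN2 K0_concave.
have [_] := min_derive2 e0 e1 ce hm.
rewrite oppr0 opprK oppr_ge0.
have -> : K2 0 = int_torus (fun x => g x * dpartial i (dpartial i m) x).
  apply: (congr1 (@int_torus R n)); apply/funext => x.
  have e : x + 0 *: ebasis R i = x by rewrite scale0r addr0.
  by rewrite e.
by rewrite -mulr2n pmulrn_lle0.
Qed.

End conv_monotone.

(** * The Hamiltonian along a gradient *)

Lemma dpartialC_at (R : realType) n (f : 'rV[R]_n -> R) i j x : Ck 2 f ->
  dpartial i (dpartial j f) x = dpartial j (dpartial i f) x.
Proof. by move=> /(dpartialC i j)/(congr1 (fun f => f x)). Qed.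

(** The index bookkeeping behind [laplace_ham]: V stands for the Hessian of v, A and P for the pure
    second derivatives of H, B and Bt for the two orders of mixed ones, and W for third derivatives
    of v. *)
Lemma laplace_algebra (R : comRingType) d (A B Bt P V : 'M[R]_d) (b : 'I_d -> R)
    (W : 'I_d -> 'I_d -> R) : (forall i j, Bt i j = B j i) -> V^T = V ->
  \sum_i (A i i + \sum_k V i k * B k i +
    \sum_j (V i j * Bt i j + V i j * \sum_k V i k * P k j + b j * W j i)) =
  \tr A + 2 * \tr (B *m V) + \tr (P *m (V *m V)) + \sum_j b j * \sum_i W j i.
Proof.
move=> BtE Vs.
have trBV : \tr (B *m V) = \sum_i \sum_k V i k * B k i.
  rewrite /mxtrace [RHS]exchange_big /=; apply: eq_bigr => k _; rewrite mxE; apply: eq_bigr => i _.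
  by rewrite mulrC.
have E1 : \sum_i \sum_j V i j * Bt i j = \tr (B *m V).
  by rewrite trBV; apply: eq_bigr => i _; apply: eq_bigr => j _; rewrite BtE.
have E2 : \sum_i \sum_j V i j * (\sum_k V i k * P k j) = \tr (P *m (V *m V)).
  rewrite /mxtrace.
  transitivity (\sum_i \sum_k \sum_j V i j * (V i k * P k j)).
    apply: eq_bigr => i _; rewrite exchange_big /=; apply: eq_bigr => j _.
    by rewrite mulr_sumr.
  rewrite exchange_big /=; apply: eq_bigr => k _; rewrite mxE exchange_big /=.
  apply: eq_bigr => j _; rewrite [X in _ * X]mxE mulr_sumr; apply: eq_bigr => i _.
  by rewrite -{1}Vs mxE; ring.
have E3 : \sum_i \sum_j b j * W j i = \sum_j b j * \sum_i W j i.
  by rewrite exchange_big /=; apply: eq_bigr => j _; rewrite mulr_sumr.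
rewrite !big_split /= -trBV -/(\tr A).
under [X in _ + X = _]eq_bigr do rewrite !big_split /=.
by rewrite !big_split /= E1 E2 E3; ring.
Qed.

(** H as a function of one vector, the form in which the chain rule along x -> (x, Dv(x))
    applies. *)
Definition joint (R : realType) d (H : 'rV[R]_d -> 'rV[R]_d -> R) (z : 'rV[R]_(d + d)) : R :=
  H (lsubmx z) (rsubmx z).

Section hamiltonian.
Context {R : realType}.
Variables (d : nat) (H : 'rV[R]_d -> 'rV[R]_d -> R).
Hypothesis CH : forall k, Ck k (joint H).

Lemma hamiltonian_row_mx x p : H x p = (joint H) (row_mx x p).
Proof. by rewrite /joint row_mxKl row_mxKr. Qed.

Local Opaque joint derive.

Let Hx p : (fun x => H x p) = (fun x => (joint H) (row_mx x p)).
Proof. by apply/funext => x; exact: hamiltonian_row_mx. Qed.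

Let Hp x : H x = (fun p => (joint H) (row_mx x p)).
Proof. by apply/funext => p; exact: hamiltonian_row_mx. Qed.

Lemma DpHE x p i : DpH H x p 0 i = dpartial (rshift d i) (joint H) (row_mx x p).
Proof.
by rewrite mxE Hp; have := dpartial_row_mxr x i (CH 1) => /(congr1 (fun f => f p)).
Qed.

Let DpHxE x j : (fun q => 'D_(ebasis R j) (H x) q) = (fun q => dpartial (rshift d j) (joint H) (row_mx x q)).
Proof. by rewrite Hp; exact: (dpartial_row_mxr x j (CH 1)). Qed.

Let DxHpE p j : (fun y => 'D_(ebasis R j) (fun x => H x p) y) =
  (fun y => dpartial (lshift d j) (joint H) (row_mx y p)).
Proof. by rewrite Hx; exact: (dpartial_row_mxl p j (CH 1)). Qed.

Lemma D2ppHE x p i j :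
  D2ppH H x p i j = dpartial (rshift d i) (dpartial (rshift d j) (joint H)) (row_mx x p).
Proof.
rewrite mxE DpHxE.
by have := dpartial_row_mxr x i (Ck_dpartial (rshift d j) (CH 2)) => /(congr1 (fun f => f p)).
Qed.

Lemma D2xxHE x p i j :
  D2xxH H x p i j = dpartial (lshift d i) (dpartial (lshift d j) (joint H)) (row_mx x p).
Proof.
rewrite mxE DxHpE.
by have := dpartial_row_mxl p i (Ck_dpartial (lshift d j) (CH 2)) => /(congr1 (fun f => f x)).
Qed.

Lemma D2xpHE x p i j :
  D2xpH H x p i j = dpartial (lshift d i) (dpartial (rshift d j) (joint H)) (row_mx x p).
Proof.
rewrite mxE (_ : (fun y => 'D_(ebasis R j) (H y) p) =
   (fun y => dpartial (rshift d j) (joint H) (row_mx y p))).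
  by have := dpartial_row_mxl p i (Ck_dpartial (rshift d j) (CH 2)) => /(congr1 (fun f => f x)).
by apply/funext => y; have /(congr1 (fun f => f p)) := DpHxE y j.
Qed.

Lemma D2pxHE x p i j :
  D2pxH H x p i j = dpartial (rshift d i) (dpartial (lshift d j) (joint H)) (row_mx x p).
Proof.
rewrite mxE (_ : (fun q => 'D_(ebasis R j) (fun y => H y q) x) =
   (fun q => dpartial (lshift d j) (joint H) (row_mx x q))).
  by have := dpartial_row_mxr x i (Ck_dpartial (lshift d j) (CH 2)) => /(congr1 (fun f => f p)).
by apply/funext => q; have /(congr1 (fun f => f x)) := DxHpE q j.
Qed.

Lemma D2px_xp x p i j : D2pxH H x p i j = D2xpH H x p j i.
Proof.
apply: (etrans (D2pxHE x p i j)); apply: (etrans _ (esym (D2xpHE x p j i))).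
exact: (dpartialC_at (rshift d i) (lshift d j) _ (CH 2)).
Qed.

Section along_gradient.
Variable v : 'rV[R]_d -> R.
Hypothesis Cv : forall k, Ck k v.

Definition grad (x : 'rV[R]_d) : 'rV[R]_d := \row_i dpartial i v x.
Definition hess (x : 'rV[R]_d) : 'M[R]_d := \matrix_(i, j) dpartial i (dpartial j v) x.
Definition drift i (x : 'rV[R]_d) : R := DpH H x (grad x) 0 i.
Definition ham (x : 'rV[R]_d) : R := H x (grad x).

Let Cg k j : Ck k (fun x => grad x 0 j).
Proof.
rewrite (_ : (fun x => _) = dpartial j v); first exact: (Ck_dpartial j (Cv k.+1)).
by apply/funext => x; rewrite mxE.
Qed.

Let dg i j x : dpartial i (fun x => grad x 0 j) x = hess x i j.
Proof.
rewrite (_ : (fun x => _) = dpartial j v); first by rewrite mxE.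
by apply/funext => y; rewrite mxE.
Qed.

Lemma hess_sym x : (hess x)^T = hess x.
Proof. by apply/matrixP => i j; rewrite mxE !mxE; exact: (dpartialC_at j i x (Cv 2)). Qed.

Let hamE : ham = (fun x => (joint H) (row_mx x (grad x))).
Proof. by apply/funext => x; exact: hamiltonian_row_mx. Qed.

Let driftE i : drift i = (fun x => dpartial (rshift d i) (joint H) (row_mx x (grad x))).
Proof. by apply/funext => x; exact: DpHE. Qed.

Lemma Ck_ham k : Ck k ham.
Proof. by rewrite hamE; apply: Ck_graph => //; exact: Cg. Qed.

Lemma Ck_drift k i : Ck k (drift i).
Proof. by rewrite driftE; apply: Ck_graph => //; exact: (Ck_dpartial _ (CH k.+1)). Qed.

Lemma dpartial_drift i j x : dpartial i (drift j) x =
  D2xpH H x (grad x) i j + \sum_k hess x i k * D2ppH H x (grad x) k j.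
Proof.
rewrite driftE.
have E := dpartial_graph i (Ck_dpartial (rshift d j) (CH 2)) (Cg 1).
apply: etrans (congr1 (fun f => f x) E) _.
apply: congr2; first exact: esym (D2xpHE x (grad x) i j).
apply: eq_bigr => k _; apply: congr2; first exact: dg.
exact: esym (D2ppHE x (grad x) k j).
Qed.

Definition divdrift x := \sum_i dpartial i (drift i) x.

Lemma divdriftE x :
  divdrift x = \tr (D2xpH H x (grad x)) + \tr (D2ppH H x (grad x) *m hess x).
Proof.
rewrite /divdrift; under eq_bigr do rewrite dpartial_drift.
rewrite big_split /=; congr (_ + _); rewrite /mxtrace exchange_big /=.
apply: eq_bigr => i _; rewrite mxE; apply: eq_bigr => j _; by rewrite mulrC.
Qed.

Let dham i : dpartial i ham = (fun x => dpartial (lshift d i) (joint H) (row_mx x (grad x)) +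
  \sum_j dpartial i (dpartial j v) x * drift j x).
Proof.
rewrite hamE (dpartial_graph i (CH 1) (Cg 1)); apply/funext => x; congr (_ + _).
by apply: eq_bigr => j _; rewrite dg mxE driftE.
Qed.

(** The third derivatives of v combine into the drift acting on Delta v. When Delta u is tested
    against the Fokker-Planck equation this is the term that cancels, leaving expressions of second
    order in u. *)
Lemma laplace_ham x :
  \sum_i dpartial i (dpartial i ham) x =
  \tr (D2xxH H x (grad x)) + 2 * \tr (D2pxH H x (grad x) *m hess x) +
  \tr (D2ppH H x (grad x) *m (hess x *m hess x)) +
  \sum_j drift j x * \sum_i dpartial j (dpartial i (dpartial i v)) x.
Proof.
have Cl i k : Ck k (fun x => dpartial (lshift d i) (joint H) (row_mx x (grad x))).
  by apply: Ck_graph => //; exact: (Ck_dpartial _ (CH k.+1)).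
have Cd2 i j k : Ck k (dpartial i (dpartial j v)).
  exact: (Ck_dpartial i (Ck_dpartial j (Cv k.+2))).
have E i : dpartial i (dpartial i ham) x =
   D2xxH H x (grad x) i i + \sum_k hess x i k * D2pxH H x (grad x) k i +
   \sum_j (hess x i j * D2xpH H x (grad x) i j +
     hess x i j * \sum_k hess x i k * D2ppH H x (grad x) k j +
     drift j x * dpartial j (dpartial i (dpartial i v)) x).
  have Cs j : Ck 1 (fun x => dpartial i (dpartial j v) x * drift j x).
    by apply: CkM; [exact: Cd2|exact: Ck_drift].
  rewrite dham.
  apply: etrans (congr1 (fun f => f x) (dpartialD i (Cl i 1) (Ck_sum _ Cs))) _.
  apply: congr2.
    have E1 := dpartial_graph i (Ck_dpartial (lshift d i) (CH 2)) (Cg 1).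
    apply: etrans (congr1 (fun f => f x) E1) _.
    apply: congr2; first exact: esym (D2xxHE x (grad x) i i).
    apply: eq_bigr => k _; apply: congr2; first exact: dg.
    exact: esym (D2pxHE x (grad x) k i).
  apply: etrans (congr1 (fun f => f x) (dpartial_sum i _ Cs)) _.
  apply: eq_bigr => j _.
  apply: etrans (congr1 (fun f => f x) (dpartialM i (Cd2 i j 1) (Ck_drift 1 j))) _.
  have h1 : dpartial i (dpartial j v) x = hess x i j by rewrite mxE.
  have h2 : dpartial i (dpartial i (dpartial j v)) x = dpartial j (dpartial i (dpartial i v)) x.
    rewrite (dpartialC i j (Cv 2)); exact: (dpartialC_at i j x (Ck_dpartial i (Cv 3))).
  apply: etrans (congr2 +%R (congr2 *%R h1 (dpartial_drift i j x)) (congr1 ( *%R^~ _) h2)) _.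
  by rewrite mulrDr [X in _ + X]mulrC.
apply: (etrans (eq_bigr _ (fun i _ => E i))).
apply: laplace_algebra; last exact: hess_sym.
by move=> i j; exact: esym (D2px_xp x (grad x) j i).
Qed.

End along_gradient.
End hamiltonian.

(** * Pointwise consequences of (A5) and (A9) *)

Section pointwise.
Context {R : realType}.

Lemma entry_le_frob n (A : 'M[R]_n) i j : `|A i j| <= frob_norm A.
Proof.
rewrite /frob_norm -sqrtr_sqr; apply: ler_wsqrtr.
rewrite (bigD1 i) //= (bigD1 j) //= -addrA lerDl addr_ge0 //.
  by apply: sumr_ge0 => k _; exact: sqr_ge0.
by apply: sumr_ge0 => k _; apply: sumr_ge0 => l _; exact: sqr_ge0.
Qed.

Lemma frob_ge0 n (A : 'M[R]_n) : 0 <= frob_norm A.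
Proof. exact: sqrtr_ge0. Qed.

Lemma tr_le_frob n (A : 'M[R]_n) : `|\tr A| <= n%:R * frob_norm A.
Proof.
apply: le_trans (ler_norm_sum _ _ _) _.
apply: (@le_trans _ _ (\sum_(i < n) frob_norm A)); first by apply: ler_sum => i _; exact: entry_le_frob.
by rewrite sumr_const card_ord mulr_natl.
Qed.

Lemma tr_mulmxN n (A B : 'M[R]_n) : \tr (A *m - B) = - \tr (A *m B).
Proof. by rewrite mulmxN linearN. Qed.

Lemma mulmxNN n (A B : 'M[R]_n) : A *m (- B *m - B) = A *m (B *m B).
Proof. by congr (_ *m _); rewrite mulNmx mulmxN opprK. Qed.

Variables (d : nat) (H : 'rV[R]_d -> 'rV[R]_d -> R) (mu : R).
Hypothesis H1 : forall x p, 1 <= H x p.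
Hypothesis mu01 : 0 < mu < 1.
Hypothesis A9 : exists C : R, forall x p,
     frob_norm (D2xpH H x p) ^+ 2
       <= C * powR (H x p) ((2 + 2 * mu) / (2 + mu)) /\
     forall (M : 'M[R]_d), M^T = M ->
       frob_norm (D2ppH H x p *m M) ^+ 2
         <= C * powR (H x p) (mu / (2 + mu)) * \tr (D2ppH H x p *m (M *m M)).

Let H0 x p : 0 < H x p. Proof. exact: lt_le_trans (H1 x p). Qed.

(** Read off the second bound of (A9), whose left side is a square: if C > 0 the trace is a
    nonnegative number divided by a positive one, and if C = 0 the matrix D2_pp H M vanishes. *)
Lemma tr_pp_ge0 x p (M : 'M[R]_d) : M^T = M -> 0 <= \tr (D2ppH H x p *m (M *m M)).
Proof.
move=> Ms; have [C HC] := A9; have [h1 /(_ _ Ms) h2] := HC x p.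
have C0 : 0 <= C.
  rewrite -(pmulr_lge0 _ (powR_gt0 ((2 + 2 * mu) / (2 + mu)) (H0 x p))).
  exact: le_trans (sqr_ge0 _) h1.
move: C0; rewrite le_eqVlt => /predU1P[C0|C0]; last first.
  have pH : 0 < C * powR (H x p) (mu / (2 + mu)) by rewrite mulr_gt0 // powR_gt0.
  by rewrite -(pmulr_rge0 _ pH); exact: le_trans (sqr_ge0 _) h2.
rewrite -C0 !mul0r in h2.
have f0 : frob_norm (D2ppH H x p *m M) = 0.
  by apply/eqP; rewrite -sqrf_eq0 eq_le h2 sqr_ge0.
have -> : D2ppH H x p *m (M *m M) = 0.
  rewrite mulmxA (_ : D2ppH H x p *m M = 0) ?mul0mx //; apply/matrixP => i j; rewrite [RHS]mxE.
  by apply/eqP; rewrite -normr_le0 -f0; exact: entry_le_frob.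
by rewrite mxtrace0.
Qed.

(** With s = (1 + mu)/(2 + mu), the exponents of (A9) satisfy (2 + 2 mu)/(2 + mu) = 2 s and mu/(2 +
    mu) + 1 = 2 s. So both squared norms are at most C X^(2 s), where X dominates H and the
    trace. *)
Lemma div_drift_le : exists2 Cb : R, 0 < Cb & forall x p (V : 'M[R]_d), V^T = V ->
  `|\tr (D2xpH H x p) + \tr (D2ppH H x p *m V)| <=
  Cb * powR (H x p + \tr (D2ppH H x p *m (V *m V))) ((1 + mu) / (2 + mu)).
Proof.
have /andP[mu0 mu1] := mu01; have m2 : 0 < 2 + mu by lra.
(* As C1 >= 1, C <= C1^2, so C1 can replace the square root of C. *)
have [C HC] := A9; pose C1 := Num.max C 1.
have C11 : 1 <= C1 by rewrite le_max lexx orbT.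
have C10 : 0 < C1 by exact: lt_le_trans C11.
have CC1 : C <= C1 by rewrite le_max lexx.
exists (2 * d%:R * C1 + 1) => [|x p V Vs].
  by rewrite ltr_wpDl // mulr_ge0 ?(ltW C10) // mulr_ge0.
have [h1 /(_ _ Vs) h2] := HC x p; have T0 := tr_pp_ge0 x p Vs.
move: h2 T0; set TR := \tr (D2ppH H x p *m (V *m V)) => h2 T0.
set X := H x p + TR; have X0 : 0 < X by rewrite ltr_pwDl.
have HX : H x p <= X by rewrite lerDl.
have TX : TR <= X by rewrite lerDr ltW.
set s := (1 + mu) / (2 + mu).
have key (w : R) : 0 <= w -> w ^+ 2 <= C * powR X (2 * s) -> w <= C1 * powR X s.
  move=> w0 wle; rewrite -ler_sqr ?nnegrE ?mulr_ge0 ?powR_ge0 ?(ltW C10) //.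
  apply: (le_trans wle); rewrite exprMn -(powR_mulrn 2 (powR_ge0 X s)) -powRrM [s * _]mulrC.
  by rewrite ler_wpM2r ?powR_ge0 // (le_trans CC1) // -[leLHS]mulr1 expr2 ler_wpM2l // ltW.
have C0 : 0 <= C.
  rewrite -(pmulr_lge0 _ (powR_gt0 ((2 + 2 * mu) / (2 + mu)) (H0 x p))).
  exact: le_trans (sqr_ge0 _) h1.
have k1 : frob_norm (D2xpH H x p) <= C1 * powR X s.
  apply: key; first exact: frob_ge0.
  apply: (le_trans h1); rewrite ler_wpM2l //.
  have -> : (2 + 2 * mu) / (2 + mu) = 2 * s by rewrite /s; field; lra.
  have s0 : 0 <= 2 * s by rewrite /s mulr_ge0 // divr_ge0 ?ltW //; lra.
  by apply: (ge0_ler_powR s0) => //; rewrite nnegrE ltW.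
have k2 : frob_norm (D2ppH H x p *m V) <= C1 * powR X s.
  apply: key; first exact: frob_ge0.
  apply: (le_trans h2); rewrite -mulrA ler_wpM2l //.
  have -> : 2 * s = mu / (2 + mu) + 1 by rewrite /s; field; lra.
  rewrite powRD; last by rewrite (gt_eqF X0) implybT.
  rewrite powRr1 ?(ltW X0) //; apply: ler_pM => //; first exact: powR_ge0.
  have s0 : 0 <= mu / (2 + mu) by rewrite divr_ge0 ?ltW.
  by apply: (ge0_ler_powR s0) => //; rewrite nnegrE ltW.
apply: le_trans (ler_normD _ _) _.
apply: (@le_trans _ _ (d%:R * (C1 * powR X s) + d%:R * (C1 * powR X s))).
  by apply: lerD; apply: le_trans (tr_le_frob _) _; rewrite ler_wpM2l.
have := powR_ge0 X s; move: (powR X s) => Y Y0.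
by rewrite -subr_ge0 (_ : _ - _ = Y) //; ring.
Qed.

Hypothesis A5a : exists C : R, forall x p,
     euclid_norm (DxH H x p) <= C * H x p + C /\
     frob_norm (D2xxH H x p) <= C * H x p + C.
Hypothesis A5b : forall delta : R, 0 < delta -> exists Cd : R,
     forall (M : 'M[R]_d), M^T = M -> forall x p,
       \tr (D2pxH H x p *m M)
         <= delta * \tr (D2ppH H x p *m (M *m M)) + Cd * H x p.

(** (A5) bounds the mixed trace from above only; applied to - V it gives the lower bound. The
    constant in the bound on D2_xx H is absorbed into H because H >= 1. *)
Lemma second_order_ge : exists2 Ca : R, 0 <= Ca & forall x p (V : 'M[R]_d), V^T = V ->
  2^-1 * \tr (D2ppH H x p *m (V *m V)) - Ca * H x p <=
  \tr (D2xxH H x p) + 2 * \tr (D2pxH H x p *m V) + \tr (D2ppH H x p *m (V *m V)).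
Proof.
(* With delta = 1/4 the mixed term, which occurs twice, costs half of the last trace. *)
have [C HC] := A5a; have q4 : (0 : R) < 4^-1 by rewrite invr_gt0.
have [Cd HCd] := A5b q4.
exists (d%:R * (2 * `|C|) + 2 * `|Cd|) => [|x p V Vs].
  by rewrite addr_ge0 // !mulr_ge0.
have VNs : (- V)^T = - V by rewrite linearN /= Vs.
move: (HCd (- V) VNs x p); move: (D2pxH H x p) (D2ppH H x p) => B P.
rewrite tr_mulmxN mulmxNN.
move: (\tr (P *m (V *m V))) (\tr (B *m V)) => TR Q hQ.
have [_ h] := HC x p; have Hxp := H1 x p.
have tx : - (d%:R * (2 * `|C|) * H x p) <= \tr (D2xxH H x p).
  have := tr_le_frob (D2xxH H x p); rewrite ler_norml => /andP[h' _]; apply: le_trans h'.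
  rewrite lerN2 -mulrA ler_wpM2l //; apply: (le_trans h).
  have C0 := ler_norm C; have Cn := normr_ge0 C.
  apply: (@le_trans _ _ (`|C| * H x p + `|C| * H x p)); last by rewrite -mulrA mulr2n mulrDl mul1r.
  apply: lerD; first by rewrite ler_wpM2r // ltW.
  by apply: (le_trans C0); rewrite ler_peMr.
have hd : Cd * H x p <= `|Cd| * H x p by rewrite ler_wpM2r ?ler_norm // ltW.
rewrite mulrDl; move: tx hd hQ; rewrite -[2 * `|Cd| * _]mulrA.
move: (\tr _) (d%:R * _ * _) (Cd * _) (`|Cd| * _) => t1 t2 t3 t4.
lra.
Qed.

End pointwise.

(** * Functions of space and time *)

Section space_time.
Context {R : realType}.

Lemma spatial_min n (f : 'rV[R]_n -> R) x i : Ck 2 f -> (forall y, f x <= f y) ->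
  dpartial i f x = 0 /\ 0 <= dpartial i (dpartial i f) x.
Proof.
move=> Cf fmin.
have e0 (s : R) : is_derive s 1 (fun s => f (x + s *: ebasis R i)) (dpartial i f (x + s *: ebasis R i)).
  by apply: is_derive_line; apply: Ck_derivable Cf.
have e1 (s : R) : is_derive s 1 (fun s => dpartial i f (x + s *: ebasis R i))
    (dpartial i (dpartial i f) (x + s *: ebasis R i)).
  by apply: is_derive_line; apply: Ck_derivable (Ck_dpartial i Cf).
have c2 : continuous (fun s : R => dpartial i (dpartial i f) (x + s *: ebasis R i)).
  exact: (@jcont_sec R 'rV[R]_n R (fun x s => dpartial i (dpartial i f) (x + s *: ebasis R i)) x
    (jcont_swap (jcont_line (Ck_cont (Ck_dpartial i (Ck_dpartial i Cf)))))).
have ex : x + 0 *: ebasis R i = x by rewrite scale0r addr0.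
have hm (s : R) : f (x + 0 *: ebasis R i) <= f (x + s *: ebasis R i) by rewrite ex.
by have := min_derive2 e0 e1 c2 hm; rewrite ex.
Qed.

(** Near a point where f is negative there would be an interior point with the same property; it is
    found by moving from t a small fraction [e] of the way towards the midpoint of [a, b]. *)
Lemma ge0_closure (f : R -> R) (a b : R) : a < b -> continuous f ->
  (forall t, a < t < b -> 0 <= f t) -> forall t, a <= t <= b -> 0 <= f t.
Proof.
move=> ab cf f0 t /andP[at_ tb]; rewrite leNgt; apply/negP => ft.
have : \forall s \near t, f s < 0 by apply: (cvgr_lt (f t) (cf t)).
move=> /nbhs_ballP[r /= r0 rP].
pose c := (a + b) / 2; have acb : a < c < b by rewrite /c; apply/andP; split; lra.
pose e := Num.min (1 / 2) (r / (2 * (1 + `|c - t|))).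
have den : 0 < 2 * (1 + `|c - t|) by rewrite mulr_gt0 // ltr_pwDl.
have e0 : 0 < e by rewrite lt_min !divr_gt0.
have e12 : e <= 1 / 2 by rewrite /e ge_min lexx.
have er : e <= r / (2 * (1 + `|c - t|)) by rewrite /e ge_min lexx orbT.
pose s := t + e * (c - t).
have /andP[ac cb] := acb.
have sab : a < s < b.
  have -> : s = (1 - e) * t + e * c by rewrite /s; ring.
  have h1 : (1 - e) * a <= (1 - e) * t by apply: ler_wpM2l => //; lra.
  have h2 : (1 - e) * t <= (1 - e) * b by apply: ler_wpM2l => //; lra.
  have h3 : e * a < e * c by rewrite ltr_pM2l.
  have h4 : e * c < e * b by rewrite ltr_pM2l.
  by apply/andP; split; lra.
have : f s < 0.
  apply: rP; rewrite -ball_normE /= /s opprD addrA subrr sub0r normrN normrM gtr0_norm //.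
  apply: (@le_lt_trans _ _ (r / 2)); last by rewrite ltr_pdivrMr // ltr_pMr // ltr1n.
  apply: (@le_trans _ _ (e * (1 + `|c - t|))); first by rewrite ler_wpM2l ?(ltW e0) // lerDr.
  apply: le_trans (ler_wpM2r _ er) _; first by rewrite addr_ge0.
  rewrite le_eqVlt; apply/orP; left; apply/eqP; field.
  by rewrite gt_eqF // ltr_pwDl.
by rewrite ltNge f0.
Qed.

(** A negative value at a time t < T forces a negative minimum over [0, t], at a positive time.
    There the time derivative is nonpositive because earlier values are not smaller, which
    contradicts the last hypothesis. The final time T follows by continuity. *)
Lemma min_principle n (F Ft : 'rV[R]_n -> R -> R) (T : R) : 0 < T -> jcont F ->
  (forall t, 0 <= t < T -> Zperiodic (F^~ t)) ->
  (forall x (t : R), is_derive t 1 (F x) (Ft x t)) -> (forall x, continuous (Ft x)) ->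
  (forall x, 0 <= F x 0) ->
  (forall x t, 0 < t < T -> F x t < 0 -> (forall y, F x t <= F y t) -> 0 < Ft x t) ->
  forall x t, 0 <= t <= T -> 0 <= F x t.
Proof.
move=> T0 cF pF dF cFt F0 H x.
apply: (ge0_closure T0); first exact: (@jcont_sec R 'rV[R]_n R F x cF).
move=> t /andP[t0 tT].
have pF' s : 0 <= s <= t -> Zperiodic (F^~ s).
  by move=> /andP[s0 st]; apply: pF; rewrite s0 (le_lt_trans st).
have [x0 [t1 [/andP[t10 t1t] mn]]] := slab_min (ltW t0) cF pF'.
apply: (@le_trans _ _ (F x0 t1)); last by apply: mn; rewrite (ltW t0) lexx.
rewrite leNgt; apply/negP => Fneg.
have t1p : 0 < t1.
  rewrite lt_def t10 andbT; apply/negP => /eqP t1E.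
  by move: Fneg; rewrite t1E ltNge F0.
have := H x0 t1; rewrite t1p (le_lt_trans t1t) // => /(_ isT Fneg).
have t1r : 0 <= t1 <= t by rewrite t10.
move=> /(_ (fun y => mn y t1 t1r)); rewrite ltNge.
rewrite (min_derive_left t1p (dF x0) (cFt x0)) // => s /andP[s0 st1].
by apply: mn; rewrite s0 (le_trans st1).
Qed.

Lemma slab_bounded n (F : 'rV[R]_n -> R -> R) (T : R) : 0 <= T -> jcont F ->
  (forall t, 0 <= t <= T -> Zperiodic (F^~ t)) ->
  exists2 c, 0 < c & forall x t, 0 <= t <= T -> `|F x t| <= c.
Proof.
move=> T0 cF pF; have cn : jcont (fun x t => - `|F x t|).
  move=> z; apply: cvgN; apply: cvg_norm; exact: cF.
have pn t : 0 <= t <= T -> Zperiodic (fun x => - `|F x t|).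
  by move=> tT x i; rewrite (pF t tT).
have [x0 [t0 [_ mn]]] := slab_min T0 cn pn.
exists (`|F x0 t0| + 1) => [|x t tT]; first by rewrite ltr_wpDl.
by apply: (@le_trans _ _ `|F x0 t0|); [rewrite -lerN2 mn|rewrite lerDl].
Qed.

Variable d : nat.

Definition st (x : 'rV[R]_d) (t : R) : 'rV[R]_(d + 1) := row_mx x (const_mx t).
Definition ti : 'I_(d + 1) := rshift d (0 : 'I_1).
Definition dxx (F : 'rV[R]_(d + 1) -> R) i := dpartial (lshift 1 i) F.
Definition dtt (F : 'rV[R]_(d + 1) -> R) := dpartial ti F.

Lemma st_line x (t : R) : st x t = st x 0 + t *: ebasis R ti.
Proof.
rewrite /st -row_mx_liner; congr row_mx.
by apply/rowP => j; rewrite !mxE add0r ord1 eqxx mulr1.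
Qed.

Lemma is_derive_st (F : 'rV[R]_(d + 1) -> R) x (t : R) : Ck 1 F ->
  is_derive t 1 (fun t => F (st x t)) (dtt F (st x t)).
Proof.
case=> _ /(_ ti)[dF _]; have := @is_derive_line R _ F (st x 0) (ebasis R ti) t (dF _).
rewrite -st_line; congr (is_derive _ _ _ _).
by apply/funext => h; rewrite -st_line.
Qed.

Lemma st_cont (F : 'rV[R]_(d + 1) -> R) : continuous F -> jcont (fun x t => F (st x t)).
Proof.
move=> cF; apply: (row_mx_cont cF); first exact: continuous_fst.
move=> z; apply: (@cvg_rV _ _ (nbhs z) _) => j; rewrite mxE.
by under eq_fun do rewrite mxE; exact: cvg_snd.
Qed.

Lemma st_cont_swap (F : 'rV[R]_(d + 1) -> R) : continuous F -> jcont (fun t x => F (st x t)).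
Proof. by move/st_cont/jcont_swap. Qed.

Lemma torus_time_derive (F : 'rV[R]_(d + 1) -> R) (t : R) : Ck 1 F ->
  is_derive t 1 (fun t => int_torus (fun x => F (st x t))) (int_torus (fun x => dtt F (st x t))).
Proof.
move=> CF; have cF := Ck_cont CF; have cdF := Ck_cont (Ck_dpartial ti CF).
apply: (cint_is_derive (cintT d) (F' := fun t x => dtt F (st x t))).
- near=> s; split; first exact: (@jcont_sec R R 'rV[R]_d (fun t x => F (st x t)) s (st_cont_swap cF)).
  by move=> x; exact: is_derive_st.
- exact: (@jcont_sec R R 'rV[R]_d (fun t x => dtt F (st x t)) t (st_cont_swap cdF)).
- by move=> x; have cc := st_cont_swap cdF; exact: cc.
Unshelve. all: by end_near. Qed.

Lemma torus_time_cont (F : 'rV[R]_(d + 1) -> R) : continuous F ->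
  continuous (fun t => int_torus (fun x => F (st x t))).
Proof. by move=> cF; apply: (cint_jcont (cintT d)); exact: st_cont_swap. Qed.

Lemma Ck_slice k (F : 'rV[R]_(d + 1) -> R) t : Ck k F -> Ck k (fun x => F (st x t)).
Proof. exact: Ck_row_mxl. Qed.

Lemma dpartial_slice i (F : 'rV[R]_(d + 1) -> R) t : Ck 1 F ->
  dpartial i (fun x => F (st x t)) = (fun x => dxx F i (st x t)).
Proof. exact: dpartial_row_mxl. Qed.

Lemma dpartial2_slice i j (F : 'rV[R]_(d + 1) -> R) t : Ck 2 F ->
  dpartial i (dpartial j (fun x => F (st x t))) = (fun x => dxx (dxx F j) i (st x t)).
Proof.
move=> CF; rewrite (dpartial_slice j t (CkS CF)).
exact: (dpartial_slice i t (Ck_dpartial _ CF)).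
Qed.

End space_time.

(** * Absorption arguments *)

Section scalar.
Context {R : realType}.

(** Take v = (2 b)^(1/(1 - nu)). The weighted arithmetic-geometric inequality gives 2 b S^nu <= nu S
    + (1 - nu) v <= S + v, and half of S is absorbed on the left. *)
Lemma le_absorb_powR (S a b nu : R) : 0 <= S -> 0 <= b -> 0 < nu < 1 ->
  S <= a + b * powR S nu -> S <= 2 * a + powR (2 * b) (1 - nu)^-1.
Proof.
move=> S0 b0 /andP[nu0 nu1] hS; have n1 : 0 < 1 - nu by rewrite subr_gt0.
have b2 : 0 <= 2 * b by rewrite mulr_ge0.
pose v := powR (2 * b) (1 - nu)^-1.
have v0 : 0 <= v by exact: powR_ge0.
have nu01 : 0 <= nu <= 1 by rewrite !ltW.
have := @weighted_amgm R S v nu S0 v0 nu01.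
have -> : powR v (1 - nu) = 2 * b by rewrite -powRrM mulVf ?gt_eqF // powRr1.
have nS : nu * S <= S by rewrite ler_piMl // ltW.
have nv : (1 - nu) * v <= v by rewrite ler_piMl // lerBlDl lerDr ltW.
rewrite -/v; move: hS nS nv; clearbody v; move: (powR S nu) => w; lra.
Qed.

(* The power of [l] is the one for which [l] cancels in the weighted geometric mean of the two
   terms on the right. *)
Lemma density_young (mu q l a X : R) : 0 < mu -> 0 < l -> 0 < a -> 0 <= X ->
  powR a q * powR X ((1 + mu) / (2 + mu)) <=
  l * (X * a) + powR l (- (1 + mu)) * powR a (1 + (q - 1) * (2 + mu)).
Proof.
move=> mu0 l0 a0 X0; set e := 1 + (q - 1) * (2 + mu); set th := (1 + mu) / (2 + mu).
have m2 : 2 + mu != 0 by rewrite gt_eqF //; lra.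
have thE : 1 - th = (2 + mu)^-1 by rewrite /th; field; exact: m2.
have th01 : 0 <= th <= 1.
  apply/andP; split; first by rewrite divr_ge0 //; lra.
  by rewrite -subr_ge0 thE invr_ge0; lra.
have u0 : 0 <= l * (X * a) by rewrite !mulr_ge0 // ltW.
have v0 : 0 <= powR l (- (1 + mu)) * powR a e by rewrite mulr_ge0 ?powR_ge0.
have := weighted_amgm u0 v0 th01; have /andP[th0 th1] := th01.
rewrite !powRM ?powR_ge0 ?(ltW l0) ?(ltW a0) ?mulr_ge0 ?(ltW a0) // -!powRrM.
have an : a != 0 by rewrite gt_eqF.
have ln : l != 0 by rewrite gt_eqF.
have -> : powR l th * (powR X th * powR a th) *
  (powR l (- (1 + mu) * (1 - th)) * powR a (e * (1 - th))) =
  (powR l th * powR l (- (1 + mu) * (1 - th))) * powR X th * (powR a th * powR a (e * (1 - th))).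
  by ring.
rewrite -!powRD ?an ?ln ?implybT // thE.
have -> : th + - (1 + mu) / (2 + mu) = 0 by rewrite /th mulNr subrr.
have -> : th + e / (2 + mu) = q by rewrite /th -mulrDl; apply: (mulIf m2); rewrite divfK // /e; ring.
rewrite powRr0 mul1r mulrC => h; apply: (le_trans h).
apply: lerD; rewrite ler_piMl // invr_le1 ?unitfE //; lra.
Qed.

Lemma powR_le_1D (a e f : R) : 0 < a -> 0 <= e -> e <= f -> powR a e <= 1 + powR a f.
Proof.
move=> a0 e0 ef; have [a1|a1] := leP a 1.
  apply: (@le_trans _ _ 1); last by rewrite lerDl powR_ge0.
  have := @ge0_ler_powR R e e0 a 1; rewrite !nnegrE powR1 ler01 ltW //; exact.
by apply: (le_trans (ler_powR (ltW a1) ef)); rewrite lerDr.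
Qed.

(** Multiplied by D, right side minus left side is D (1 + mu) - q (D (1 + mu) - 2), so the bound on
    q is the required inequality. D >= 2 makes the denominator positive. *)
Lemma exponent_le (D mu q : R) : 2 <= D -> 0 < mu -> 1 <= q ->
  q < D * (1 + mu) / (D * (1 + mu) - 2) -> 1 + (q - 1) * (2 + mu) <= q * (1 + 2 * D^-1).
Proof.
move=> D2 mu0 q1; have D0 : 0 < D by exact: lt_le_trans D2.
have Dm : 0 < D * (1 + mu) - 2.
  have : 0 < D * mu by rewrite mulr_gt0.
  by lra.
rewrite ltr_pdivlMr // => h.
rewrite -(ler_pM2l D0) -subr_ge0.
have -> : D * (q * (1 + 2 / D)) - D * (1 + (q - 1) * (2 + mu)) =
  D * (1 + mu) - q * (D * (1 + mu) - 2) by field; rewrite gt_eqF.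
by rewrite subr_ge0 ltW.
Qed.

End scalar.

Lemma int_torus_mulC (R : realType) n (f g : 'rV[R]_n -> R) :
  int_torus (fun x => f x * g x) = int_torus (fun x => g x * f x).
Proof. by apply: (congr1 (@int_torus R n)); apply/funext => x; rewrite mulrC. Qed.

Lemma torus_laplace_sym (R : realType) n (f g : 'rV[R]_n -> R) : Ck 2 f -> Ck 2 g ->
  Zperiodic f -> Zperiodic g ->
  int_torus (fun x => (\sum_i dpartial i (dpartial i f) x) * g x) =
  int_torus (fun x => f x * \sum_i dpartial i (dpartial i g) x).
Proof.
move=> Cf Cg pf pg; have HI := @cintT R n.
have Cfi i : Ck 1 (dpartial i f) by exact: Ck_dpartial.
have Cgi i : Ck 1 (dpartial i g) by exact: Ck_dpartial.
have pfi i : Zperiodic (dpartial i f) by exact: Zperiodic_dpartial.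
have pgi i : Zperiodic (dpartial i g) by exact: Zperiodic_dpartial.
have cf := Ck_cont Cf; have cg := Ck_cont Cg.
have cdf i : continuous (dpartial i (dpartial i f)) by exact: Ck_cont (Ck_dpartial i (Cfi i)).
have cdg i : continuous (dpartial i (dpartial i g)) by exact: Ck_cont (Ck_dpartial i (Cgi i)).
transitivity (\sum_i int_torus (fun x => g x * dpartial i (dpartial i f) x)).
  rewrite -(cint_sum HI); last by move=> i; exact: (continuousMc cg (cdf i)).
  apply: etrans (int_torus_mulC _ g) _.
  by apply: (congr1 (@int_torus R n)); apply/funext => x; rewrite mulr_sumr.
transitivity (\sum_i int_torus (fun x => f x * dpartial i (dpartial i g) x)).
  apply: eq_bigr => i _; apply: etrans (torus_ibp i (CkS Cg) (Cfi i) pg (pfi i)) _.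
  apply: etrans _ (esym (torus_ibp i (CkS Cf) (Cgi i) pf (pgi i))).
  exact: (congr1 -%R (int_torus_mulC (dpartial i g) (dpartial i f))).
rewrite -(cint_sum HI); last by move=> i; exact: (continuousMc cf (cdg i)).
by apply: (congr1 (@int_torus R n)); apply/funext => x; rewrite mulr_sumr.
Qed.

(** Division-free form of q m D(m^(q-1)) = (q - 1) D(m^q), after which the drift term can be
    integrated by parts against m^q. *)
Lemma powR_chain (R : realType) (q a x b : R) : 0 < a ->
  q * (b * ((q - 1) * powR a (q - 2) * x) * a) = (q - 1) * (b * (q * powR a (q - 1) * x)).
Proof.
move=> a0; have -> : powR a (q - 1) = powR a (q - 2) * a.
  rewrite -[X in _ * X](powRr1 (ltW a0)) -powRD; last by rewrite (gt_eqF a0) implybT.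
  by congr powR; ring.
by ring.
Qed.

Section power_flux.
Context {R : realType}.
Variables (d : nat) (m : 'rV[R]_d -> R) (b : 'I_d -> 'rV[R]_d -> R) (q : R).
Hypotheses (Cm : Ck 2 m) (pm : Zperiodic m) (m0 : forall x, 0 < m x).
Hypotheses (Cb : forall i, Ck 1 (b i)) (pb : forall i, Zperiodic (b i)).
Let HI := @cintT R d.
Let phi x := powR (m x) (q - 1).
Let mq x := powR (m x) q.

Let Cphi : Ck 2 phi. Proof. exact: Ck_powR. Qed.
Let Cmq : Ck 1 mq. Proof. exact: Ck_powR (CkS Cm) m0. Qed.
Let pphi : Zperiodic phi. Proof. by move=> x i; rewrite /phi pm. Qed.
Let pmq : Zperiodic mq. Proof. by move=> x i; rewrite /mq pm. Qed.

Let dphi i x : dpartial i phi x = (q - 1) * powR (m x) (q - 2) * dpartial i m x.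
Proof.
have [_ E] := dpartial_powR i (q - 1) (CkS Cm) m0 x.
apply: etrans E _; apply: (congr1 (fun e => (q - 1) * powR (m x) e * dpartial i m x)).
by ring.
Qed.

Let dmq i x : dpartial i mq x = q * powR (m x) (q - 1) * dpartial i m x.
Proof. by have [_ E] := dpartial_powR i q (CkS Cm) m0 x. Qed.

(** The left side is q times the dual Fokker-Planck operator applied to m^(q-1), which is the time
    derivative of int m^q. Integration by parts leaves only the divergence of the drift and the
    dissipation. *)
Lemma power_flux :
  q * int_torus (fun x => (\sum_i dpartial i (dpartial i phi) x -
    \sum_i b i x * dpartial i phi x) * m x) =
  (q - 1) * (int_torus (fun x => powR (m x) q * \sum_i dpartial i (b i) x) -
    q * int_torus (fun x => powR (m x) (q - 2) * \sum_i dpartial i m x ^+ 2)).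
Proof.
have cm := Ck_cont Cm; have cdm i := Ck_cont (Ck_dpartial i (CkS Cm)).
have cphi i := Ck_cont (Ck_dpartial i (CkS Cphi)).
have cl : continuous (fun x => \sum_i dpartial i (dpartial i phi) x).
  by apply: continuous_sum => i; exact: Ck_cont (Ck_dpartial i (Ck_dpartial i Cphi)).
have cb i := Ck_cont (Cb i); have cdb i := Ck_cont (Ck_dpartial i (Cb i)).
have cs : continuous (fun x => \sum_i b i x * dpartial i phi x).
  by apply: continuous_sum => i; exact: (continuousMc (cb i) (cphi i)).
have cdmq i := Ck_cont (Ck_dpartial i Cmq); have cmq := Ck_cont Cmq.
have I1 : int_torus (fun x => (\sum_i dpartial i (dpartial i phi) x) * m x) =
    - ((q - 1) * int_torus (fun x => powR (m x) (q - 2) * \sum_i dpartial i m x ^+ 2)).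
  have h i : int_torus (fun x => m x * dpartial i (dpartial i phi) x) =
      - int_torus (fun x => dpartial i m x * dpartial i phi x).
    exact: (torus_ibp i (CkS Cm) (Ck_dpartial i Cphi) pm (Zperiodic_dpartial i pphi)).
  apply: (etrans (int_torus_mulC _ m)).
  have -> : (fun x => m x * \sum_i dpartial i (dpartial i phi) x) =
            (fun x => \sum_i m x * dpartial i (dpartial i phi) x).
    by apply/funext => x; rewrite mulr_sumr.
  rewrite (cint_sum HI); last first.
    by move=> i; exact: (continuousMc cm (Ck_cont (Ck_dpartial i (Ck_dpartial i Cphi)))).
  rewrite (eq_bigr _ (fun i _ => h i)) sumrN -(cint_sum HI); last first.
    by move=> i; exact: (continuousMc (cdm i) (cphi i)).
  rewrite -(cintZ HI); last first.
    apply: (continuousMc (Ck_cont (Ck_powR (q - 2) Cm m0))).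
    apply: continuous_sum => i; exact: (continuousMc (cdm i) (cdm i)).
  apply: (congr1 -%R); apply: (congr1 (@int_torus R d)); apply/funext => x.
  rewrite mulrA mulr_sumr; apply: eq_bigr => i _; rewrite dphi.
  by move: (dpartial i m x) (powR _ _) => e f; ring.
have I2 : q * int_torus (fun x => (\sum_i b i x * dpartial i phi x) * m x) =
    - ((q - 1) * int_torus (fun x => powR (m x) q * \sum_i dpartial i (b i) x)).
  have h i : int_torus (fun x => b i x * dpartial i mq x) =
      - int_torus (fun x => dpartial i (b i) x * mq x).
    exact: (torus_ibp i (Cb i) Cmq (pb i) pmq).
  rewrite -(cintZ HI); last exact: (continuousMc cs cm).
  have -> : (fun x => q * ((\sum_i b i x * dpartial i phi x) * m x)) =
            (fun x => (q - 1) * \sum_i b i x * dpartial i mq x).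
    apply/funext => x; rewrite mulr_suml !mulr_sumr; apply: eq_bigr => i _.
    by rewrite dphi dmq powR_chain.
  have ccm i : continuous (fun x => b i x * dpartial i mq x).
    exact: (continuousMc (cb i) (cdmq i)).
  rewrite (cintZ HI); last exact: continuous_sum.
  rewrite -mulrN; apply: (congr1 (fun e => (q - 1) * e)).
  rewrite (cint_sum HI) // (eq_bigr _ (fun i _ => h i)) sumrN.
  rewrite -(cint_sum HI); last by move=> i; exact: (continuousMc (cdb i) cmq).
  apply: (congr1 -%R); apply: (congr1 (@int_torus R d)); apply/funext => x.
  by rewrite -mulr_suml mulrC.
have -> : (fun x => (\sum_i dpartial i (dpartial i phi) x - \sum_i b i x * dpartial i phi x) * m x) =
    (fun x => (\sum_i dpartial i (dpartial i phi) x) * m x -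
              (\sum_i b i x * dpartial i phi x) * m x).
  by apply/funext => x; rewrite mulrBl.
rewrite (cintB HI); [|exact: continuousMc cl cm|exact: continuousMc cs cm].
rewrite mulrBr I1 I2; move: (int_torus _) (int_torus _) => e f; ring.
Qed.

End power_flux.

Lemma le0_derive_segment (R : realType) (f : R -> R) (T : R) : {within `[0, T], continuous f} ->
  (forall t, 0 < t < T -> exists2 D, is_derive t 1 f D & D <= 0) ->
  forall s t, 0 <= s -> s <= t -> t <= T -> f t <= f s.
Proof.
move=> cf df s t s0 + tT; rewrite le_eqVlt => /predU1P[->//|st].
have df' r : s < r < t -> exists2 D, is_derive r 1 f D & D <= 0.
  by move=> /andP[sr rt]; apply: df; rewrite (le_lt_trans s0 sr) (lt_le_trans rt tT).
have [||r] := @MVT R f (fun s => 'D_1 f s) s t st.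
- by move=> r; rewrite in_itv /= => /df'[D [h1 h2] _]; split.
- apply: continuous_subspaceW cf => r /=; rewrite !in_itv /= => /andP[sr rt].
  by rewrite (le_trans s0 sr) (le_trans rt tT).
rewrite in_itv /= => /df'[D [h1 h2] h3] E.
rewrite -subr_le0 E h2; apply: (mulr_le0_ge0 h3); by rewrite subr_ge0 ltW.
Qed.

(** * The differential inequality that closes the moment estimate *)

Section moment_bound.
Context {R : realType}.
Variables (T q mu c Cb CG C2 Cphi Y0 : R).
Hypotheses (T0 : 0 < T) (q1 : 1 <= q) (mu0 : 0 < mu) (c0 : 0 < c) (cmu : 2 * c < 1 + mu).
Hypotheses (Cb0 : 0 < Cb) (CG1 : 1 <= CG) (C20 : 0 <= C2) (Cphi0 : 0 <= Cphi).

(** Small enough for the remainder 2 (q - 1) delta S, integrated over [0, T], to be at most S/2 (see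
    [dT]); the added 1 keeps delta <= 1 when q = 1. *)
Let delta := (1 + 4 * ((q - 1) * T))^-1.
Let A := powR (Cb * CG / delta) (1 + mu)^-1.
Let nu := 2 * c / (1 + mu).
Let b := (q - 1) * (2 * (Cb * A) * (Cphi + C2 * T)).

Let d0 : 0 < delta.
Proof. by rewrite invr_gt0 ltr_wpDr // !mulr_ge0 ?subr_ge0 // ltW. Qed.
Let d1 : delta <= 1.
Proof.
have h : 0 <= 4 * ((q - 1) * T) by rewrite !mulr_ge0 ?subr_ge0 // ltW.
by rewrite invf_le1 ?lerDl // ltr_wpDr.
Qed.
Let dT : (q - 1) * (2 * delta * T) <= 2^-1.
Proof.
have h : 0 <= (q - 1) * T by rewrite mulr_ge0 ?subr_ge0 // ltW.
have -> : (q - 1) * (2 * delta * T) = 2 * ((q - 1) * T) / (1 + 4 * ((q - 1) * T)).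
  by rewrite -/delta; ring.
rewrite ler_pdivrMr; last by rewrite ltr_wpDr // mulr_ge0.
by move: h; move: (_ * T) => z; lra.
Qed.
Let CG0 : 0 < CG. Proof. exact: lt_le_trans CG1. Qed.
Let K0 : 0 < Cb * CG / delta. Proof. by rewrite divr_gt0 // mulr_gt0. Qed.
Let A0 : 0 < A. Proof. exact: powR_gt0. Qed.
Let m1 : 0 < 1 + mu. Proof. by rewrite addr_gt0. Qed.

(* [A] is chosen so that at [l = A * S ^ nu] the factor in front of the Gagliardo-Nirenberg term
   equals [delta * S ^ (- 2 c)]. *)
Let lamE (S : R) : 0 < S ->
  Cb * powR (A * powR S nu) (- (1 + mu)) = delta / CG * powR S (- (2 * c)).
Proof.
move=> S0; rewrite powRM ?(ltW A0) ?powR_ge0 // -!powRrM mulrN mulVf ?gt_eqF //.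
have -> : nu * - (1 + mu) = - (2 * c) by rewrite /nu mulrN divfK // gt_eqF.
rewrite powR_inv1 ?(ltW K0) // mulrA; congr (_ * _).
by rewrite invfM invrK invfM; field; rewrite !gt_eqF.
Qed.

(** The choice of l turns the Gagliardo-Nirenberg term into at most delta (S + E). Its part in E is
    absorbed by the dissipation because delta <= 1, and its part in S stays as the remainder,
    together with another delta S. *)
Let step (S y E B DPhi l : R) : 1 <= S -> 0 <= y -> y <= S -> 0 <= E ->
  l = A * powR S nu -> B <= 2 * (DPhi + C2) ->
  Cb * (l * B + powR l (- (1 + mu)) * (1 + CG * (powR y (2 * c) * (y + E)))) - E <=
  2 * (Cb * l) * (DPhi + C2) + 2 * delta * S.
Proof.
move=> S1 y0 yS E0 lE hB; have S0 : 0 < S by exact: lt_le_trans S1.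
have l0 : 0 < l by rewrite lE mulr_gt0 // powR_gt0.
rewrite mulrDr mulrA mulrA lE lamE // -lE.
have sp : 1 <= powR S (2 * c).
  have h0 : 0 <= 2 * c by rewrite mulr_ge0 // ltW.
  have := @ge0_ler_powR R (2 * c) h0 1 S; rewrite !nnegrE powR1 ler01 (ltW S0); exact.
have hy : powR y (2 * c) <= powR S (2 * c).
  have h0 : 0 <= 2 * c by rewrite mulr_ge0 // ltW.
  by apply: (@ge0_ler_powR R (2 * c) h0 y S) => //; rewrite nnegrE // ltW.
rewrite powRN; set s := powR S (2 * c) in sp hy *.
have s0 : 0 < s by exact: lt_le_trans sp.
have h1 : Cb * l * B <= 2 * (Cb * l) * (DPhi + C2).
  rewrite [leRHS](_ : _ = Cb * l * (2 * (DPhi + C2))); last by ring.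
  by rewrite ler_pM2l // mulr_gt0.
have h2 : delta / CG * s^-1 * 1 <= delta.
  rewrite mulr1 -mulrA ler_piMr // ?(ltW d0) //.
  by rewrite mulr_ile1 ?invr_ge0 ?(ltW CG0) ?(ltW s0) // invf_le1.
have h3 : delta / CG * s^-1 * (CG * (powR y (2 * c) * (y + E))) <= delta * (S + E).
  rewrite [leLHS](_ : _ = delta * (s^-1 * powR y (2 * c) * (y + E))); last first.
    by field; rewrite !gt_eqF.
  rewrite ler_pM2l //.
  apply: (@le_trans _ _ (1 * (y + E))); last by rewrite mul1r lerD2r.
  by rewrite ler_wpM2r ?addr_ge0 // mulrC ler_pdivrMr // mul1r.
have h4 : delta * E <= E by rewrite ler_piMl.
have h5 : delta <= delta * S by rewrite ler_peMr // ltW.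
rewrite mulrDr; move: h1 h2 h3; rewrite [delta * (S + E)]mulrDr -[2 * delta * S]mulrA.
move: h4 h5; move: (Cb * l * B) (2 * _ * _) (_ * 1) (_ * (CG * _)) (delta * S) (delta * E).
by move=> a1 a2 a3 a4 a5 a6; lra.
Qed.

(** The bound is chosen before y and Phi, hence is the same for all solutions. The parameter l
    depends on the supremum of y but not on t, so the inequality integrates in time with constant
    coefficients. *)
Lemma moment_bound : exists Kb, forall y Phi : R -> R,
  {within `[0, T], continuous y} -> continuous Phi -> (forall t, 0 <= t <= T -> 0 <= y t) ->
  (forall t, 0 < t < T -> exists Dy DPhi B E,
     [/\ is_derive t 1 y Dy, is_derive t 1 Phi DPhi, 0 <= E, 0 <= B <= 2 * (DPhi + C2) &
      forall l, 0 < l -> Dy <= (q - 1) * (Cb * (l * B + powR l (- (1 + mu)) *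
         (1 + CG * (powR (y t) (2 * c) * (y t + E)))) - E)]) ->
  Phi T - Phi 0 <= Cphi -> y 0 <= Y0 -> forall t, 0 <= t <= T -> y t <= Kb.
Proof.
(* The value that [le_absorb_powR] returns for S <= 2 (1 + Y0) + 2 b S^nu. *)
exists (2 * (2 * (1 + Y0)) + powR (2 * (2 * b)) (1 - nu)^-1) => y Phi cy cPhi y0 dy hPhi hY.
have [ts tsT tsmax] := EVT_max (ltW T0) cy.
have nu01 : 0 < nu < 1.
  by rewrite /nu divr_gt0 ?mulr_gt0 //= ltr_pdivrMr // mul1r.
have q0 : 0 <= q - 1 by rewrite subr_ge0.
have b0 : 0 <= b by rewrite /b !mulr_ge0 // ?addr_ge0 ?mulr_ge0 // ltW.
pose S := Num.max 1 (y ts).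
have S1 : 1 <= S by rewrite le_max lexx.
have S0 : 0 < S by exact: lt_le_trans S1.
have yS t : 0 <= t <= T -> y t <= S.
  by move=> tT; rewrite le_max tsmax ?orbT // in_itv.
pose l := A * powR S nu.
have l0 : 0 < l by rewrite mulr_gt0 // powR_gt0.
(* The derivative of psi is at least B/2 >= 0. By monotonicity the growth of psi up to any
   intermediate time is controlled by the bound on Phi T - Phi 0 alone. *)
pose psi (t : R) := Phi t + C2 * t.
have dpsi (t D : R) : is_derive t 1 Phi D -> is_derive t 1 psi (D + C2).
  move=> h1; have h2 := @is_deriveZ R R R (@id R) C2 t 1 1 (is_derive_id _ _).
  have := @is_deriveD R R R Phi (fun t => C2 * t) t 1 _ _ h1 h2.
  by rewrite [_ *: 1]mulr1.
have cpsi : continuous psi.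
  by apply: continuousDc => //; apply: continuousMc; [exact: cst_continuous|move=> t; exact: cvg_id].
have psi_mono (s t : R) : 0 <= s -> s <= t -> t <= T -> psi s <= psi t.
  move=> s0 st tT; rewrite -lerN2.
  apply: (@le0_derive_segment R (fun t => - psi t) T _ _ s t s0 st tT).
    by apply: continuous_subspaceT; exact: continuousNc.
  move=> r /dy[Dy [DPhi [B [E [_ h1 _ /andP[h2 h3] _]]]]].
  exists (- (DPhi + C2)); first exact: (@is_deriveN R R R psi r 1 _ (dpsi _ _ h1)).
  by rewrite oppr_le0 -(pmulr_rge0 _ (ltr0n R 2)) (le_trans h2).
pose k := (q - 1) * (2 * (Cb * l)); pose j := (q - 1) * (2 * delta * S).
(* y minus a primitive of its upper bound; G is nonincreasing on [0, T]. *)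
pose G (t : R) := y t - (k * psi t + j * t).
have k0 : 0 <= k by rewrite mulr_ge0 // mulr_ge0 // ltW // mulr_gt0.
have j0 : 0 <= j by rewrite mulr_ge0 // ltW // !mulr_gt0.
have cG : {within `[0, T], continuous G}.
  have c1 : continuous (fun t => k * psi t + j * t).
    apply: continuousDc; apply: continuousMc; try exact: cst_continuous; first exact: cpsi.
    by move=> t; exact: cvg_id.
  move=> t; apply: cvgB; [exact: cy|exact: (continuous_subspaceT c1)].
have main (t : R) : 0 <= t <= T -> y t <= Y0 + (k * (Cphi + C2 * T) + j * T).
  move=> /andP[t0 tT].
  have : G t <= G 0.
    apply: (@le0_derive_segment R G T cG _ 0 t (lexx _) t0 tT) => r rT.
    have [Dy [DPhi [B [E [h1 h2 h3 /andP[B0 h4] h5]]]]] := dy r rT.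
    exists (Dy - (k * (DPhi + C2) + j)).
      have i1 := @is_deriveZ R R R psi k r 1 _ (dpsi _ _ h2).
      have i2 := @is_deriveZ R R R (@id R) j r 1 1 (is_derive_id _ _).
      rewrite [_ *: 1]mulr1 in i2.
      have i3 := @is_deriveD R R R (fun t => k * psi t) (fun t => j * t) r 1 _ _ i1 i2.
      exact: (@is_deriveB R R R y _ r 1 _ _ h1 i3).
    have /andP[r0 rT'] := rT.
    have rTc : 0 <= r <= T by rewrite !ltW.
    rewrite subr_le0; apply: (le_trans (h5 l l0)).
    rewrite /k /j -!mulrA -mulrDr ler_wpM2l //.
    have := @step S (y r) E B DPhi l S1 (y0 r rTc) (yS r rTc) h3 erefl h4.
    by rewrite -!mulrA.
  have := psi_mono t T t0 tT (lexx _).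
  rewrite /G /psi !mulr0 !addr0 => p1.
  have p2 : k * (Phi t + C2 * t - Phi 0) <= k * (Cphi + C2 * T).
    by rewrite ler_wpM2l //; move: p1 hPhi; lra.
  have p3 : j * t <= j * T by rewrite ler_wpM2l.
  move: p2 hY; rewrite mulrBr; move: p3.
  by move: (k * (Phi t + _)) (k * Phi 0) (k * _) (j * t) (j * T) (y t) (y 0) => *; lra.
have jT : j * T <= S / 2.
  have -> : j * T = ((q - 1) * (2 * delta * T)) * S by rewrite /j; ring.
  by rewrite mulrC ler_pM2l.
have kb : k * (Cphi + C2 * T) = b * powR S nu by rewrite /k /b /l; ring.
have tsT' : 0 <= ts <= T by move: tsT; rewrite in_itv.
have hS : S <= 2 * (1 + Y0) + 2 * b * powR S nu.
  have Y00 : 0 <= Y0 by by apply: le_trans (y0 0 _) hY; rewrite lexx ltW.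
  have SM : S <= 1 + (Y0 + (k * (Cphi + C2 * T) + j * T)).
    rewrite ge_max lerDl (le_trans (y0 ts tsT') (main ts tsT')) /=.
    by rewrite (le_trans (main ts tsT')) // lerDr.
  move: SM jT; rewrite kb -[2 * b * _]mulrA.
  by move: (b * _) (j * T) => *; lra.
move=> t tT; apply: (le_trans (yS t tT)).
have b2 : 0 <= 2 * b by rewrite mulr_ge0.
exact: (le_absorb_powR (ltW S0) b2 nu01 hS).
Qed.

End moment_bound.

(** Young's inequality is applied pointwise. As the power e it produces may be below q (1 + 2/d), it
    is replaced by 1 plus the latter power, and the 1 integrates to the volume of the torus. *)
Lemma flux_le (R : realType) n (m X D : 'rV[R]_n.+2 -> R) (q mu Cb l : R) :
  Ck 1 m -> (forall x, 0 < m x) -> continuous X -> continuous D -> (forall x, 0 <= X x) ->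
  (forall x, `|D x| <= Cb * powR (X x) ((1 + mu) / (2 + mu))) ->
  0 < mu -> 0 < Cb -> 1 <= q -> 1 + (q - 1) * (2 + mu) <= q * (1 + 2 * n.+2%:R^-1) -> 0 < l ->
  let c := n.+2%:R^-1 in let beta := q * (1 + 2 * c) * (1 - c) in
  let y := int_torus (fun x => powR (m x) q) in
  let E := int_torus (fun x => powR (m x) (q - 2) * \sum_i dpartial i m x ^+ 2) in
  (int_torus (fun x => powR (m x) q * D x) <=
  Cb * (l * int_torus (fun x => X x * m x) + powR l (- (1 + mu)) *
    (1 + n.+2%:R ^+ 2 * (2 * (1 + beta ^+ 2)) * (powR y (2 * c) * (y + E)))) : Prop).
Proof.
move=> Cm m0 cX cD X0 hD mu0 Cb0 q1 hq l0 c beta y E.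
have HI := @cintT R n.+2; have cm := Ck_cont Cm.
have cp (e : R) : continuous (fun x => powR (m x) e) by exact: Ck_cont (Ck_powR e Cm m0).
have cXm : continuous (fun x => X x * m x) by exact: (continuousMc cX cm).
have q0 : 0 < q by exact: lt_le_trans q1.
have GN := gagliardo_nirenberg Cm m0 q0.
pose f := q * (1 + 2 * c).
have c1f : continuous (fun x => 1 + powR (m x) f).
  exact: (continuousDc (@cst_continuous _ _ _) (cp f)).
pose L := powR l (- (1 + mu)).
apply: (@le_trans _ _ (int_torus (fun x => Cb * (l * (X x * m x) + L * (1 + powR (m x) f))))).
  apply: (cint_le HI) => [||x _]; first exact: (continuousMc (cp q) cD).
    exact: (continuousZc (continuousDc (continuousZc cXm) (continuousZc c1f))).
  have h1 := density_young q mu0 l0 (m0 x) (X0 x).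
  have e0 : 0 <= 1 + (q - 1) * (2 + mu).
    by rewrite addr_ge0 // mulr_ge0 ?subr_ge0 // addr_ge0 // ltW.
  have h2 := powR_le_1D (m0 x) e0 hq.
  apply: (@le_trans _ _ (powR (m x) q * (Cb * powR (X x) ((1 + mu) / (2 + mu))))).
    by rewrite ler_wpM2l ?powR_ge0 // (le_trans (ler_norm _)).
  rewrite mulrCA ler_pM2l //; apply: (le_trans h1); rewrite lerD2l.
  by rewrite ler_wpM2l // powR_ge0.
rewrite (cintZ HI); last exact: (continuousDc (continuousZc cXm) (continuousZc c1f)).
rewrite ler_pM2l // (cintD HI); [|exact: continuousZc|exact: continuousZc].
rewrite !(cintZ HI) // lerD2l ler_wpM2l ?powR_ge0 // (cintD HI) //; last exact: cst_continuous.
by rewrite (cint_cst HI) mul1r lerD2l.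
Qed.

(** * Estimates for a solution of the regularized system *)

(** With L = c + 1, E1 = exp(- L t) and E2 = exp(- 2 L t), the bound Mx D <= Mt shows that the
    expression is at least (L - D) (k E2 - E1 Mx) + (D + L) k E2. The first product is nonnegative
    and the second positive. *)
Lemma comparison_sign (R : realFieldType) (c D Mx Mt E1 E2 k : R) :
  0 < E1 -> 0 < k * E2 -> - c <= D -> D <= c -> Mx * D <= Mt -> E1 * Mx - k * E2 < 0 ->
  0 < E1 * Mt + (- (c + 1) * E1) * Mx - k * ((- (c + 1) * 2) * E2).
Proof.
move=> e1 e2 D1 D2 dM; rewrite subr_lt0 => Fneg.
have h : E1 * (Mx * D) <= E1 * Mt by rewrite (ler_pM2l e1).
have p1 : 0 <= (c + 1 - D) * (k * E2 - E1 * Mx) by rewrite mulr_ge0 // subr_ge0; lra.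
have p2 : 0 < (D + (c + 1)) * (k * E2) by rewrite mulr_gt0 //; lra.
apply: (@lt_le_trans _ _ ((D + (c + 1)) * (k * E2) + (c + 1 - D) * (k * E2 - E1 * Mx))).
  by rewrite ltr_wpDr.
rewrite -subr_ge0; have : 0 <= E1 * Mt - E1 * (Mx * D) by rewrite subr_ge0.
by move=> h'; apply: (le_trans h'); rewrite le_eqVlt; apply/orP; left; apply/eqP; ring.
Qed.

Lemma Zperiodic_sum (R : realType) n (I : Type) (r : seq I) (f : I -> 'rV[R]_n -> R) :
  (forall i, Zperiodic (f i)) -> Zperiodic (fun x => \sum_(i <- r) f i x).
Proof. by move=> pf x j; apply: eq_bigr => i _; exact: pf. Qed.

Lemma is_derive_expR_lin (R : realType) (c t : R) : is_derive t 1 (fun t => expR (c * t)) (c * expR (c * t)).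
Proof.
have d1 : is_derive t 1 (fun t : R => c * t) c.
  have := @is_deriveZ _ _ _ (@id R) c t 1 1 (is_derive_id _ _).
  by rewrite [_ *: 1]mulr1.
have := @is_derive1_comp R (@expR R) (fun t => c * t) t _ c (is_derive_expR _) d1.
by rewrite mulrC.
Qed.

Lemma expR_lin_cont (R : realType) (c : R) : continuous (fun t : R => expR (c * t)).
Proof.
by move=> t; apply/differentiable_continuous/derivable1_diffP; have [] := is_derive_expR_lin c t.
Qed.

Lemma sumB_eq (V : zmodType) n (a b c e : 'I_n -> V) :
  (forall i, a i = b i - (c i + e i)) ->
  \sum_i a i = \sum_i b i - (\sum_i c i + \sum_i e i).
Proof. by move=> h; rewrite (eq_bigr _ (fun i _ => h i)) sumrB big_split. Qed.

Lemma dual_cancel (A : comPzRingType) (a b g l w m : A) : g = a - (l + w) ->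
  (l - b) * m + w * m = (a - b) * m - g * m.
Proof. by move=> ->; ring. Qed.

Lemma lagr_cancel (A : comPzRingType) (l b h w m : A) :
  (l - b) * m + w * m = - ((b - h) * m + (h - (l + w)) * m).
Proof. by ring. Qed.

Section mean_field_game.
Context {R : realType}.
Variables (d : nat) (T : R) (H : 'rV[R]_d -> 'rV[R]_d -> R).
Variables (U M : 'rV[R]_(d + 1) -> R).
Hypotheses (T0 : 0 < T) (CH : forall k, Ck k (joint H)).
Hypothesis pH : forall p, Zperiodic (fun x => H x p).
Hypotheses (CU : forall k, Ck k U) (CM : forall k, Ck k M).
Let u t := fun x => U (st x t).
Let m t := fun x => M (st x t).
Hypotheses (pU : forall t, 0 <= t <= T -> Zperiodic (u t)).
Hypotheses (pM : forall t, 0 <= t <= T -> Zperiodic (m t)).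
Hypothesis eqM : forall x t, 0 < t < T ->
  dtt M (st x t) - \sum_i dpartial i (fun y => m t y * drift H (u t) i y) x =
  \sum_i dpartial i (dpartial i (m t)) x.

Let Cu k t : Ck k (u t). Proof. exact: Ck_slice. Qed.
Let Cm k t : Ck k (m t). Proof. exact: Ck_slice. Qed.

Lemma grad_slice x t j : grad (u t) x 0 j = dxx U j (st x t).
Proof. by rewrite mxE; exact: (congr1 (fun f => f x) (dpartial_slice j t (CU 1))). Qed.

Lemma hess_slice x t i j : hess (u t) x i j = dxx (dxx U j) i (st x t).
Proof. by rewrite mxE; exact: (congr1 (fun f => f x) (dpartial2_slice i j t (CU 2))). Qed.

Lemma grad_jcont : continuous (fun z : 'rV[R]_d * R => grad (u z.2) z.1).
Proof.
move=> z; apply: (@cvg_rV _ _ (nbhs z) _) => j; rewrite grad_slice.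
rewrite (_ : (fun s : 'rV[R]_d * R => grad (u s.2) s.1 0 j) = (fun s => dxx U j (st s.1 s.2))).
  have cc := st_cont (Ck_cont (Ck_dpartial (lshift 1 j) (CU 1))); exact: cc.
by apply/funext => s; exact: grad_slice.
Qed.

Lemma graph_jcont (F : 'rV[R]_(d + d) -> R) : continuous F ->
  jcont (fun x t => F (row_mx x (grad (u t) x))).
Proof.
move=> cF; apply: (row_mx_cont (f := fun z : 'rV[R]_d * R => z.1)
  (g := fun z : 'rV[R]_d * R => grad (u z.2) z.1) cF); first exact: continuous_fst.
exact: grad_jcont.
Qed.

Lemma drift_periodic t i : 0 <= t <= T -> Zperiodic (drift H (u t) i).
Proof.
move=> tT x j.
have gE : grad (u t) (x + ebasis R j) = grad (u t) x.
  by apply/rowP => l; rewrite !mxE; exact: (Zperiodic_dpartial l (pU tT)).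
rewrite /drift gE !mxE; have -> : H (x + ebasis R j) = H x; last by [].
by apply/funext => p; exact: pH.
Qed.

Lemma divdrift_periodic t : 0 <= t <= T -> Zperiodic (divdrift H (u t)).
Proof.
move=> tT; apply: Zperiodic_sum => i; apply: Zperiodic_dpartial; exact: drift_periodic.
Qed.

Lemma divdrift_jcont : jcont (fun x t => divdrift H (u t) x).
Proof.
rewrite (_ : (fun x t => divdrift H (u t) x) = (fun x t => \sum_i
   (dpartial (lshift d i) (dpartial (rshift d i) (joint H)) (row_mx x (grad (u t) x)) +
   \sum_k dxx (dxx U k) i (st x t) *
     dpartial (rshift d k) (dpartial (rshift d i) (joint H)) (row_mx x (grad (u t) x))))).
  apply: continuous_sum => i; apply: continuousDc.
    exact: graph_jcont (Ck_cont (Ck_dpartial _ (Ck_dpartial _ (CH 2)))).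
  apply: continuous_sum => k; apply: continuousMc.
    exact: st_cont (Ck_cont (Ck_dpartial _ (Ck_dpartial _ (CU 2)))).
  exact: graph_jcont (Ck_cont (Ck_dpartial _ (Ck_dpartial _ (CH 2)))).
apply/funext => x; apply/funext => t; apply: eq_bigr => i _.
apply: etrans (dpartial_drift CH (fun k => Cu k t) i i x) _.
apply: congr2; first exact: (D2xpHE CH).
apply: eq_bigr => k _; apply: congr2; first exact: hess_slice.
exact: (D2ppHE CH).
Qed.

Lemma fokker_planck_expand x t : 0 < t < T -> dtt M (st x t) =
  \sum_i dpartial i (dpartial i (m t)) x +
  \sum_i (m t x * dpartial i (drift H (u t) i) x + dpartial i (m t) x * drift H (u t) i x).
Proof.
move=> tT; have := eqM x tT => /eqP; rewrite subr_eq => /eqP ->; congr (_ + _).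
apply: eq_bigr => i _.
exact: (congr1 (fun f => f x) (dpartialM i (Cm 1 t) (Ck_drift CH (fun k => Cu k t) 1 i))).
Qed.

Let HI := @cintT R d.

(* The comparison function is kappa exp(-c t) with c larger than |div b|.  It is compared after
   multiplication by another exponential, which makes the inequality at an interior minimum
   strict. *)
Lemma density_gt0 (kappa : R) : 0 < kappa -> (forall x, kappa <= m 0 x) ->
  forall x t, 0 <= t <= T -> 0 < m t x.
Proof.
move=> k0 m0.
have [c c0 cD] := slab_bounded (ltW T0) divdrift_jcont divdrift_periodic.
pose L := c + 1.
pose F x t := expR (- L * t) * M (st x t) - kappa * expR (- L * t * 2).
pose F' x t := (expR (- L * t) * dtt M (st x t) + (- L * expR (- L * t)) * M (st x t))
   - kappa * ((- L * 2) * expR (- L * t * 2)).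
have cE (a : R) : continuous (fun t : R => expR (a * t)) by exact: expR_lin_cont.
have EE t : expR (- L * t * 2) = expR ((- L * 2) * t) by congr expR; rewrite mulrAC.
have main : forall x t, 0 <= t <= T -> 0 <= F x t.
  apply: (@min_principle R d F F' T T0).
  - apply: continuousDc.
      apply: continuousMc; last exact: st_cont (Ck_cont (CM 0)).
      exact: (continuous_compc (f := snd) (@continuous_snd _ _) (cE (- L))).
    move=> z; apply: cvgN; move: z.
    apply: continuousMc; first exact: cst_continuous.
    have -> : (fun z : 'rV[R]_d * R => expR (- L * z.2 * 2)) = (fun z => expR ((- L * 2) * z.2)).
      by apply/funext => z; exact: EE.
    exact: (continuous_compc (f := snd) (@continuous_snd _ _) (cE (- L * 2))).
  - move=> t /andP[h0 hT] x i; rewrite /F; congr (_ * _ - _).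
    by apply: (pM (t := t)); rewrite h0 ltW.
  - move=> x t.
    have h1 := is_derive_expR_lin (- L) t; have h2 := is_derive_st x t (CM 1).
    have h3 := is_derive_expR_lin (- L * 2) t.
    have h4 := @is_deriveM R R (fun t => expR (- L * t)) (fun t => M (st x t)) t 1 _ _ h1 h2.
    have h5 := @is_deriveZ R R R (fun t => expR (- L * 2 * t)) kappa t 1 _ h3.
    have h6 := @is_deriveB R R R _ _ t 1 _ _ h4 h5.
    have -> : F x = (fun t => expR (- L * t) * M (st x t)) - (kappa *: (fun t => expR (- L * 2 * t))).
      by apply/funext => s; rewrite /F EE.
    apply: (is_derive_eq h6); rewrite /F' EE; congr (_ + _ - _).
    by rewrite [LHS]mulrC.
  - move=> x; have c1 : continuous (fun t => M (st x t)).
      exact: (@jcont_sec R 'rV[R]_d R (fun x t => M (st x t)) x (st_cont (Ck_cont (CM 0)))).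
    have c2 : continuous (fun t => dtt M (st x t)).
      exact: (@jcont_sec R 'rV[R]_d R (fun x t => dtt M (st x t)) x
        (st_cont (Ck_cont (Ck_dpartial (ti d) (CM 1))))).
    have c3 : continuous (fun t => kappa * ((- L * 2) * expR (- L * t * 2))).
      under eq_fun do rewrite EE.
      apply: continuousMc; first exact: cst_continuous.
      by apply: continuousMc; [exact: cst_continuous|exact: cE].
    have c4 : continuous (fun t => expR (- L * t) * dtt M (st x t) + (- L * expR (- L * t)) * M (st x t)).
      apply: continuousDc; apply: continuousMc => //.
      exact: continuousZc.
    by move=> t; apply: cvgB; [exact: c4|exact: c3].
  - move=> x; rewrite /F !mulr0 mul0r expR0 mul1r mulr1 subr_ge0; exact: m0.
  - move=> x t tT Fneg Fmin; have /andP[tp tT'] := tT.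
    have tTc : 0 <= t <= T by rewrite !ltW.
    have e1 : 0 < expR (- L * t) by exact: expR_gt0.
    have e2 : 0 < kappa * expR (- L * t * 2) by rewrite mulr_gt0 // expR_gt0.
    have mmin y : m t x <= m t y.
      by have := Fmin y; rewrite /F lerD2r ler_pM2l.
    have sp i := spatial_min i (Cm 2 t) mmin.
    have dM : m t x * divdrift H (u t) x <= dtt M (st x t).
      rewrite fokker_planck_expand // big_split /= -mulr_sumr -/(divdrift _ _ _).
      rewrite [X in _ + (_ + X)]big1 ?addr0; last by move=> i _; rewrite (sp i).1 mul0r.
      by rewrite lerDr sumr_ge0 // => i _; exact: (sp i).2.
    have := cD x t tTc; rewrite ler_norml => /andP[D1 D2].
    exact: (comparison_sign e1 e2 D1 D2 dM Fneg).
move=> x t tT; have := main x t tT; rewrite /F subr_ge0 => h.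
rewrite -(pmulr_rgt0 _ (expR_gt0 (- L * t))).
by apply: lt_le_trans h; rewrite mulr_gt0 // expR_gt0.
Qed.

(** The weak form with a time-independent test function. It is used with 1 for the mass, u for P,
    Delta u for W, and m^(q-1) for the moments. *)
Lemma fokker_planck_dual (phi : 'rV[R]_d -> R) t : 0 < t < T -> Ck 2 phi -> Zperiodic phi ->
  int_torus (fun x => phi x * dtt M (st x t)) =
  int_torus (fun x => (\sum_i dpartial i (dpartial i phi) x -
    \sum_i drift H (u t) i x * dpartial i phi x) * m t x).
Proof.
move=> tT Cphi pphi; have /andP[tp tT'] := tT.
have tTc : 0 <= t <= T by rewrite !ltW.
have C1 : Ck 1 phi by exact: CkS.
have Cd k i : Ck k (drift H (u t) i) by exact: (Ck_drift CH (fun k => Cu k t) k i).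
have Cdm i : Ck 1 (dpartial i (m t)) by exact: Ck_dpartial (Cm 2 t).
have Cdp i : Ck 1 (dpartial i phi) by exact: Ck_dpartial Cphi.
have cphi := Ck_cont C1; have cm : continuous (m t) := Ck_cont (Cm 0 t).
have Cmd i : Ck 1 (fun y => m t y * drift H (u t) i y) by apply: CkM; [exact: Cm|exact: Cd].
have pmd i : Zperiodic (fun y => m t y * drift H (u t) i y).
  by apply: ZperiodicM; [exact: pM|exact: drift_periodic].
have pdm i : Zperiodic (dpartial i (m t)) by apply: Zperiodic_dpartial; exact: pM.
have pdp i : Zperiodic (dpartial i phi) by exact: Zperiodic_dpartial.
have cc1 i : continuous (fun x => phi x * dpartial i (dpartial i (m t)) x).
  by apply: continuousMc => //; exact: Ck_cont (Ck_dpartial i (Cdm i)).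
have cc2 i : continuous (fun x => phi x * dpartial i (fun y => m t y * drift H (u t) i y) x).
  by apply: continuousMc => //; exact: Ck_cont (Ck_dpartial i (Cmd i)).
have cc3 i : continuous (fun x => dpartial i (dpartial i phi) x * m t x).
  by apply: continuousMc => //; exact: Ck_cont (Ck_dpartial i (Cdp i)).
have cc4 i : continuous (fun x => dpartial i phi x * (m t x * drift H (u t) i x)).
  by apply: continuousMc; [exact: Ck_cont (Cdp i)|exact: Ck_cont (Cmd i)].
have E1 i : int_torus (fun x => phi x * dpartial i (dpartial i (m t)) x) =
            int_torus (fun x => dpartial i (dpartial i phi) x * m t x).
  rewrite (torus_ibp i C1 (Cdm i) pphi (pdm i)) (torus_ibp i (Cdp i) (Cm 1 t) (pdp i) (pM tTc)).
  by rewrite opprK.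
have E2 i : int_torus (fun x => phi x * dpartial i (fun y => m t y * drift H (u t) i y) x) =
            - int_torus (fun x => dpartial i phi x * (m t x * drift H (u t) i x)).
  exact: (torus_ibp i C1 (Cmd i) pphi (pmd i)).
transitivity (int_torus (fun x => \sum_i phi x * dpartial i (dpartial i (m t)) x +
   \sum_i phi x * dpartial i (fun y => m t y * drift H (u t) i y) x)).
  apply: (congr1 (@int_torus R d)); apply/funext => x.
  have := eqM x tT => /eqP; rewrite subr_eq => /eqP ->.
  by rewrite mulrDr !mulr_sumr.
rewrite (cintD HI); [|exact: continuous_sum|exact: continuous_sum].
rewrite !(cint_sum HI) // (eq_bigr _ (fun i _ => E1 i)) (eq_bigr _ (fun i _ => E2 i)).
rewrite sumrN -!(cint_sum HI) // -(cintB HI); [|exact: continuous_sum|exact: continuous_sum].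
apply: (congr1 (@int_torus R d)); apply/funext => x.
rewrite mulrBl !mulr_suml; congr (_ - _); apply: eq_bigr => i _.
by rewrite mulrA mulrAC [drift _ _ _ _ * _]mulrC.
Qed.

Hypothesis m0 : forall x t, 0 <= t <= T -> 0 < m t x.

Variable q : R.

(* Outside of [0, T] the density may be negative, where [powR] is discontinuous; it is truncated
   from below at its minimum on the slab. *)
Lemma moment_continuous :
  {within `[0, T], continuous (fun t => int_torus (fun x => powR (m t x) q))}.
Proof.
have [k k0 mk] : exists2 k, 0 < k & forall x t, 0 <= t <= T -> k <= m t x.
  have [x0 [t0 [t0T mn]]] := slab_min (ltW T0) (st_cont (Ck_cont (CM 0))) pM.
  by exists (m t0 x0); [exact: m0|exact: mn].
have cI : continuous (fun t => int_torus (fun x => powR (Num.max (M (st x t)) k) q)).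
  apply: (cint_jcont (cintT d)) => z.
  apply: (@powR_continuous_pos R _ (fun z : R * 'rV[R]_d => Num.max (M (st z.2 z.1)) k) q z).
    apply: (@continuous_max _ _ (fun z : R * 'rV[R]_d => M (st z.2 z.1)) (fun=> k)).
      exact: (st_cont_swap (Ck_cont (CM 0))).
    exact: cvg_cst.
  by rewrite lt_max k0 orbT.
apply: (@subspace_eq_continuous _ _ _ (fun t => int_torus (fun x => powR (Num.max (M (st x t)) k) q))).
  move=> t; rewrite inE /= in_itv /= => tT.
  apply: (congr1 (@int_torus R d)); apply/funext => x.
  by rewrite (max_idPl (mk x t tT)).
exact: continuous_subspaceT.
Qed.

(** At an interior time all nearby slices are positive, so the power is differentiable in t there;
    [power_flux] then rewrites the derivative. *)
Lemma moment_is_derive t : 0 < t < T ->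
  is_derive t 1 (fun t => int_torus (fun x => powR (m t x) q))
  ((q - 1) * (int_torus (fun x => powR (m t x) q * divdrift H (u t) x) -
    q * int_torus (fun x => powR (m t x) (q - 2) * \sum_i dpartial i (m t) x ^+ 2))).
Proof.
move=> tT; have tTc : 0 <= t <= T by have /andP[? ?] := tT; rewrite !ltW.
have mt0 x : 0 < m t x by exact: m0.
have Cb k i : Ck k (drift H (u t) i) by apply: Ck_drift => // l; exact: Cu.
have pb i : Zperiodic (drift H (u t) i) by exact: drift_periodic.
have := power_flux q (Cm 2 t) (pM tTc) mt0 (Cb 1) pb.
rewrite -/(divdrift _ _) => <-.
have Cphi : Ck 2 (fun x => powR (m t x) (q - 1)) by exact: Ck_powR.
have pphi : Zperiodic (fun x => powR (m t x) (q - 1)) by move=> x i; rewrite (pM tTc).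
rewrite -(fokker_planck_dual tT Cphi pphi).
have cphi := Ck_cont Cphi.
have cdM : continuous (fun x => dtt M (st x t)) by exact: Ck_cont (Ck_slice t (Ck_dpartial _ (CM 1))).
rewrite -(cintZ HI); last exact: (continuousMc cphi cdM).
have -> : (fun x => q * (powR (m t x) (q - 1) * dtt M (st x t))) =
          (fun x => q * powR (m t x) (q - 1) * dtt M (st x t)).
  by apply/funext => x; rewrite mulrA.
apply: (cint_is_derive (cintT d) (F' := fun t x => q * powR (m t x) (q - 1) * dtt M (st x t))).
- have /andP[t0 tT'] := tT.
  near=> s.
  have sT : 0 < s < T by apply/andP; split; near: s; [exact: lt_nbhsr|exact: lt_nbhsl].
  have sTc : 0 <= s <= T by have /andP[? ?] := sT; rewrite !ltW.
  split; first by apply: (Ck_cont (Ck_powR q (Cm 0 s) _)) => x; exact: m0.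
  move=> x; have ms : 0 < M (st x s) by exact: m0.
  exact: (@is_derive1_comp R (fun a => powR a q) (fun s => M (st x s)) s _ _
    (is_derive1_powR q ms) (is_derive_st x s (CM 1))).
- by apply: continuousMc => //; apply: continuousMc => //; exact: cst_continuous.
- move=> x; apply: continuousM.
    apply: continuousM; first exact: cvg_cst.
    apply: (@powR_continuous_pos R _ (fun z : R * 'rV[R]_d => M (st z.2 z.1)) (q - 1)).
      exact: (st_cont_swap (Ck_cont (CM 0))).
    exact: mt0.
  exact: (st_cont_swap (Ck_cont (Ck_dpartial (ti d) (CM 1)))).
Unshelve. all: by end_near.
Qed.

Variables (k : 'rV[R]_d -> R) (N alpha : R).
Hypotheses (Hk : kernel_on k N) (a0 : 0 < alpha).
Let g t := tconv k (fun y => powR (tconv k (m t) y) alpha).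
Hypothesis eqU : forall x t, 0 < t < T ->
  - dtt U (st x t) + ham H (u t) x = \sum_i dpartial i (dpartial i (u t)) x + g t x.
Hypothesis H1 : forall x p, 1 <= H x p.

Let tTc t : 0 < t < T -> 0 <= t <= T. Proof. by move=> /andP[? ?]; rewrite !ltW. Qed.
Let mpos t : 0 <= t <= T -> forall y, 0 < m t y.
Proof. by move=> tT y; exact: m0. Qed.
Let g0 t x : 0 <= t <= T -> 0 <= g t x.
Proof.
by move=> tT; exact: (conv_pow_ge0 Hk alpha (Cm 2 t) (pM tT) (mpos tT) x).
Qed.

(** The minimum principle is applied in reversed time s = T - t. At a spatial minimum Du = 0 and
    Delta u >= 0, and the coupling is nonnegative, so - u_t >= - H(x, 0) >= - cH; the extra 1 in the
    slope makes the inequality strict. *)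
Lemma value_lower_bound cT cH : (forall x, - cT <= u T x) -> (forall x, H x 0 <= cH) ->
  forall x t, 0 <= t <= T -> - (cT + (cH + 1) * (T - t)) <= u t x.
Proof.
move=> hT hH x t tT.
pose F x s := U (st x (T - s)) + ((cH + 1) * s + cT).
pose F' x s := - dtt U (st x (T - s)) + (cH + 1).
have crev : continuous (fun s : R => T - s) by move=> s; apply: cvgB; [exact: cvg_cst|exact: cvg_id].
have crev2 : continuous (fun z : 'rV[R]_d * R => (z.1, T - z.2)).
  apply: continuous_pairc; first exact: continuous_fst.
  exact: (continuous_compc (f := snd) (@continuous_snd _ _) crev).
have main : forall x s, 0 <= s <= T -> 0 <= F x s.
  apply: (@min_principle R d F F' T T0).
  - apply: continuousDc.
      exact: (continuous_compc (f := fun z : 'rV[R]_d * R => (z.1, T - z.2)) crev2 (st_cont (Ck_cont (CU 0)))).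
    apply: continuousDc; last exact: cst_continuous.
    by apply: continuousMc; [exact: cst_continuous|exact: continuous_snd].
  - move=> s /andP[s0 sT] y i; rewrite /F; congr (_ + _).
    by apply: (pU (t := T - s)); rewrite subr_ge0 ltW //= lerBlDr lerDl.
  - move=> y s.
    have h1 : is_derive s 1 (fun s : R => T - s) (-1).
      have := @is_deriveB R R R (cst T) id s 1 0 1 (is_derive_cst _ _ _) (is_derive_id _ _).
      by rewrite sub0r.
    have h2 := @is_derive1_comp R (fun t => U (st y t)) (fun s => T - s) s _ (-1)
      (is_derive_st y (T - s) (CU 1)) h1.
    have h3 : is_derive s 1 (fun s : R => (cH + 1) * s + cT) (cH + 1).
      have h4 := @is_deriveZ R R R (@id R) (cH + 1) s 1 1 (is_derive_id _ _).
      have := @is_deriveD R R R (fun s => (cH + 1) * s) (cst cT) s 1 _ 0 h4 (is_derive_cst _ _ _).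
      by rewrite addr0 [_ *: 1]mulr1.
    have := @is_deriveD R R R _ _ s 1 _ _ h2 h3.
    by rewrite mulrN1.
  - move=> y; have c1 : continuous (fun t => dtt U (st y t)).
      exact: (@jcont_sec R 'rV[R]_d R (fun x t => dtt U (st x t)) y
        (st_cont (Ck_cont (Ck_dpartial (ti d) (CU 1))))).
    move=> s; apply: cvgD; last exact: cvg_cst.
    apply: cvgN; exact: (continuous_compc (f := fun s : R => T - s) crev c1).
  - move=> y; rewrite /F subr0 mulr0 add0r -lerBlDr sub0r; exact: hT.
  - move=> y s /andP[s0 sT] _ Fmin.
    have tT' : 0 < T - s < T by rewrite subr_gt0 sT /= ltrBlDr ltrDl.
    have umin z : u (T - s) y <= u (T - s) z by have := Fmin z; rewrite /F lerD2r.
    have sp i := spatial_min i (Cu 2 (T - s)) umin.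
    have gr : grad (u (T - s)) y = 0 by apply/rowP => i; rewrite !mxE (sp i).1.
    have lap0 : 0 <= \sum_i dpartial i (dpartial i (u (T - s))) y.
      by apply: sumr_ge0 => i _; exact: (sp i).2.
    have := eqU y tT'; have := g0 y (tTc tT'); rewrite /ham gr; have := hH y.
    rewrite /F'; move: (dtt U _) (H y 0) (g _ _) (\sum_i _) lap0 => a b c e.
    move=> e0 bH c0 E; lra.
have := main x (T - t); rewrite subr_ge0 lerBlDr lerDl andbC tT => /(_ isT).
have e : T - (T - t) = t by rewrite opprB addrC subrK.
by rewrite /F e => h; rewrite -subr_ge0 opprK [cT + _]addrC.
Qed.

Lemma mass_conserved : int_torus (m 0) = 1 -> forall t, 0 <= t <= T -> int_torus (m t) = 1.
Proof.
move=> E0 t /andP[t0 tT].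
have d0 (s : R) : 0 < s < T -> is_derive s 1 (fun t => int_torus (fun x => M (st x t))) 0.
  move=> sT; have := torus_time_derive s (CM 1); set D := int_torus _.
  suff -> : D = 0 by [].
  have C1 : Ck 2 (fun _ : 'rV[R]_d => (1 : R)) by exact: Ck_cst.
  have := fokker_planck_dual sT C1 (fun _ _ => erefl).
  have -> : (fun x => 1 * dtt M (st x s)) = (fun x => dtt M (st x s)).
    by apply/funext => x; rewrite mul1r.
  rewrite -/D => ->; rewrite -[RHS](cint0 HI).
  apply: (congr1 (@int_torus R d)); apply/funext => x.
  have dz i : dpartial i (fun _ : 'rV[R]_d => (1 : R)) = (fun=> 0).
    by apply/funext => y; rewrite /dpartial derive_cst.
  have dz0 i : dpartial i (fun _ : 'rV[R]_d => (0 : R)) = (fun=> 0).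
    by apply/funext => y; rewrite /dpartial derive_cst.
  rewrite !big1 ?subrr ?mul0r // => i _; first by rewrite dz mulr0.
  by rewrite dz dz0.
have cI := torus_time_cont (Ck_cont (CM 0)).
have [||s _ E] := @MVT_segment R (fun t => int_torus (fun x => M (st x t))) (fun=> 0) 0 t t0.
- by move=> s; rewrite in_itv /= => /andP[s0 st]; apply: d0; rewrite s0 (lt_le_trans st).
- exact: continuous_subspaceT.
- rewrite mul0r in E; apply/eqP; rewrite -subr_eq0 -E0; exact/eqP.
Qed.

Let lap (t : R) x := \sum_i dpartial i (dpartial i (u t)) x.
(** Delta u as a function on space-time, which can be differentiated in t; [lap] is the same
    function on one slice, to which the torus identities apply. *)
Let LU (z : 'rV[R]_(d + 1)) := \sum_i dxx (dxx U i) i z.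

Let CLU k' : Ck k' LU.
Proof. by apply: Ck_sum => i; exact: (Ck_dpartial _ (Ck_dpartial _ (CU k'.+2))). Qed.

Let lapE t : lap t = (fun x => LU (st x t)).
Proof.
apply/funext => x; apply: eq_bigr => i _.
exact: (congr1 (fun f => f x) (dpartial2_slice i i t (CU 2))).
Qed.

Let Clap k' t : Ck k' (lap t). Proof. by rewrite lapE; exact: Ck_slice. Qed.
Let plap t : 0 <= t <= T -> Zperiodic (lap t).
Proof.
move=> tT; apply: Zperiodic_sum => i; apply: Zperiodic_dpartial; apply: Zperiodic_dpartial.
exact: pU.
Qed.

Let w (t : R) x := dtt U (st x t).
Let Cw k' t : Ck k' (w t). Proof. exact: Ck_slice (Ck_dpartial _ (CU k'.+1)). Qed.
Let Cham k' t : Ck k' (ham H (u t)). Proof. by apply: Ck_ham => // l; exact: Cu. Qed.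
Let Cdr k' t i : Ck k' (drift H (u t) i). Proof. by apply: Ck_drift => // l; exact: Cu. Qed.

(** The smoothness of the coupling is read off the Hamilton-Jacobi equation, whose other terms are
    smooth, so that no convolution has to be differentiated. *)
Let gE t : 0 < t < T -> g t = (fun x => ham H (u t) x + - (lap t x + w t x)).
Proof. by move=> tT; apply/funext => x; have := eqU x tT; rewrite -/(lap t x) -/(w t x); lra. Qed.

Let Cg k' t : 0 < t < T -> Ck k' (g t).
Proof. by move=> /gE ->; apply: CkD => //; apply: CkN; exact: CkD. Qed.

Let pg t : 0 <= t <= T -> Zperiodic (g t).
Proof.
move=> tT; apply: (tconv_periodic Hk) => x i.
by rewrite (tconv_periodic Hk (pM tT)).
Qed.

Let cm t : continuous (m t). Proof. exact: Ck_cont (Cm 0 t). Qed.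

Definition second_order (t : R) x :=
  \tr (D2xxH H x (grad (u t) x)) + 2 * \tr (D2pxH H x (grad (u t) x) *m hess (u t) x) +
  \tr (D2ppH H x (grad (u t) x) *m (hess (u t) x *m hess (u t) x)).

Let second_orderE t x : second_order t x =
  \sum_i dpartial i (dpartial i (ham H (u t))) x - \sum_j drift H (u t) j x * dpartial j (lap t) x.
Proof.
rewrite (laplace_ham CH (fun l => Cu l t)) -/(second_order t x).
rewrite (_ : \sum_j drift H (u t) j x * dpartial j (lap t) x =
  \sum_j drift H (u t) j x * \sum_i dpartial j (dpartial i (dpartial i (u t))) x) ?addrK //.
apply: eq_bigr => j _; congr (_ * _).
have Ci i : Ck 1 (dpartial i (dpartial i (u t))).
  exact: (Ck_dpartial i (Ck_dpartial i (Cu 3 t))).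
exact: (congr1 (fun f => f x) (dpartial_sum j _ Ci)).
Qed.

Let c_second_order t : continuous (second_order t).
Proof.
rewrite (_ : second_order t = (fun x => \sum_i dpartial i (dpartial i (ham H (u t))) x +
   - \sum_j drift H (u t) j x * dpartial j (lap t) x)).
  apply: continuousDc.
    by apply: continuous_sum => i; exact: Ck_cont (Ck_dpartial i (Ck_dpartial i (Cham 2 t))).
  apply: continuousNc; apply: continuous_sum => j; apply: continuousMc.
    exact: Ck_cont (Cdr 0 t j).
  exact: Ck_cont (Ck_dpartial j (Clap 1 t)).
by apply/funext => x; exact: second_orderE.
Qed.

Let W (t : R) := int_torus (fun x => LU (st x t) * M (st x t)).
Let P (t : R) := int_torus (fun x => U (st x t) * M (st x t)).
Let Q (t : R) := int_torus (fun x => U (st x t)).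

Let dttLU t x : dtt LU (st x t) = \sum_i dpartial i (dpartial i (w t)) x.
Proof.
have Ci i : Ck 1 (dxx (dxx U i) i) by exact: (Ck_dpartial _ (Ck_dpartial _ (CU 3))).
apply: etrans (congr1 (fun f => f (st x t)) (dpartial_sum (ti d) _ Ci)) _.
apply: eq_bigr => i _.
apply: etrans _ (esym (congr1 (fun f => f x) (dpartial2_slice i i t (Ck_dpartial (ti d) (CU 3))))).
apply: etrans (dpartialC_at (ti d) (lshift 1 i) (st x t) (Ck_dpartial (lshift 1 i) (CU 3))) _.
apply: (congr1 (fun f => dpartial (lshift 1 i) f (st x t))).
exact: (dpartialC (ti d) (lshift 1 i) (CU 2)).
Qed.

(** Only a lower bound is stated because the contribution of the coupling is dropped: two
    integrations by parts move its Laplacian onto m, where [conv_pow_laplace_le0] gives the sign. *)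
Let dW t : 0 < t < T -> exists2 D, is_derive t 1 W D &
  int_torus (fun x => second_order t x * m t x) <= D.
Proof.
move=> tT; have tc := tTc tT.
have CLM : Ck 1 (fun z => LU z * M z) by apply: CkM.
exists (int_torus (fun x => dtt (fun z => LU z * M z) (st x t))).
  exact: torus_time_derive.
have E x : dtt (fun z => LU z * M z) (st x t) = lap t x * dtt M (st x t) + dtt LU (st x t) * m t x.
  rewrite (lapE t); exact: (congr1 (fun f => f (st x t)) (dpartialM (ti d) (CLU 1) (CM 1))).
have cdM : continuous (fun x => dtt M (st x t)) by exact: Ck_cont (Ck_slice t (Ck_dpartial _ (CM 1))).
have cdL : continuous (fun x => dtt LU (st x t)) by exact: Ck_cont (Ck_slice t (Ck_dpartial _ (CLU 1))).
have cl : continuous (lap t) := Ck_cont (Clap 0 t).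
have cc1 : continuous (fun x => lap t x * dtt M (st x t)) by exact: continuousMc.
have cc2 : continuous (fun x => dtt LU (st x t) * m t x) by exact: continuousMc.
rewrite [leRHS](_ : _ = int_torus (fun x => lap t x * dtt M (st x t) + dtt LU (st x t) * m t x)); last first.
  by apply: (congr1 (@int_torus R d)); apply/funext => x; exact: E.
rewrite (cintD HI) // (fokker_planck_dual tT (Clap 2 t) (plap tc)).
have cdd (f : 'rV[R]_d -> R) i : Ck 2 f -> continuous (fun x => dpartial i (dpartial i f) x).
  by move=> Cf; exact: Ck_cont (Ck_dpartial i (Ck_dpartial i Cf)).
have cA : continuous (fun x => (\sum_i dpartial i (dpartial i (lap t)) x -
    \sum_i drift H (u t) i x * dpartial i (lap t) x) * m t x).
  apply: continuousMc => //; apply: continuousDc; first by apply: continuous_sum => i; exact: cdd.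
  apply: continuousNc; apply: continuous_sum => i; apply: continuousMc.
    exact: Ck_cont (Cdr 0 t i).
  exact: Ck_cont (Ck_dpartial i (Clap 1 t)).
rewrite -(cintD HI) //.
have cgm i : continuous (fun x => dpartial i (dpartial i (g t)) x * m t x).
  by apply: continuousMc => //; apply: cdd; exact: Cg.
have -> : int_torus (fun x => (\sum_i dpartial i (dpartial i (lap t)) x -
    \sum_i drift H (u t) i x * dpartial i (lap t) x) * m t x + dtt LU (st x t) * m t x) =
  int_torus (fun x => second_order t x * m t x - \sum_i dpartial i (dpartial i (g t)) x * m t x).
  apply: (congr1 (@int_torus R d)); apply/funext => x.
  rewrite second_orderE dttLU -mulr_suml.
  have dg i : dpartial i (dpartial i (g t)) x = dpartial i (dpartial i (ham H (u t))) x -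
      (dpartial i (dpartial i (lap t)) x + dpartial i (dpartial i (w t)) x).
    have Cd (f : 'rV[R]_d -> R) : Ck 2 f -> Ck 1 (dpartial i f) by exact: Ck_dpartial.
    have Clw := CkD (Clap 2 t) (Cw 2 t).
    rewrite (gE tT) (dpartialD i (Cham 1 t) (CkN (CkS Clw))) (dpartialN i (CkS Clw)).
    rewrite (dpartialD i (Clap 1 t) (Cw 1 t)).
    have h2 := Cd _ (Clap 2 t); have h3 := Cd _ (Cw 2 t).
    rewrite (dpartialD i (Cd _ (Cham 2 t)) (CkN (CkD h2 h3))) (dpartialN i (CkD h2 h3)).
    by rewrite (dpartialD i h2 h3).
  (* The bilaplacian of u from the dual equation and Delta u_t are eliminated together by means of
     the Laplacian of the Hamilton-Jacobi equation. *)
  exact: (dual_cancel _ _ (sumB_eq dg)).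
rewrite (cintB HI); [|exact: continuousMc|exact: continuous_sum].
rewrite lerBrDr gerDl (cint_sum HI) //.
apply: sumr_le0 => i _.
have Cg1 := Cg 1 tT; have Cdg : Ck 1 (dpartial i (g t)) by exact: Ck_dpartial (Cg 2 tT).
have Cdm : Ck 1 (dpartial i (m t)) by exact: Ck_dpartial (Cm 2 t).
have pdg : Zperiodic (dpartial i (g t)) by apply: Zperiodic_dpartial; exact: pg.
have pdm : Zperiodic (dpartial i (m t)) by apply: Zperiodic_dpartial; exact: pM.
have := torus_ibp i (Cm 1 t) Cdg (pM tc) pdg.
have -> : (fun x => m t x * dpartial i (dpartial i (g t)) x) =
          (fun x => dpartial i (dpartial i (g t)) x * m t x).
  by apply/funext => x; rewrite mulrC.
move=> ->; rewrite (torus_ibp i Cdm Cg1 pdm (pg tc)) opprK.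
have := conv_pow_laplace_le0 Hk (Cm 2 t) (pM tc) (mpos tc) a0 i; rewrite -/(g t).
by congr (int_torus _ <= _); apply/funext => x; rewrite mulrC.
Qed.

Definition lagr (t : R) x := Lhat H x (grad (u t) x).

Let lagrE t x : lagr t x = \sum_i drift H (u t) i x * dpartial i (u t) x - ham H (u t) x.
Proof. by rewrite /lagr /Lhat /dotv; congr (_ - _); apply: eq_bigr => i _; rewrite [grad _ _ _ _]mxE. Qed.

Let c_lagr t : continuous (lagr t).
Proof.
rewrite (_ : lagr t = (fun x => \sum_i drift H (u t) i x * dpartial i (u t) x + - ham H (u t) x)).
  apply: continuousDc.
    apply: continuous_sum => i; apply: continuousMc; first exact: Ck_cont (Cdr 0 t i).
    exact: Ck_cont (Ck_dpartial i (Cu 1 t)).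
  exact: Ck_cont (CkN (Cham 0 t)).
by apply/funext => x; exact: lagrE.
Qed.

Let dP t : 0 < t < T -> is_derive t 1 P
  (- (int_torus (fun x => lagr t x * m t x) + int_torus (fun x => g t x * m t x))).
Proof.
move=> tT; have tc := tTc tT.
have CLM : Ck 1 (fun z => U z * M z) by apply: CkM.
have := torus_time_derive t CLM; rewrite -/P; set D := int_torus _; suff -> : D =
  - (int_torus (fun x => lagr t x * m t x) + int_torus (fun x => g t x * m t x)) by [].
have cdM : continuous (fun x => dtt M (st x t)) by exact: Ck_cont (Ck_slice t (Ck_dpartial _ (CM 1))).
have cw : continuous (w t) := Ck_cont (Cw 0 t).
have cu : continuous (u t) := Ck_cont (Cu 0 t).
have cg : continuous (g t) := Ck_cont (Cg 0 tT).
have cl := @c_lagr t.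
have cc1 : continuous (fun x => u t x * dtt M (st x t)) by exact: continuousMc.
have cc2 : continuous (fun x => w t x * m t x) by exact: continuousMc.
have cc3 : continuous (fun x => lagr t x * m t x) by exact: continuousMc.
have cc4 : continuous (fun x => g t x * m t x) by exact: continuousMc.
have cA : continuous (fun x => (\sum_i dpartial i (dpartial i (u t)) x -
    \sum_i drift H (u t) i x * dpartial i (u t) x) * m t x).
  apply: continuousMc => //; apply: continuousDc; first exact: Ck_cont (Clap 0 t).
  apply: continuousNc; apply: continuous_sum => i; apply: continuousMc.
    exact: Ck_cont (Cdr 0 t i).
  exact: Ck_cont (Ck_dpartial i (Cu 1 t)).
have -> : D = int_torus (fun x => u t x * dtt M (st x t) + w t x * m t x).
  apply: (congr1 (@int_torus R d)); apply/funext => x.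
  exact: (congr1 (fun f => f (st x t)) (dpartialM (ti d) (CU 1) (CM 1))).
rewrite (cintD HI) // (fokker_planck_dual tT (Cu 2 t) (pU tc)).
rewrite -!(cintD HI) // -(cintN HI); last exact: continuousDc.
apply: (congr1 (@int_torus R d)); apply/funext => x.
rewrite lagrE (gE tT); exact: lagr_cancel.
Qed.

(** Delta u integrates to zero and the integral of h is nonnegative, which leaves the coupling. *)
Let dQ t : 0 < t < T -> exists2 D, is_derive t 1 Q D & - int_torus (g t) <= D.
Proof.
move=> tT; have tc := tTc tT; exists (int_torus (w t)); first exact: torus_time_derive.
have cw : continuous (w t) := Ck_cont (Cw 0 t).
have cg : continuous (g t) := Ck_cont (Cg 0 tT).
have cl : continuous (lap t) := Ck_cont (Clap 0 t).
have ch : continuous (ham H (u t)) := Ck_cont (Cham 0 t).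
have E : w t = (fun x => ham H (u t) x - lap t x - g t x).
  by apply/funext => x; rewrite (gE tT); ring.
have chl : continuous (fun x => ham H (u t) x - lap t x).
  exact: (continuousDc ch (continuousNc cl)).
rewrite E (cintB HI) // (cintB HI) //.
have -> : int_torus (lap t) = 0.
  rewrite (cint_sum HI); last by move=> i; exact: Ck_cont (Ck_dpartial i (Ck_dpartial i (Cu 2 t))).
  apply: big1 => i _; apply: torus_dpartial; first exact: Ck_dpartial (Cu 2 t).
  by apply: Zperiodic_dpartial; exact: pU.
rewrite subr0 lerDr; apply: (cint_ge0 HI) => // x _.
by apply: le_trans (H1 _ _).
Qed.

Definition trpp (t : R) x :=
  \tr (D2ppH H x (grad (u t) x) *m (hess (u t) x *m hess (u t) x)).

Lemma trpp_continuous t : continuous (trpp t).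
Proof.
have cent (i j : 'I_d) : continuous (fun x => D2ppH H x (grad (u t) x) i j).
  rewrite (_ : (fun x => _) = (fun x =>
    dpartial (rshift d i) (dpartial (rshift d j) (joint H)) (row_mx x (grad (u t) x)))).
    apply: (@jcont_sec R R 'rV[R]_d (fun t x =>
      dpartial (rshift d i) (dpartial (rshift d j) (joint H)) (row_mx x (grad (u t) x))) t).
    apply: jcont_swap; apply: (graph_jcont).
    exact: Ck_cont (Ck_dpartial _ (Ck_dpartial _ (CH 2))).
  by apply/funext => x; exact: (D2ppHE CH).
have chs (i j : 'I_d) : continuous (fun x => hess (u t) x i j).
  rewrite (_ : (fun x => _) = dpartial i (dpartial j (u t))).
    exact: Ck_cont (Ck_dpartial i (Ck_dpartial j (Cu 2 t))).
  by apply/funext => x; rewrite mxE.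
rewrite (_ : trpp t = (fun x => \sum_i \sum_j D2ppH H x (grad (u t) x) i j *
   \sum_l hess (u t) x j l * hess (u t) x l i)).
  apply: continuous_sum => i; apply: continuous_sum => j; apply: continuousMc => //.
  by apply: continuous_sum => l; exact: (continuousMc (chs j l) (chs l i)).
apply/funext => x; rewrite /trpp /mxtrace; apply: eq_bigr => i _; rewrite mxE.
by apply: eq_bigr => j _; congr (_ * _); rewrite mxE.
Qed.

(* The functional Phi = W - K' (P - K Q) of the proof idea. *)
Definition energy (K' K : R) (t : R) :=
  int_torus (fun x => LU (st x t) * M (st x t)) -
  K' * (int_torus (fun x => U (st x t) * M (st x t)) - K * int_torus (fun x => U (st x t))).

Lemma energy_continuous K' K : continuous (energy K' K).
Proof.
have CL : continuous LU := Ck_cont (CLU 0).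
have CLM : continuous (fun z => LU z * M z).
  by apply: continuousMc; [exact: CL|exact: Ck_cont (CM 0)].
have CUM : continuous (fun z => U z * M z).
  by apply: continuousMc; [exact: Ck_cont (CU 0)|exact: Ck_cont (CM 0)].
have c1 := torus_time_cont CLM; have c2 := torus_time_cont CUM.
have c3 := torus_time_cont (Ck_cont (CU 0)).
move=> t; apply: cvgB; first exact: c1.
apply: cvgM; first exact: cvg_cst.
apply: cvgB; first exact: c2.
by apply: cvgM; [exact: cvg_cst|exact: c3].
Qed.

Hypothesis mass1 : int_torus (m 0) = 1.

(** The relation K' c = Ca + 1/2 makes K' times the bound (A3) outweigh the loss - Ca h and leave
    h/2. The coupling terms K' (int g m - K int g) are at least - K' K^(1 + alpha). *)
Lemma energy_derive (c C Ca K' K : R) :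
  (forall x p, c * H x p - C <= Lhat H x p) ->
  (forall x p (V : 'M[R]_d), V^T = V ->
    2^-1 * \tr (D2ppH H x p *m (V *m V)) - Ca * H x p <=
    \tr (D2xxH H x p) + 2 * \tr (D2pxH H x p *m V) + \tr (D2ppH H x p *m (V *m V))) ->
  0 <= K' -> 0 < K -> K' * c = Ca + 2^-1 ->
  forall t, 0 < t < T -> exists2 D, is_derive t 1 (energy K' K) D &
    2^-1 * int_torus (fun x => (ham H (u t) x + trpp t x) * m t x) -
    K' * (C + powR K (1 + alpha)) <= D.
Proof.
move=> hL hS K'0 K0 K'c t tT; have tc := tTc tT.
have [D1 hD1 leD1] := dW tT; have [D3 hD3 leD3] := dQ tT; have hD2 := dP tT.
set D2 := - _ in hD2.
exists (D1 - K' * (D2 - K * D3)).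
  have h3 := @is_deriveZ R R R Q K t 1 _ hD3.
  have h2 := @is_deriveB R R R P (fun t => K * Q t) t 1 _ _ hD2 h3.
  have h1 := @is_deriveZ R R R (fun t => P t - K * Q t) K' t 1 _ h2.
  exact: (@is_deriveB R R R W (fun t => K' * (P t - K * Q t)) t 1 _ _ hD1 h1).
have gm := conv_pow_integral_le Hk (Cm 2 t) (pM tc) (mpos tc) a0 K0; rewrite -/(g t) in gm.
have cs := @c_second_order t; have cl := @c_lagr t; have ct := @trpp_continuous t.
have ch : continuous (ham H (u t)) := Ck_cont (Cham 0 t).
have cht : continuous (fun x => (ham H (u t) x + trpp t x) * m t x).
  by apply: continuousMc => //; exact: continuousDc.
have csm : continuous (fun x => second_order t x * m t x) by exact: continuousMc.
have clm : continuous (fun x => lagr t x * m t x) by exact: continuousMc.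
have main : 2^-1 * int_torus (fun x => (ham H (u t) x + trpp t x) * m t x) - K' * C <=
    int_torus (fun x => second_order t x * m t x) + K' * int_torus (fun x => lagr t x * m t x).
  (* The mass is 1, so the constant can be put under the integral and the inequality proved
     pointwise with weight m. *)
  have -> : K' * C = K' * C * int_torus (m t) by rewrite (mass_conserved mass1 tc) mulr1.
  rewrite -!(cintZ HI) // -(cintB HI); [|exact: continuousZc|exact: continuousZc].
  rewrite -(cintD HI) //; last exact: continuousZc.
  apply: (cint_le HI).
  - by apply: continuousDc; [exact: continuousZc|apply: continuousNc; exact: continuousZc].
  - by apply: continuousDc => //; exact: continuousZc.
  move=> x _.
  have h1 := hL x (grad (u t) x).
  have h2 := hS x (grad (u t) x) (hess (u t) x) (hess_sym (fun l => Cu l t) x).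
  rewrite -/(trpp t x) -/(lagr t x) -/(ham H (u t) x) in h1 h2.
  rewrite -[X in _ <= X](_ : (second_order t x + K' * lagr t x) * m t x = _); last by ring.
  rewrite -[X in X <= _](_ : (2^-1 * (ham H (u t) x + trpp t x) - K' * C) * m t x = _); last by ring.
  rewrite ler_wpM2r ?(ltW (mpos tc x)) //.
  apply: (le_trans _ (lerD h2 (ler_wpM2l K'0 h1))).
  move: K'c; move: (trpp t x) (ham H (u t) x) => a b K'c.
  rewrite mulrBr mulrA K'c; lra.
have := ler_wpM2l K'0 gm; have := ler_wpM2l (mulr_ge0 K'0 (ltW K0)) leD3.
rewrite /D2; move: main leD1.
move: (int_torus _) (int_torus _) (int_torus _) (int_torus _) (int_torus _) (powR _ _) => A B E F G pw.
by rewrite !mulrDr !mulrN; move=> *; lra.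
Qed.

End mean_field_game.

(** * Bounds independent of the regularization *)

Lemma energy_weight (A : comPzRingType) (u l c k m : A) :
  u * ((l + c) - k * m) = (u * l + c * u) - k * (u * m).
Proof. by ring. Qed.

Section energy_gap.
Context {R : realType}.
Variables (d : nat) (U M : 'rV[R]_(d + 1) -> R).
Hypotheses (CU : forall k, Ck k U) (CM : forall k, Ck k M).
Let HI := @cintT R d.

(** The energy as a functional of a single slice, so that the data can be substituted at t = T and t
    = 0. *)
Let slice_energy (K' K : R) (u m : 'rV[R]_d -> R) :=
  int_torus (fun x => (\sum_i dpartial i (dpartial i u) x) * m x) -
  K' * (int_torus (fun x => u x * m x) - K * int_torus u).

Lemma energyE K' K t : energy U M K' K t =
  slice_energy K' K (fun x => U (st x t)) (fun x => M (st x t)).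
Proof.
apply: (congr1 (fun r => r - _)); apply: (congr1 (@int_torus R d)); apply/funext => x.
apply: (congr1 (fun r => r * M (st x t))); apply: eq_bigr => i _.
exact: esym (congr1 (fun f => f x) (dpartial2_slice i i t (CU 2))).
Qed.

Lemma slice_energy_le (K' K L0 L1 : R) (u m : 'rV[R]_d -> R) : Ck 2 u -> Ck 2 m ->
  0 <= K' -> 0 <= K -> (forall x, 0 < m x) -> int_torus m = 1 ->
  (forall x, `|u x| <= L0) -> (forall x, `|\sum_i dpartial i (dpartial i u) x| <= L1) ->
  slice_energy K' K u m <= L1 + K' * (L0 + K * L0).
Proof.
move=> Cu Cm K'0 K0 m0 m1 uL lL.
have cu := Ck_cont Cu; have cm := Ck_cont Cm.
have cl : continuous (fun x => \sum_i dpartial i (dpartial i u) x).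
  by apply: continuous_sum => i; exact: Ck_cont (Ck_dpartial i (Ck_dpartial i Cu)).
have cc a : continuous (fun x => a * m x) by exact: (continuousMc (@cst_continuous _ _ a) cm).
have h1 : int_torus (fun x => (\sum_i dpartial i (dpartial i u) x) * m x) <= L1.
  rewrite -[leRHS]mulr1 -m1 -(cintZ HI) //; apply: (cint_le HI) => // [|x _].
    exact: continuousMc.
  by rewrite ler_wpM2r ?(ltW (m0 x)) // (le_trans (ler_norm _)).
have h2 : - L0 <= int_torus (fun x => u x * m x).
  rewrite -[leLHS]mulr1 -m1 -(cintZ HI) //; apply: (cint_le HI) => // [|x _].
    exact: continuousMc.
  by rewrite ler_wpM2r ?(ltW (m0 x)) //; have := uL x; rewrite ler_norml => /andP[].
have h3 : int_torus u <= L0.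
  rewrite -[leRHS]mulr1 -(cint_cst HI L0); apply: (cint_le HI) => // [|x _].
    exact: cst_continuous.
  by rewrite (le_trans (ler_norm _)).
have h4 : K' * - (int_torus (fun x => u x * m x) - K * int_torus u) <= K' * (L0 + K * L0).
  rewrite ler_wpM2l // opprB addrC lerD ?ler_wpM2l // lerNl.
  exact: h2.
by rewrite /slice_energy -mulrN; exact: lerD h1 h4.
Qed.

(* Integrating by parts, the energy is int u w with w = Delta m + K' K - K' m >= 0. *)
Lemma slice_energy_ge (K' K C0 : R) (u m : 'rV[R]_d -> R) : Ck 2 u -> Ck 2 m ->
  Zperiodic u -> Zperiodic m -> int_torus m = 1 -> (forall x, - C0 <= u x) ->
  (forall x, K' * m x - \sum_i dpartial i (dpartial i m) x <= K' * K) ->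
  - (C0 * (K' * (K - 1))) <= slice_energy K' K u m.
Proof.
move=> Cu Cm pu pm m1 uC mK; have cu := Ck_cont Cu; have cm := Ck_cont Cm.
have cdm i : continuous (dpartial i (dpartial i m)).
  exact: Ck_cont (Ck_dpartial i (Ck_dpartial i Cm)).
have cl : continuous (fun x => \sum_i dpartial i (dpartial i m) x) by exact: continuous_sum.
pose w x := (\sum_i dpartial i (dpartial i m) x + K' * K) - K' * m x.
have c1 : continuous (fun x => \sum_i dpartial i (dpartial i m) x + K' * K).
  exact: (continuousDc cl (@cst_continuous _ _ _)).
have cw : continuous w by exact: (continuousDc c1 (continuousNc (continuousZc cm))).
have l0 : int_torus (fun x => \sum_i dpartial i (dpartial i m) x) = 0.
  rewrite (cint_sum HI) //; apply: big1 => i _; apply: torus_dpartial; first exact: Ck_dpartial.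
  exact: Zperiodic_dpartial.
have Iw : int_torus w = K' * (K - 1).
  rewrite (cintB HI) //; last exact: continuousZc.
  rewrite (cintD HI) //; last exact: cst_continuous.
  by rewrite l0 (cint_cst HI) (cintZ HI) // m1 add0r mulr1 mulrBr mulr1.
have -> : slice_energy K' K u m = int_torus (fun x => u x * w x).
  rewrite /slice_energy (torus_laplace_sym Cu Cm pu pm).
  have e : (fun x => u x * w x) = (fun x => (u x * \sum_i dpartial i (dpartial i m) x +
      (K' * K) * u x) - K' * (u x * m x)).
    by apply/funext => x; exact: energy_weight.
  have cul : continuous (fun x => u x * \sum_i dpartial i (dpartial i m) x) by exact: continuousMc.
  have cum : continuous (fun x => u x * m x) by exact: continuousMc.
  rewrite e (cintB HI); [|exact: (continuousDc cul (continuousZc cu))|exact: continuousZc].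
  rewrite (cintD HI) //; last exact: continuousZc.
  by rewrite !(cintZ HI) // mulrBr opprB mulrA addrCA addrA [_ + int_torus _]addrC.
rewrite -Iw -mulNr -(cintZ HI) //; apply: (cint_le HI) => [||x _]; first exact: continuousZc.
  exact: continuousMc.
by rewrite ler_wpM2r // /w subr_ge0; have := mK x; rewrite lerBlDl.
Qed.

End energy_gap.

(** * Choice of the constants and the uniform moment bound *)

Section uniform_bound.
Context {R : realType}.
Variables (n : nat) (T : R) (H : 'rV[R]_n.+2 -> 'rV[R]_n.+2 -> R) (alpha mu kappa q : R).
Variables (uT mi : 'rV[R]_n.+2 -> R).
Hypotheses (T0 : 0 < T) (CH : forall k, Ck k (joint H)).
Hypothesis pH : forall p, Zperiodic (fun x => H x p).
Hypothesis H1 : forall x p, 1 <= H x p.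
Hypotheses (a0 : 0 < alpha) (CuT : forall k, Ck k uT) (puT : Zperiodic uT).
Hypotheses (Cmi : forall k, Ck k mi) (pmi : Zperiodic mi) (mi1 : int_torus mi = 1).
Hypothesis A3 : exists c C : R, [/\ 0 < c, 0 < C & forall x p, c * H x p - C <= Lhat H x p].
Hypothesis A5a : exists C : R, forall x p,
  euclid_norm (DxH H x p) <= C * H x p + C /\ frob_norm (D2xxH H x p) <= C * H x p + C.
Hypothesis A5b : forall delta : R, 0 < delta -> exists Cd : R,
  forall (V : 'M[R]_n.+2), V^T = V -> forall x p,
  \tr (D2pxH H x p *m V) <= delta * \tr (D2ppH H x p *m (V *m V)) + Cd * H x p.
Hypotheses (kappa0 : 0 < kappa) (mik : forall x, kappa <= mi x) (mu01 : 0 < mu < 1).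
Hypothesis A9 : exists C : R, forall x p,
  frob_norm (D2xpH H x p) ^+ 2 <= C * powR (H x p) ((2 + 2 * mu) / (2 + mu)) /\
  forall (V : 'M[R]_n.+2), V^T = V ->
    frob_norm (D2ppH H x p *m V) ^+ 2 <=
    C * powR (H x p) (mu / (2 + mu)) * \tr (D2ppH H x p *m (V *m V)).
Hypotheses (q1 : 1 <= q) (hq : 1 + (q - 1) * (2 + mu) <= q * (1 + 2 * n.+2%:R^-1)).
Hypothesis hmu : 2 * n.+2%:R^-1 < 1 + mu.

(** The kernel is quantified inside, so a bound valid for all such pairs is automatically
    independent of eps and of the mollifier. *)
Definition regularized_solution (U M : 'rV[R]_(n.+2 + 1) -> R) :=
  let u t := fun x => U (st x t) in let m t := fun x => M (st x t) in
  (((forall k, Ck k U) /\ (forall k, Ck k M)) /\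
   ((forall t, 0 <= t <= T -> Zperiodic (u t)) /\ (forall t, 0 <= t <= T -> Zperiodic (m t)))) /\
  [/\ (exists (k : 'rV[R]_n.+2 -> R) (N : R), kernel_on k N /\ forall x t, 0 < t < T ->
        - dtt U (st x t) + ham H (u t) x = \sum_i dpartial i (dpartial i (u t)) x +
          tconv k (fun y => powR (tconv k (m t) y) alpha) x),
      (forall x t, 0 < t < T ->
        dtt M (st x t) - \sum_i dpartial i (fun y => m t y * drift H (u t) i y) x =
        \sum_i dpartial i (dpartial i (m t)) x),
      u T = uT & m 0 = mi].

Lemma moment_uniform_bound : exists Kb, forall U M, regularized_solution U M ->
  forall t, 0 <= t <= T -> (forall x, 0 < M (st x t)) /\
    int_torus (fun x => powR (M (st x t)) q) <= Kb.
Proof.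
have HI := @cintT R n.+2; have /andP[mu0 mu1] := mu01.
have [c0 [C [c00 C0 hL]]] := A3.
have [Ca Ca0 hS] := second_order_ge H1 A5a A5b.
have [Cb Cb0 hD] := div_drift_le H1 mu01 A9.
have [L0 L00 uTL] := periodic_bounded (Ck_cont (CuT 0)) puT.
have [L1 L10 uTL1] : exists2 c, 0 < c & forall x, `|\sum_i dpartial i (dpartial i uT) x| <= c.
  apply: periodic_bounded.
    by apply: continuous_sum => i; exact: Ck_cont (Ck_dpartial i (Ck_dpartial i (CuT 2))).
  by apply: Zperiodic_sum => i; do 2 apply: Zperiodic_dpartial.
have [cH cH0 hH] : exists2 c, 0 < c & forall x, `|H x 0| <= c.
  apply: periodic_bounded (pH 0).
  rewrite (_ : (fun x => _) = (fun x => joint H (row_mx x 0))).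
    apply: (row_mx_cont (f := fun x : 'rV[R]_n.+2 => x) (g := fun=> 0) (Ck_cont (CH 0))).
      by move=> x; exact: cvg_id.
    exact: cst_continuous.
  by apply/funext => x; rewrite /joint row_mxKl row_mxKr.
(* Solves K' c0 = Ca + 1/2, as [energy_derive] requires. *)
pose K' := (Ca + 2^-1) / c0.
have K'0 : 0 < K' by rewrite divr_gt0 // ltr_wpDl.
have K'c : K' * c0 = Ca + 2^-1 by rewrite divfK // gt_eqF.
have [mm mm0 hmm] : exists2 c, 0 < c &
    forall x, `|K' * mi x + - \sum_i dpartial i (dpartial i mi) x| <= c.
  apply: periodic_bounded.
    apply: continuousDc.
      by apply: continuousMc; [exact: cst_continuous|exact: Ck_cont (Cmi 0)].
    apply: continuousNc; apply: continuous_sum => i.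
    exact: Ck_cont (Ck_dpartial i (Ck_dpartial i (Cmi 2))).
  have ps : Zperiodic (fun x => \sum_i dpartial i (dpartial i mi) x).
    by apply: Zperiodic_sum => i; do 2 apply: Zperiodic_dpartial.
  by move=> x i; exact: (congr2 (fun a b : R => K' * a + - b) (pmi x i) (ps x i)).
(* Chosen so that K' K = mm, which makes the weight Delta m_0 + K' K - K' m_0 at t = 0
   nonnegative. *)
pose K := mm / K'; have K0 : 0 < K by rewrite divr_gt0.
have K'K : K' * K = mm by rewrite mulrC divfK // gt_eqF.
pose Cu := L0 + (cH + 1) * T.
(* Upper bound at t = T minus lower bound at t = 0; the last term is Cu times the integral K' (K -
   1) of that weight. The absolute value is used below because the bound on Phi T - Phi 0 is
   required to be nonnegative. *)
pose gap := L1 + K' * (L0 + K * L0) + Cu * (K' * (K - 1)).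
pose C2 := K' * (C + powR K (1 + alpha)).
have C20 : 0 <= C2 by rewrite mulr_ge0 ?(ltW K'0) // addr_ge0 ?powR_ge0 // ltW.
pose c : R := n.+2%:R^-1; pose beta := q * (1 + 2 * c) * (1 - c).
pose CG := n.+2%:R ^+ 2 * (2 * (1 + beta ^+ 2)).
have CG1 : 1 <= CG.
  have h1 : 1 <= n.+2%:R ^+ 2 :> R by rewrite exprn_ege1 // ler1n.
  have h2 : 1 <= 2 * (1 + beta ^+ 2) by have := sqr_ge0 beta; move: (beta ^+ 2) => z; lra.
  by rewrite -[1]mulr1 ler_pM.
have c00' : 0 < c by rewrite invr_gt0 ltr0n.
have [Kb hKb] := moment_bound (int_torus (fun x => powR (mi x) q)) T0 q1 mu0 c00' hmu Cb0 CG1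
  C20 (normr_ge0 gap).
exists Kb => U M [[[CU CM] [pU pM]] [[k [N [Hk eqU]]] eqM uTE miE]].
have mass1 : int_torus (fun x => M (st x 0)) = 1 by rewrite miE.
have M0k x : kappa <= M (st x 0) by have := congr1 (fun f => f x) miE => ->.
have mpos := density_gt0 T0 CH pH CU CM pU pM eqM kappa0 M0k.
have T00 : (0 : R) <= 0 <= T by rewrite lexx ltW.
have TT : 0 <= T <= T by rewrite lexx ltW.
have mass t := @mass_conserved R n.+2 T H U M CH pH CU CM pU pM eqM mass1 t.
have Ep : energy U M K' K T - energy U M K' K 0 <= `|gap|.
  apply: (le_trans _ (ler_norm _)); rewrite /gap !(energyE M CU).
  have uTb x : `|U (st x T)| <= L0 by have := congr1 (fun f => f x) uTE => ->.
  have h1 := slice_energy_le (Ck_slice T (CU 2)) (Ck_slice T (CM 2)) (ltW K'0) (ltW K0)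
    (fun x => mpos x T TT) (mass T TT) uTb.
  have h2 : - (Cu * (K' * (K - 1))) <= energy U M K' K 0.
    rewrite (energyE M CU); apply: slice_energy_ge => //.
    - exact: Ck_slice (CU 2).
    - exact: Ck_slice (CM 2).
    - exact: pU.
    - exact: pM.
    - move=> x; have := value_lower_bound T0 CU CM pU pM mpos Hk eqU (cT := L0) (cH := cH).
      move=> /(_ _ _ x 0 T00); rewrite subr0; apply => y.
        by have := uTb y; rewrite ler_norml => /andP[].
      exact: le_trans (ler_norm _) (hH y).
    - move=> x; rewrite K'K; have := hmm x; rewrite -miE; exact: le_trans (ler_norm _).
  rewrite (energyE M CU) in h2; rewrite -lerN2 opprK in h2.
  by apply: lerD => //; apply: h1; rewrite uTE.
move=> t tT; split; first by move=> x; exact: mpos.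
move: t tT; apply: (hKb (fun t => int_torus (fun x => powR (M (st x t)) q)) (energy U M K' K)).
- exact: (moment_continuous T0 CM pM mpos).
- exact: energy_continuous.
- move=> t tT; apply: (cint_ge0 HI) => [|x _]; last exact: powR_ge0.
  by apply: (Ck_cont (Ck_powR q (Ck_slice t (CM 0)) _)) => x; exact: mpos.
- move=> t tT; have tTc : 0 <= t <= T by have /andP[? ?] := tT; rewrite !ltW.
  have [DP hDP leDP] := energy_derive CH pH CU CM pU pM eqM mpos Hk a0 eqU H1 mass1 hL hS
    (ltW K'0) K0 K'c tT.
  have dy := moment_is_derive CH pH CU CM pU pM eqM mpos q tT.
  pose m x := M (st x t); pose X x := ham H (fun x => U (st x t)) x + trpp H U t x.
  have Cm l : Ck l m by exact: Ck_slice.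
  have Cul l : Ck l (fun x => U (st x t)) by exact: Ck_slice.
  have m0 x : 0 < m x by exact: mpos.
  have X0 x : 0 <= X x.
    rewrite addr_ge0 //; first exact: le_trans (H1 _ _).
    exact: (tr_pp_ge0 H1 A9 _ _ (hess_sym Cul x)).
  have cX : continuous X.
    apply: continuousDc; last exact: trpp_continuous.
    exact: (Ck_cont (Ck_ham CH Cul 0)).
  have cdm i : continuous (dpartial i m) by exact: Ck_cont (Ck_dpartial i (Cm 1)).
  have cE : continuous (fun x => powR (m x) (q - 2) * \sum_i dpartial i m x ^+ 2).
    apply: continuousMc; first exact: (Ck_cont (Ck_powR (q - 2) (Cm 0) m0)).
    by apply: continuous_sum => i; exact: (continuousMc (cdm i) (cdm i)).
  have cXm : continuous (fun x => X x * m x) by exact: (continuousMc cX (Ck_cont (Cm 0))).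
  have E0 : 0 <= int_torus (fun x => powR (m x) (q - 2) * \sum_i dpartial i m x ^+ 2).
    apply: (cint_ge0 HI) => // x _; rewrite mulr_ge0 ?powR_ge0 // sumr_ge0 // => i _.
    exact: sqr_ge0.
  have B0 : 0 <= int_torus (fun x => X x * m x).
    by apply: (cint_ge0 HI) => // x _; rewrite mulr_ge0 // ltW.
  eexists; exists DP, (int_torus (fun x => X x * m x)),
    (int_torus (fun x => powR (m x) (q - 2) * \sum_i dpartial i m x ^+ 2)).
  split; [exact: dy|exact: hDP|exact: E0| |].
    by rewrite B0 /= -ler_pdivrMl // -lerBlDr.
  move=> l l0; rewrite ler_wpM2l ?subr_ge0 //.
  have cdd : continuous (divdrift H (fun x => U (st x t))).
    exact: (@jcont_sec R R 'rV[R]_n.+2 (fun t x => divdrift H (fun x => U (st x t)) x) t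
      (jcont_swap (divdrift_jcont CH CU))).
  have hdd x : `|divdrift H (fun x => U (st x t)) x| <= Cb * powR (X x) ((1 + mu) / (2 + mu)).
    rewrite (divdriftE CH Cul); exact: hD (hess_sym Cul x).
  (* The dissipation in the derivative is q E, and it is weakened to E by q >= 1. *)
  apply: lerB; first exact: (flux_le (Cm 1) m0 cX cdd X0 hdd mu0 Cb0 q1 hq l0).
  exact: ler_peMl.
- exact: Ep.
- by rewrite -miE.
Qed.

End uniform_bound.

(** The pair (u, m) is replaced by smooth extensions to all times. Space derivatives agree slice by
    slice on [0, T], and time derivatives at interior times, where the functions coincide in a
    neighbourhood. *)
Lemma reg_solution_regularized (R : realType) n (T : R) (H : 'rV[R]_n.+2 -> 'rV[R]_n.+2 -> R)
  (alpha eps : R) (eta uT mi : 'rV[R]_n.+2 -> R) (u m : 'rV[R]_n.+2 -> R -> R) :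
  0 < T -> 0 < eps -> mollifier eta -> reg_solution T H alpha eta eps uT mi u m ->
  exists U M : 'rV[R]_(n.+2 + 1) -> R, regularized_solution T H alpha uT mi U M /\
    forall x t, 0 <= t <= T -> M (st x t) = m x t.
Proof.
move=> T0 eps0 moll [[[[U [CU UE]] pu] [[M [CM ME]] pm]] equ eqm uTE m0E].
have Us t : 0 <= t <= T -> (fun x => U (st x t)) = (fun x => u x t).
  by move=> tT; apply/funext => x; exact: UE.
have Ms t : 0 <= t <= T -> (fun x => M (st x t)) = (fun x => m x t).
  by move=> tT; apply/funext => x; exact: ME.
have tc t : 0 < t < T -> 0 <= t <= T by move=> /andP[? ?]; rewrite !ltW.
have dt (F : 'rV[R]_(n.+2 + 1) -> R) (f : 'rV[R]_n.+2 -> R -> R) x t : Cinf F ->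
    (forall x t, 0 <= t <= T -> F (st x t) = f x t) -> 0 < t < T -> dtt F (st x t) = dtime f x t.
  move=> CF FE tT; have h := is_derive_st x t (Cinf_Ck 1 CF).
  have nE : \near t, F (st x t) = f x t.
    have /andP[t0 tT'] := tT; near=> s; apply: FE; apply: tc.
    by apply/andP; split; near: s; [exact: lt_nbhsr|exact: lt_nbhsl].
  by have [_ E] := @near_eq_is_derive R R R (fun s => F (st x s)) (f x) t 1 _ nE h; exact: esym E.
have TT : 0 <= T <= T by rewrite lexx ltW.
have T00 : (0 : R) <= 0 <= T by rewrite lexx ltW.
exists U, M; split; last exact: ME.
split; first split.
- by split => k; exact: Cinf_Ck.
- by split => t tT; [rewrite Us|rewrite Ms].
split.
- exists (eta_eps eta eps), eps; split; first exact: kernel_eta_eps.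
  move=> x t tT; rewrite (dt U u x t CU UE tT) (Us t (tc t tT)) (Ms t (tc t tT)).
  exact: equ.
- move=> x t tT; rewrite (dt M m x t CM ME tT) (Us t (tc t tT)) (Ms t (tc t tT)).
  apply: etrans _ (eqm x t tT); apply: (congr1 (fun r => _ - r)); apply: eq_bigr => i _.
  apply: (congr1 (fun f => dpartial i f x)); apply/funext => y; rewrite [RHS]mxE.
  by have := congr1 (fun f => f y) (Ms t (tc t tT)) => ->.
- by rewrite Us //; apply/funext.
- by rewrite Ms //; apply/funext.
Unshelve. all: by end_near.
Qed.

Theorem theorem5 (R : realType) (d : nat) (T : R)
  (H : 'rV[R]_d -> 'rV[R]_d -> R) (alpha mu kappa0 : R)
  (uT m0 eta : 'rV[R]_d -> R) :
  (2 <= d)%N -> 0 < T ->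
  (* (A1) *)
  smooth2 H -> (forall p, Zperiodic (fun x => H x p)) ->
  (forall x p q lam, p != q -> 0 < lam < 1 ->
     H x (lam *: p + (1 - lam) *: q) < lam * H x p + (1 - lam) * H x q) ->
  (forall x (M : R), exists K : R, forall p,
     K <= euclid_norm p -> M <= H x p / euclid_norm p) ->
  (forall x p, 1 <= H x p) ->
  (* (A2) and (A4): g(z) = z^alpha *)
  0 < alpha ->
  Cinf uT -> Zperiodic uT -> Cinf m0 -> Zperiodic m0 ->
  (forall x, 0 <= m0 x) -> int_torus m0 = 1 ->
  (* (A3) *)
  (exists c C : R, [/\ 0 < c, 0 < C &
     forall x p, c * H x p - C <= Lhat H x p]) ->
  (* (A5) *)
  (exists C : R, forall x p,
     euclid_norm (DxH H x p) <= C * H x p + C /\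
     frob_norm (D2xxH H x p) <= C * H x p + C) ->
  (forall delta : R, 0 < delta -> exists Cd : R,
     forall (M : 'M[R]_d), M^T = M -> forall x p,
       \tr (D2pxH H x p *m M)
         <= delta * \tr (D2ppH H x p *m (M *m M)) + Cd * H x p) ->
  (* (A6) *)
  0 < kappa0 -> (forall x, kappa0 <= m0 x) ->
  (* (A9) *)
  0 < mu < 1 ->
  (exists C : R, forall x p,
     frob_norm (D2xpH H x p) ^+ 2
       <= C * powR (H x p) ((2 + 2 * mu) / (2 + mu)) /\
     forall (M : 'M[R]_d), M^T = M ->
       frob_norm (D2ppH H x p *m M) ^+ 2
         <= C * powR (H x p) (mu / (2 + mu)) * \tr (D2ppH H x p *m (M *m M))) ->
  (* eta: standard symmetric mollifying kernel *)
  mollifier eta ->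
  forall r : R, 1 <= r -> r < (d%:R * (1 + mu)) / (d%:R * (1 + mu) - 2) ->
  exists C : R, forall (eps : R) (u m : 'rV[R]_d -> R -> R),
    0 < eps -> reg_solution T H alpha eta eps uT m0 u m ->
    forall t, 0 <= t <= T -> Lr_norm r (fun x => m x t) <= C.
Proof.
case: d H uT m0 eta => [//|[//|n]] H uT m0 eta _ T0 CH pH _ _ H1 a0 CuT puT Cm0 pm0 _ m01.
move=> A3 A5a A5b k0 m0k mu01 A9 moll r r1 hr.
have /andP[mu0 _] := mu01.
have d2 : 2 <= n.+2%:R :> R by rewrite ler_nat.
have hq := exponent_le d2 mu0 r1 hr.
(* As d >= 2, 2/d <= 1 < 1 + mu; this puts the exponent of the final absorption below 1. *)
have hmu : 2 * n.+2%:R^-1 < 1 + mu.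
  apply: (@le_lt_trans _ _ 1); last by rewrite ltrDl.
  by rewrite ler_pdivrMr ?mul1r // ltr0n.
have [Kb hKb] := moment_uniform_bound T0 (fun k => Cinf_Ck k CH) pH H1 a0 (fun k => Cinf_Ck k CuT) puT
  (fun k => Cinf_Ck k Cm0) pm0
  m01 A3 A5a A5b k0 m0k mu01 A9 r1 hq hmu.
(* The sign of Kb is not recorded, and [powR] is monotone on nonnegative reals, hence the maximum
   with 0. *)
exists (powR (Num.max Kb 0) r^-1) => eps u m eps0 sol t tT.
have [U [M [solUM ME]]] := reg_solution_regularized T0 eps0 moll sol.
have [M0 hM] := hKb U M solUM t tT.
have [[[CU CM] _] _] := solUM.
rewrite /Lr_norm (_ : (fun x => powR `|m x t| r) = (fun x => powR (M (st x t)) r)); last first.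
  by apply/funext => x; rewrite -ME // gtr0_norm.
have ri : 0 <= r^-1 by rewrite invr_ge0 (le_trans _ r1).
apply: (@ge0_ler_powR R r^-1 ri); rewrite ?nnegrE ?le_max ?lexx ?orbT ?hM //.
apply: (cint_ge0 (cintT n.+2)) => [|x _]; last exact: powR_ge0.
exact: Ck_cont (Ck_powR r (Ck_slice t (CM 0)) M0).
Qed.
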